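(* Let $p$ be a prime number, let $t\ge 3$ be an integer with $p\nmid t$, and let $$g_t(x,y):=\frac{(x+1)^t-x^t-(y+1)^t+y^t}{x-y}\in\mathbb{F}_p[x,y].$$ Then $g_t(x,y)$ has an absolutely irreducible factor defined over $\mathbb{F}_p$ in each of the following cases. **(A)** $t\not\equiv 1 \pmod p$ and at least one of the following conditions holds: (a) either $\gcd(p-1,t)\ge 3$ or $\gcd(p-1,t-1)\ge 2$; ($\hat a$) there exists $m\in\mathbb{N}$ such that $g_t(x,y)$ does not factor over $\mathbb{F}_{p^m}$ (i.e. is irreducible in $\mathbb{F}_{p^m}[x,y]$) and, furthermore, either $\gcd(p^m-1,t)\ge 3$ or $\gcd(p^m-1,t-1)\ge 2$; (b) the number of singular points of the curve defined by $g_t(x,y)=0$ over an algebraic closure of $\mathbb{F}_p$ is less than $\frac{(t-2)^2}{4}$; (c) $t$ is even and, for every $(t-1)$-th root of unity $s\neq 1$ in an algebraic closure of $\mathbb{F}_p$, $(s-1)^{t-1}\notin\mathbb{F}_p$ and $(s-1)^{(t-1)(p-1)}\neq -1$; (d) $t$ is even and $t-1$ divides $p^{2e}+1$ for some positive integer $e$; (e) $t-1\ge 3$ is a prime number such that the multiplicative order of $p$ in $\mathbb{Z}/(t-1)\mathbb{Z}$ is $(t-2)/2$; (f) setting $e:=\gcd(e_{t-1},e_t)$, either (1) there exists a divisor $d>2$ of $t$ such that $\gcd(e,e_d)=1$, or (2) there exists a divisor $d>1$ of $t-1$ such that $\gcd(e,e_d)=1$; (g) $g_t(x,y)$ is irreducible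 over $\mathbb{F}_p$ and $\gcd(e_d\mid d\in E)=1$, where $E:=\{d\in\mathbb{N}\mid d>2 \text{ and } d \text{ divides either } t \text{ or } t-1\}$. **(B)** $t\equiv 1\pmod p$, written as $t=p^i\ell+1$ with $i\ge 1$ and $p\nmid \ell$, and one of the following holds: (B.1) $\gcd(\ell,p^i-1)<\ell$ and at least one of these conditions holds: $p\ge 5$, $i\ge 1$ and $\ell>3$; or $p\ge 5$, $i\ge 2$ and $\ell\ge 3$; or $p=3$, $i\ge 2$ and $\ell\ge 3$; (B.2) $\gcd(\ell,p^i-1)=\ell$ and $1<\ell<p^i-1$.
   Context: For a positive integer $n$ not divisible by $p$, $e_n$ denotes the multiplicative order of $p$ in $\mathbb{Z}/n\mathbb{Z}$. A polynomial over $\mathbb{F}_p$ is absolutely irreducible if it is irreducible over an algebraic closure of $\mathbb{F}_p$. A singular point of the affine plane curve $h(x,y)=0$ is a point at which $h$ and both of its first partial derivatives vanish (equivalently, a point where $h$ has multiplicity at least $2$). *)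

(* Defs.v *)
From HB Require Import structures.
From mathcomp Require Import all_boot all_order all_fingroup all_algebra cyclic.

Set Implicit Arguments.
Unset Strict Implicit.
Unset Printing Implicit Defensive.

Import GRing.Theory.
Local Open Scope ring_scope.

(* F[x, y] is {poly {poly F}} with the conventions of polyXY: x is the outer
   variable 'X and y is the inner one, 'Y := 'X%:P; u.[a, b] substitutes a for
   x and b for y. *)

Definition irreducible_elt (R : idomainType) (r : R) : Prop :=
  [/\ r != 0, r \isn't a GRing.unit &
      forall a b : R, r = a * b -> a \is a GRing.unit \/ b \is a GRing.unit].

Definition extend_scalars (F L : fieldType) (phi : {rmorphism F -> L})
    (u : {poly {poly F}}) : {poly {poly L}} :=
  map_poly (map_poly phi) u.

(* Meant to be used when iota embeds F in an algebraic closure of F. *)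
Definition absolutely_irreducible (F : fieldType) (K : closedFieldType)
    (iota : {rmorphism F -> K}) (u : {poly {poly F}}) : Prop :=
  irreducible_elt (extend_scalars iota u).

Definition has_abs_irreducible_factor (F : fieldType) (K : closedFieldType)
    (iota : {rmorphism F -> K}) (u : {poly {poly F}}) : Prop :=
  exists f : {poly {poly F}},
    (exists h : {poly {poly F}}, u = f * h) /\ absolutely_irreducible iota f.

Definition singular_point (K : fieldType) (h : {poly {poly K}}) (a : K * K) :=
  [/\ h.[a.1, a.2] = 0, h^`().[a.1, a.2] = 0 &
      (map_poly (@deriv K) h).[a.1, a.2] = 0].

Definition g_numerator (F : fieldType) (t : nat) : {poly {poly F}} :=
  ('X + 1) ^+ t - 'X ^+ t - ('Y + 1) ^+ t + 'Y ^+ t.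

(* %/ is Euclidean division in the outer variable by the monic 'X - 'Y; it is
   exact by g_polyP. *)
Definition g_poly (F : fieldType) (t : nat) : {poly {poly F}} :=
  g_numerator F t %/ ('X - 'Y).

Lemma g_polyP (F : fieldType) (t : nat) :
  g_poly F t * ('X - 'Y) = g_numerator F t.
Proof.
rewrite /g_poly; set d := 'X - 'Y.
have dmon : d \is monic by rewrite monicXsubC.
have rt : root (g_numerator F t) 'X.
  rewrite rootE /g_numerator !(hornerE, horner_exp).
  by rewrite [_ - 'X^t]addrC addrK addNr.
have [h ->] := factor_theorem _ _ rt.
by rewrite Pdiv.IdomainMonic.mulpK.
Qed.

(* Multiplicative order of p in Z/nZ, for n > 0 coprime to p: p%:R is then a
   unit and the default value 1 of insubd is not used.  The value is also
   correct for n = 1, even though 'Z_1 is Z/2Z; see mult_orderP. *)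
Definition mult_order (p n : nat) : nat :=
  #[insubd (1%g : {unit 'Z_n}) (p%:R : 'Z_n)]%g.

Lemma mult_orderP (p n k : nat) : (0 < n)%N -> coprime p n ->
  (p ^ k == 1 %[mod n])%N = (mult_order p n %| k)%N.
Proof.
case: n => [|[|n]] // _ cpn.
  rewrite !modn1 eqxx; symmetry; apply: (@dvdn_trans 1); last exact: dvd1n.
  have := order_dvdG (in_setT (insubd (1%g : {unit 'Z_1}) (p%:R : 'Z_1))).
  by rewrite [#|_|](@card_units_Zp 2).
rewrite /mult_order order_dvdn -val_eqE FinRing.val_unitX val_insubd unitZpE //.
rewrite coprime_sym cpn -natrX -val_eqE /=.
by rewrite val_Zp_nat // [X in _ == X](_ : _ = 1 %% n.+2).
Qed.

(* Main.v *)
(* Call a monic irreducible factor of g over K a component. A component fixed by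
   the Frobenius automorphism acting on coefficients descends to F_p, so suppose
   that there is none. A simple point of g over F_(p^m), affine of the form
   (1/(z - 1), 1/(z' - 1)) with z^t = z'^t = 1, or at infinity (w : 1 : 0) with
   w^(t - 1) = 1, forces the component through it to be fixed by the m-th power
   of Frobenius: this yields (a), (^a), (f) and (g). If p = 2 or t is odd then
   x + y + 1 divides g.

   Otherwise a component f and its distinct conjugate both divide g, whence
   2 deg f <= deg g. Write t = q L + 1 with q a power of p and p not dividing L,
   F = (x + 1)^t - x^t, so that (x - y) g = F(x) - F(y), and let C be the set of
   roots of (x + 1)^L - x^L, i.e. of the critical points of F, all of
   multiplicity q. If P divides g and P V = F(x) - F(y), then, up to a constant,
   N(P') N(V) = prod_(k in C) P(k, y)^q, where N is the norm of K[x, y]/(P) over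
   K[y]; moreover deg N(P') <= d (d - 1) with d = deg P, and N(V) only vanishes
   on C. Therefore
     d q (L - 1) - d (d - 1) <= sum_(c in C) mult_c N(V).
   For q = 1 this makes the number of pairs (c, k) of critical points with
   F(c) = F(k) so large that (b), (c), (d) and (e) are contradicted. For q > 1,
   a point (k, c) of multiplicity r on P contributes at least r (r - 1) to
   mult_c N(P'), which bounds mult_c N(V); the contradiction follows by taking
   for P a divisor of g with deg g / 3 <= deg P <= deg g / 2. *)

Require Import Defs.
From HB Require Import structures.
From mathcomp Require Import all_boot all_order all_fingroup all_algebra.
From mathcomp Require Import polyXY finfield cyclic zify ring.
From Stdlib Require Import Classical.

Set Implicit Arguments.
Unset Strict Implicit.
Unset Printing Implicit Defensive.

Import Order.TTheory GRing.Theory Num.Theory.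
Import Pdiv.CommonRing Pdiv.RingMonic.

Local Open Scope ring_scope.

(** * Norms modulo a monic polynomial *)

(** The cases q = 1 and q > 1 differ for the following reason. For q = 1 the crude bound mult_c N(V)
    <= sum_k mult_c P(k, y) is additive in P, so it can be summed over the components, each of
    degree at most half of deg g. For q > 1 the same bound carries a factor q; with m = L - 1, both
    sides of the summed inequality may then be about (q m)^2 / 2, and nothing is contradicted. The
    loss is recovered from N(P'): a pair (c, k) at which P(k, y) has order r at c costs about q r -
    r (r - 1) <= (q + 1)^2 / 4 instead of q r. This estimate no longer sees deg P, so it says
    nothing about components of small degree; hence the divisor of intermediate degree. For even t
    the involution x -> -1 - x negates F, so a value of F is taken at most m / 2 times on C, and the
    right-hand side is about (q m)^2 / 8, whereas d (q m - d) is about 2 (q m)^2 / 9 or more when d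
    lies between a third and half of q m. The lower-order terms matter only for small q. The
    inequality between mult_c N(P') and multiplicities is linear algebra over K[y]: the Sylvester
    matrix maps lattices of polynomials with prescribed multiplicities into one another. *)

Definition mulmod_mx (R : comNzRingType) (d : nat) (f v : {poly R}) : 'M[R]_d :=
  \matrix_(i < d) poly_rV (rmodp ('X^i * v) f).

Definition norm_mod (R : comNzRingType) (d : nat) (f v : {poly R}) : R :=
  \det (mulmod_mx d f v).

Section NormMod.

Variables (R : comNzRingType) (d : nat) (f : {poly R}).
Hypotheses (f_monic : f \is monic) (size_f : size f = d.+1).

Lemma size_rmodp_le v : (size (rmodp v f) <= d)%N.
Proof. by rewrite -ltnS -size_f ltn_rmodp monic_neq0. Qed.

Lemma rVpoly_sum (u : 'rV[R]_d) : rVpoly u = \sum_(i < d) u 0 i *: 'X^i.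
Proof.
rewrite /rVpoly poly_def; apply: eq_bigr => i _.
by rewrite valK.
Qed.

Lemma rVpoly_mulmod (u : 'rV[R]_d) v :
  rVpoly (u *m mulmod_mx d f v) = rmodp (rVpoly u * v) f.
Proof.
rewrite mulmx_sum_row linear_sum /= rVpoly_sum mulr_suml rmodp_sum //.
apply: eq_bigr => i _; rewrite linearZ /= rowK poly_rV_K ?size_rmodp_le //.
by rewrite -scalerAl rmodpZ.
Qed.

Lemma mulmod_mxM v w :
  mulmod_mx d f (v * w) = mulmod_mx d f v *m mulmod_mx d f w.
Proof.
apply/row_matrixP => i; rewrite row_mul rowK; apply: (can_inj (@rVpolyK _ _)).
rewrite rVpoly_mulmod poly_rV_K ?size_rmodp_le // rowK.
by rewrite poly_rV_K ?size_rmodp_le // rmodp_mulml // mulrA.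
Qed.

Lemma norm_modM v w : norm_mod d f (v * w) = norm_mod d f v * norm_mod d f w.
Proof. by rewrite /norm_mod mulmod_mxM det_mulmx. Qed.

Lemma mulmod_mxD v w :
  mulmod_mx d f (v + w) = mulmod_mx d f v + mulmod_mx d f w.
Proof.
apply/row_matrixP => i; rewrite linearD /= !rowK.
by rewrite mulrDr rmodpD // linearD.
Qed.

Lemma mulmod_mxC c : mulmod_mx d f c%:P = c%:M.
Proof.
apply/row_matrixP => i; rewrite rowK mulrC mul_polyC rmodp_small; last first.
  rewrite size_f ltnS (leq_trans (size_scale_leq _ _)) //.
  by rewrite size_polyXn.
by apply/rowP => j; rewrite !mxE coefZ coefXn eq_sym mulr_natr val_eqE.
Qed.

Lemma norm_modC c : norm_mod d f c%:P = c ^+ d.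
Proof. by rewrite /norm_mod mulmod_mxC det_scalar. Qed.

Lemma norm_mod1 : norm_mod d f 1 = 1.
Proof. by rewrite norm_modC expr1n. Qed.

Lemma norm_modX v n : norm_mod d f (v ^+ n) = norm_mod d f v ^+ n.
Proof.
elim: n => [|n IHn]; first by rewrite !expr0 norm_mod1.
by rewrite !exprS norm_modM IHn.
Qed.

Lemma norm_mod_prod (I : Type) (s : seq I) (F : I -> {poly R}) :
  norm_mod d f (\prod_(i <- s) F i) = \prod_(i <- s) norm_mod d f (F i).
Proof. exact: (big_morph _ norm_modM norm_mod1). Qed.

Lemma norm_mod_addM v w : norm_mod d f (v + w * f) = norm_mod d f v.
Proof.
congr (\det _); apply/row_matrixP => i; rewrite !rowK.
by rewrite mulrDr mulrA rmodpD // rmodp_mull // addr0.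
Qed.

Lemma mulmod_mx_companion :
  mulmod_mx d f 'X = \matrix_(i < d, j < d)
    if (i == d.-1 :> nat) then - f`_j else (i.+1 == j :> nat)%:R.
Proof.
apply/matrixP => i j; rewrite !mxE -exprSr.
have [id|id] := eqVneq (i : nat) d.-1; last first.
  rewrite rmodp_small ?coefXn 1?eq_sym //.
  rewrite size_polyXn size_f ltnS ltn_neqAle ltn_ord andbT.
  by apply: contraNneq id => /(congr1 predn) /= ->.
have id' : i.+1 = d by rewrite id (ltn_predK (ltn_ord i)).
have -> : 'X^(i.+1) = 1 * f + ('X^d - f).
  by rewrite mul1r addrC subrK id'.
rewrite rmodp_addl_mul_small ?coefB ?coefXn ?ltn_eqF ?sub0r //.
rewrite size_f ltnS; apply/leq_sizeP => k; rewrite leq_eqVlt.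
case/predU1P=> [<-|lt_dk]; rewrite coefB coefXn.
  by rewrite eqxx; have /monicP := f_monic; rewrite /lead_coef size_f => ->; rewrite subrr.
by rewrite gtn_eqF // nth_default ?subrr // size_f.
Qed.

(** Multiplication by x has the companion matrix of [f], whose characteristic polynomial is [f]; the
    sign is that of det(x - c) against det(c - x). *)
Lemma norm_modXsubC c : norm_mod d f ('X - c%:P) = (-1) ^+ d * f.[c].
Proof.
have E : mulmod_mx d f ('X - c%:P) = - (c%:M - mulmod_mx d f 'X).
  by rewrite -polyCN mulmod_mxD mulmod_mxC opprB raddfN.
rewrite /norm_mod E -scaleN1r detZ; congr (_ * _).
have -> : f.[c] = (char_poly (companionmx f)).[c] by rewrite companionmxK.
rewrite mulmod_mx_companion -[RHS]/(horner_eval c _) -det_map_mx.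
(* [companionmx f] has dimension [(size f).-1], which equals [d] only propositionally. *)
move: (d) (esym (congr1 predn size_f)) => /= n ->; congr (\det _).
apply/matrixP => i j; rewrite !mxE /horner_eval !hornerE /=.
by rewrite hornerMn hornerX.
Qed.

End NormMod.

(** Division by a monic polynomial commutes with ring morphisms. This allows both the specialisation
    of y and translations in y. *)
Lemma map_norm_mod (R S : comNzRingType) (phi : {rmorphism R -> S}) d f v :
  f \is monic -> size f = d.+1 ->
  phi (norm_mod d f v) = norm_mod d (map_poly phi f) (map_poly phi v).
Proof.
move=> f_monic size_f; rewrite /norm_mod -det_map_mx; congr (\det _).
have pf_monic : map_poly phi f \is monic by rewrite monic_map.
have size_pf : size (map_poly phi f) = d.+1.
  rewrite size_map_poly_id0 //.
  by have /monicP -> := f_monic; rewrite rmorph1 oner_neq0.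
apply/row_matrixP => i; rewrite rowK -map_row rowK map_poly_rV; congr poly_rV.
have := rdivp_eq f_monic ('X^i * v) => /(congr1 (map_poly phi)).
rewrite rmorphM rmorphD rmorphM /= map_polyXn => ->.
rewrite rmodp_addl_mul_small //.
by rewrite size_pf ltnS (leq_trans (size_poly _ _)) // (size_rmodp_le f_monic).
Qed.

Lemma norm_mod_neq0 (F : fieldType) d (f v : {poly F}) :
  f \is monic -> size f = d.+1 -> coprimep f v -> norm_mod d f v != 0.
Proof.
move=> f_monic size_f /Bezout_eq1_coprimepP [[a b] /= ab].
have: norm_mod d f (b * v) = 1.
  have -> : b * v = 1 + (- a) * f by rewrite -ab mulNr addrAC subrr add0r.
  by rewrite norm_mod_addM // norm_mod1.
rewrite norm_modM // => /eqP; apply: contraTneq => ->.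
by rewrite mulr0 eq_sym oner_neq0.
Qed.

(** * Sylvester matrices *)

Section BandMatrix.

Variable R : comNzRingType.

Definition band_mx (n N : nat) (v : {poly R}) : 'M[R]_(n, N) :=
  \matrix_(i < n) poly_rV ('X^i * v).

Lemma mul_band_mx n N (u : 'rV[R]_n) v :
  u *m band_mx n N v = poly_rV (rVpoly u * v).
Proof.
rewrite mulmx_sum_row rVpoly_sum mulr_suml linear_sum /=.
by apply: eq_bigr => i _; rewrite rowK -linearZ /= scalerAl.
Qed.

(** Dividing each x^i v by [f] amounts to row operations that turn the upper block into (M | 0),
    with M the matrix of multiplication by [v]; what remains of the lower block is unitriangular. *)
Lemma det_sylvester d m (f v : {poly R}) :
    f \is monic -> size f = d.+1 -> (size v <= m.+1)%N ->
  \det (col_mx (band_mx d (d + m) v) (band_mx m (d + m) f)) = norm_mod d f v.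
Proof.
move=> f_monic size_f size_v.
pose Q : 'M[R]_(d, m) := \matrix_(i < d) poly_rV (rdivp ('X^i * v) f).
pose F := band_mx m (d + m) f.
have size_q (i : 'I_d) : (size (rdivp ('X^i * v) f) <= m)%N.
  set q := rdivp _ _; have [->|q_neq0] := eqVneq q 0; first by rewrite size_poly0.
  have : (size (q * f + rmodp ('X^i * v) f)%R <= d + m)%N.
    rewrite -rdivp_eq // (leq_trans (size_polyMleq _ _)) // size_polyXn /=.
    by rewrite (leq_trans (leq_add (leqnn _) size_v)) // addnS -addSn leq_add2r.
  have size_qf : size (q * f) = (size q + d)%N by rewrite size_Mmonic // size_f addnS.
  rewrite size_polyDl size_qf; first by rewrite addnC leq_add2l.
  rewrite (leq_ltn_trans (size_rmodp_le f_monic size_f _)) //.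
  by rewrite -[X in (X < _)%N]add0n ltn_add2r size_poly_gt0.
have top : band_mx d (d + m) v = row_mx (mulmod_mx d f v) 0 + Q *m F.
  apply/row_matrixP => i; rewrite linearD /= row_row_mx row0 row_mul !rowK.
  rewrite mul_band_mx poly_rV_K //.
  have {1}-> := rdivp_eq f_monic ('X^i * v).
  rewrite addrC linearD /=; congr (_ + _); apply/rowP => j; rewrite !mxE.
  by case: split_ordP => k ->; rewrite !mxE //=
    nth_default // (leq_trans (size_rmodp_le f_monic size_f _)) ?leq_addr.
have -> : col_mx (band_mx d (d + m) v) F =
   block_mx 1%:M Q 0 1%:M *m block_mx (mulmod_mx d f v) 0 (lsubmx F) (rsubmx F).
  rewrite mulmx_block !mul1mx !mul0mx !add0r top /block_mx hsubmxK.
  by rewrite -{1}(hsubmxK F) mul_mx_row add_row_mx add0r.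
rewrite det_mulmx det_ublock !det1 !mul1r det_lblock.
have trigF : is_trig_mx (rsubmx F).
  apply/is_trig_mxP => i j lt_ij; rewrite !mxE /= coefXnM.
  case: ifP => // _; rewrite nth_default // size_f.
  by rewrite -addnBA ?(ltnW lt_ij) // -addn1 leq_add2l subn_gt0.
rewrite (det_trig trigF) big1 ?mulr1 // => i _; rewrite !mxE /= coefXnM.
rewrite ltnNge leq_addl /= addnK.
by have /monicP := f_monic; rewrite /lead_coef size_f.
Qed.

End BandMatrix.

(* A decreasing chain of ideals (E 0) <= (E 1) <= ... <= (E M) = (1) of K[x]
   filters K[x]_(< n); [flag_poly] is a basis of monic polynomials of degrees
   0, 1, ... adapted to this filtration. *)
Section FlagBasis.

Variables (K : fieldType) (E : nat -> {poly K}) (M : nat).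
Hypotheses (E_monic : forall a, E a \is monic)
           (E_dvd : forall a, E a.+1 %| E a)
           (E_M : E M = 1).

Let deg a := (size (E a)).-1.

(** As the degrees decrease, this count is the least [a] with [deg a <= i], that is, the power of y
    that must accompany a basis vector of degree [i]. *)
Definition flag_weight (i : nat) : nat := \sum_(a < M) (i < deg a).

Definition flag_poly (i : nat) : {poly K} :=
  E (flag_weight i) * 'X^(i - deg (flag_weight i)).

Lemma E_dvd_leq a b : (a <= b)%N -> E b %| E a.
Proof.
elim: b => [|b IHb]; first by rewrite leqn0 => /eqP ->.
rewrite leq_eqVlt => /predU1P[-> //|/IHb]; exact: dvdp_trans.
Qed.

Lemma deg_anti a b : (a <= b)%N -> (deg b <= deg a)%N.
Proof.
move/E_dvd_leq/dvdp_leq; rewrite monic_neq0 // => /(_ isT); rewrite /deg.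
by case: (size (E b)); case: (size (E a)).
Qed.

Lemma deg_ge_M a : (M <= a)%N -> deg a = 0%N.
Proof. by move/deg_anti; rewrite /deg E_M size_poly1 leqn0 => /eqP. Qed.

Lemma flag_weight_le i a : (flag_weight i <= a)%N = (deg a <= i)%N.
Proof.
rewrite leqNgt [RHS]leqNgt; congr (~~ _).
have [lt_aM|le_Ma] := ltnP a M; last first.
  rewrite (deg_ge_M le_Ma) ltn0; apply/negbTE; rewrite -leqNgt.
  apply: leq_trans le_Ma; rewrite /flag_weight.
  by rewrite -[X in (_ <= X)%N]card_ord -sum1_card leq_sum // => k _; case: (_ < _)%N.
rewrite /flag_weight; apply/idP/idP => [|lt_i].
  apply: contraTT; rewrite -!leqNgt => le_i.
  rewrite -(big_mkord predT (fun k => (i < deg k : bool) : nat)).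
  rewrite (big_cat_nat (leq0n a) (ltnW lt_aM)) /=.
  rewrite [X in (_ + X)%N]big_nat_cond [X in (_ + X)%N]big1 ?addn0.
    apply: leq_trans (_ : \sum_(0 <= k < a) 1 <= _)%N; first by apply: leq_sum => k _; case: (_ < _)%N.
    by rewrite sum_nat_const_nat subn0 muln1.
  move=> k; rewrite andbT => /andP[le_ak _].
  by rewrite ltnNge (leq_trans (deg_anti le_ak) le_i).
rewrite -(big_mkord predT (fun k => (i < deg k : bool) : nat)) (big_cat_nat (leq0n a.+1) lt_aM) /=.
apply: leq_trans (leq_addr _ _).
apply: leq_trans (_ : \sum_(0 <= k < a.+1) 1 <= _)%N.
  by rewrite sum_nat_const_nat subn0 muln1.
rewrite big_nat_cond [X in (_ <= X)%N]big_nat_cond.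
apply: leq_sum => k; rewrite andbT ltnS => /deg_anti le_ka.
by rewrite (leq_trans lt_i).
Qed.

Lemma deg_flag_weight i : (deg (flag_weight i) <= i)%N.
Proof. by rewrite -flag_weight_le. Qed.

Lemma flag_poly_monic i : flag_poly i \is monic.
Proof. by rewrite monicMr ?monicXn. Qed.

Lemma size_flag_poly i : size (flag_poly i) = i.+1.
Proof.
rewrite size_Mmonic ?monic_neq0 ?monicXn // size_polyXn addnS /=.
rewrite -[X in (X + _)%N]prednK ?size_poly_gt0 ?monic_neq0 // -/(deg _) addSn.
by rewrite subnKC // deg_flag_weight.
Qed.

(** Both sides count the pairs (i, a) with [i < deg a]. *)
Lemma sum_flag_weight n : (deg 0 <= n)%N ->
  (\sum_(i < n) flag_weight i = \sum_(a < M) deg a)%N.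
Proof.
move=> le_n; rewrite exchange_big /=; apply: eq_bigr => a _.
have {le_n}le_n : (deg a <= n)%N by apply: leq_trans le_n; exact: deg_anti.
rewrite -(big_mkord predT (fun k => (k < deg a : bool) : nat)) (big_cat_nat (leq0n (deg a)) le_n) /=.
rewrite [X in (_ + X)%N]big_nat_cond [X in (_ + X)%N]big1 ?addn0; last first.
  by move=> k; rewrite andbT => /andP[le_ak _]; rewrite ltnNge le_ak.
rewrite big_nat_cond (eq_bigr (fun=> 1%N)) => [|k].
  by rewrite -big_nat_cond sum_nat_const_nat subn0 muln1.
by rewrite andbT => /= ->.
Qed.

Definition flag_mx n : 'M[K]_n := \matrix_(i < n) poly_rV (flag_poly i).

Lemma det_flag_mx n : \det (flag_mx n) = 1.
Proof.
rewrite det_trig.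
  rewrite big1 // => i _; rewrite !mxE.
  by have /monicP := flag_poly_monic i; rewrite /lead_coef size_flag_poly.
by apply/is_trig_mxP => i j lt_ij; rewrite !mxE nth_default // size_flag_poly.
Qed.

(** By elimination of leading terms: a non-zero multiple of [E a] has degree at least [deg a], so
    the basis vector of that degree has weight at most [a] and is a multiple of [E a] too. *)
Lemma flag_coord n a (q : {poly K}) : (size q <= n)%N -> E a %| q ->
  exists c : 'I_n -> K, q = \sum_(i < n) c i *: flag_poly i /\
    forall i, c i != 0 -> (flag_weight i <= a)%N.
Proof.
move: {2}(size q) (leqnn (size q)) => k.
elim: k q => [|k IHk] q le_qk le_qn dvd_q.
  exists (fun=> 0); split=> [|i]; last by rewrite eqxx.
  move: le_qk; rewrite leqn0 size_poly_eq0 => /eqP ->.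
  by rewrite big1 // => i _; rewrite scale0r.
have [q0|q_neq0] := eqVneq q 0; first by apply: IHk; rewrite // q0 size_poly0.
have size_q := polySpred q_neq0.
have lt_n : ((size q).-1 < n)%N by rewrite -size_q.
pose j := Ordinal lt_n.
have w_j : (flag_weight j <= a)%N.
  rewrite flag_weight_le /deg /=.
  by have := dvdp_leq q_neq0 dvd_q; case: (size (E a)); case: (size q).
pose q' := q - lead_coef q *: flag_poly j.
have size_q' : (size q' <= k)%N.
  rewrite -ltnS; apply: leq_trans le_qk; rewrite size_q ltnS.
  apply/leq_sizeP => l; rewrite leq_eqVlt coefB coefZ => /predU1P[<-|lt_l].
    have /monicP := flag_poly_monic j; rewrite /lead_coef size_flag_poly /= => ->.
    by rewrite mulr1 subrr.
  by rewrite !nth_default ?size_flag_poly ?mulr0 ?subrr // size_q.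
have le_q'n : (size q' <= n)%N.
  rewrite (leq_trans (size_polyD _ _)) // geq_max le_qn size_polyN.
  by rewrite (leq_trans (size_scale_leq _ _)) // size_flag_poly.
have dvd_q' : E a %| q'.
  rewrite dvdp_sub // dvdpZr ?lead_coef_eq0 // dvdp_mulr //.
  exact: E_dvd_leq.
have [c [def_q' c_supp]] := IHk q' size_q' le_q'n dvd_q'.
exists (fun i => c i + lead_coef q *+ (i == j)); split.
  rewrite (eq_bigr (fun i => c i *: flag_poly i + (lead_coef q *+ (i == j)) *: flag_poly i)).
    rewrite big_split /= -def_q' (bigD1 j) //= eqxx big1 ?addr0 ?subrK // => i /negPf ->.
    by rewrite scale0r.
  by move=> i _; rewrite scalerDl.
by move=> i; have [-> //|_] := eqVneq i j; rewrite addr0; apply: c_supp.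
Qed.

(** The polynomials whose coefficient of y^a is divisible by [E a] for all [a] form a lattice over
    K[y], with basis the y^w b_i, where w is the weight of i and b_i its flag polynomial; [mu] is
    the vector of coordinates. *)
Lemma flag_coordXY n (Q : {poly {poly K}}) :
    (size Q <= n)%N -> (forall a, E a %| (swapXY Q)`_a) ->
  exists mu : 'rV[{poly K}]_n,
    poly_rV Q = mu *m (diag_mx (\row_i 'X^(flag_weight i)) *m map_mx polyC (flag_mx n)).
Proof.
move=> size_Q dvd_Q; pose A := size (swapXY Q).
have size_Qa a : (size ((swapXY Q)`_a)%R <= n)%N.
  apply/leq_sizeP => j le_nj; rewrite coef_swapXY.
  by rewrite (nth_default _ (leq_trans size_Q le_nj)) coef0.
have/fin_all_exists [c cP] (a : 'I_A) := flag_coord (size_Qa a) (dvd_Q a).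
exists (\row_i \sum_(a < A) c a i *: 'X^(a - flag_weight i)).
apply/rowP => j; rewrite !mxE; apply/polyP => k.
transitivity (\sum_(a < A) (\sum_(i < n) c a i *: ('X^a * ((flag_poly i)`_j)%:P)))`_k.
  rewrite -coef_swapXY -[LHS]coef_swapXY swapXYK.
  have -> : Q`_j = \sum_(a < A) (swapXY Q)`_a`_j *: 'X^a.
    apply/polyP => l; rewrite coef_sum (eq_bigr (fun a : 'I_A => (swapXY Q)`_a`_j * (l == a)%:R)).
      rewrite -[in LHS](swapXYK Q) coef_swapXY.
      have [lt_lA|le_Al] := ltnP l A.
        rewrite (bigD1 (Ordinal lt_lA)) //= eqxx mulr1 big1 ?addr0 // => a.
        by rewrite -val_eqE eq_sym => /negPf ->; rewrite mulr0.
      rewrite (nth_default _ le_Al) coef0 big1 // => a _.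
      by rewrite gtn_eqF ?mulr0 // (leq_trans (ltn_ord a)).
    by move=> a _; rewrite coefZ coefXn.
  rewrite !coef_sum; apply: eq_bigr => a _; have [{1}-> _] := cP a.
  rewrite coef_sum scaler_suml !coef_sum; apply: eq_bigr => i _.
  by rewrite coefZ !coefZ coefMC mulrA mulrAC.
rewrite exchange_big /= !coef_sum; apply: eq_bigr => i _; rewrite !mxE.
rewrite mulr_suml !coef_sum; apply: eq_bigr => a _.
rewrite -scalerAl !coefZ; have [_ c_supp] := cP a.
have [-> |/c_supp w_i] := eqVneq (c a i) 0; first by rewrite !mul0r.
congr (_ * _`_k).
transitivity ('X^(a - flag_weight i) * ('X^(flag_weight i) * ((flag_poly i)`_j)%:P)).
  by rewrite mulrA -exprD subnK.
rewrite [in RHS](bigD1 i) //= big1 ?addr0 => [|l /negPf l_i].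
  by rewrite !mxE eqxx mulr1n.
by rewrite !mxE eq_sym l_i mulr0n mul0r.
Qed.

End FlagBasis.

Lemma det_diag_polyXn (K : fieldType) n (w : 'I_n -> nat) :
  \det (diag_mx (\row_i 'X^(w i)) : 'M[{poly K}]_n) = 'X^(\sum_i w i).
Proof.
rewrite det_diag -prodrXr; apply: eq_bigr => i _; exact: mxE.
Qed.

Section FlagNorm.

Variables (K : fieldType) (Er Es En : nat -> {poly K}) (M d m : nat).
Variables (f v : {poly {poly K}}).
Let deg (E : nat -> {poly K}) a := (size (E a)).-1.
Hypotheses (f_monic : f \is monic) (size_f : size f = d.+1)
  (size_v : (size v <= m.+1)%N).
Hypotheses (Er_monic : forall a, Er a \is monic)
  (Es_monic : forall a, Es a \is monic) (En_monic : forall a, En a \is monic).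
Hypotheses (Er_dvd : forall a, Er a.+1 %| Er a)
  (Es_dvd : forall a, Es a.+1 %| Es a) (En_dvd : forall a, En a.+1 %| En a).
Hypotheses (Er_M : Er M = 1) (Es_M : Es M = 1) (En_M : En M = 1).
Hypotheses (Er_le : (deg Er 0 <= d)%N) (Es_le : (deg Es 0 <= m)%N)
  (En_le : (deg En 0 <= d + m)%N).
Hypotheses (En_mul : forall a b, En (a + b)%N %| Er a * Es b)
  (Er_f : forall a, Er a %| (swapXY f)`_a)
  (Es_v : forall a, Es a %| (swapXY v)`_a).

(** Multiplication by [u] sends the lattice of [E] into that of [En]. It is applied to each of the
    two blocks of rows of the Sylvester matrix. *)
Let row_block k k' (E E' : nat -> {poly K}) (u : {poly {poly K}})
    (E_mon : forall a, E a \is monic) (E_dvd : forall a, E a.+1 %| E a) (E_M : E M = 1)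
    (mulE : forall a b, En (a + b)%N %| E a * E' b)
    (E'_u : forall a, E' a %| (swapXY u)`_a) (size_u : (size u <= k'.+1)%N)
    (kk' : (k + k' = d + m)%N) :
  exists mu : 'M[{poly K}]_(k, d + m),
    diag_mx (\row_i 'X^(flag_weight E M i)) *m map_mx polyC (flag_mx E M k)
      *m band_mx k (d + m) u
    = mu *m (diag_mx (\row_i 'X^(flag_weight En M i)) *m map_mx polyC (flag_mx En M (d + m))).
Proof.
suff H (i : 'I_k) : exists mu : 'rV[{poly K}]_(d + m),
    row i (diag_mx (\row_i 'X^(flag_weight E M i)) *m map_mx polyC (flag_mx E M k)
      *m band_mx k (d + m) u)
    = mu *m (diag_mx (\row_i 'X^(flag_weight En M i)) *m map_mx polyC (flag_mx En M (d + m))).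
  have/fin_all_exists [mu muP] := H.
  exists (\matrix_i mu i); apply/row_matrixP => i.
  by rewrite muP [in RHS]row_mul rowK.
pose w := flag_weight E M i; pose b := flag_poly E M i.
have -> : row i (diag_mx (\row_i 'X^(flag_weight E M i)) *m map_mx polyC (flag_mx E M k)
      *m band_mx k (d + m) u) = poly_rV (('X^w)%:P * (map_poly polyC b * u)).
  rewrite -mulmxA row_mul row_diag_mx mxE -scalemxAl -rowE row_mul mul_band_mx.
  rewrite mul_polyC linearZ /=; congr (_ *: poly_rV (_ * _)).
  rewrite -map_row rowK map_poly_rV poly_rV_K //.
  by rewrite size_map_polyC size_flag_poly.
apply: flag_coordXY => //.
  rewrite mul_polyC (leq_trans (size_scale_leq _ _)) //.
  rewrite (leq_trans (size_polyMleq _ _)) // size_map_polyC size_flag_poly //=.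
  by rewrite (leq_trans (leq_add (leqnn i) size_u)) // addnS -addSn -kk' leq_add2r.
move=> a; rewrite rmorphM rmorphM /= swapXY_polyC map_polyXn swapXY_map_polyC.
rewrite coefXnM; case: ifP => [|/negbT]; first by rewrite dvdp0.
rewrite -leqNgt => le_wa; rewrite coefCM.
apply: dvdp_trans (_ : E w * E' (a - w)%N %| _); first by rewrite -{1}(subnKC le_wa).
by rewrite dvdp_mul // dvdp_mulr.
Qed.

(** The map (a, b) -> a v + b f has determinant N(v) and sends the lattices of [Er] and [Es] into
    that of [En]; the bases of the three lattices have determinants the powers of y in the
    statement. *)
Lemma flag_norm_dvd :
  'X^(\sum_(a < M) deg En a) %|
    'X^(\sum_(a < M) deg Er a + \sum_(a < M) deg Es a) * norm_mod d f v.
Proof.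
have [mu1 top] := row_block Er_monic Er_dvd Er_M En_mul Es_v size_v (erefl _).
have En_mul' a b : En (a + b)%N %| Es a * Er b by rewrite addnC mulrC.
have size_f' : (size f <= d.+1)%N by rewrite size_f.
have [mu2 bot] := row_block Es_monic Es_dvd Es_M En_mul' Er_f size_f' (addnC _ _).
set D1 := diag_mx _ *m _ in top; set D2 := diag_mx _ *m _ in bot.
set D3 := diag_mx _ *m _ in top bot.
have detD n (E : nat -> {poly K}) : (forall a, E a \is monic) -> (forall a, E a.+1 %| E a) ->
    E M = 1 -> (deg E 0 <= n)%N ->
    \det (diag_mx (\row_i 'X^(flag_weight E M i)) *m map_mx polyC (flag_mx E M n))
      = 'X^(\sum_(a < M) deg E a).
  move=> Emon Edvd EM Ele; rewrite det_mulmx det_diag_polyXn det_map_mx det_flag_mx //.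
  by rewrite rmorph1 mulr1 (sum_flag_weight M Emon Edvd Ele).
have : \det (block_mx D1 0 0 D2 *m col_mx (band_mx d (d + m) v) (band_mx m (d + m) f))
     = \det (col_mx mu1 mu2 *m D3).
  congr (\det _).
  by rewrite mul_block_col mul_col_mx !mul0mx addr0 add0r top bot.
rewrite [LHS]det_mulmx det_ublock det_sylvester // [RHS]det_mulmx.
rewrite [\det D1]detD // [\det D2]detD // [\det D3]detD //.
by rewrite -exprD => ->; rewrite dvdp_mull.
Qed.

End FlagNorm.

Lemma double_sum_subn M k : (k <= M)%N -> (2 * \sum_(a < M) (k - a) = k * k.+1)%N.
Proof.
elim: M k => [|M IHM] [|k] // le_kM.
- by rewrite big_ord0.
- by rewrite big1.
rewrite big_ord_recl subn0 mulnDr.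
rewrite (eq_bigr (fun a : 'I_M => k - a)%N) => [|a _]; last by rewrite subSS.
by rewrite IHM //; lia.
Qed.

(** * Multiplicities at several points of the line y = 0 *)

Section MultiPoint.

Variable K : fieldType.
Implicit Types (C : seq K) (e : K -> nat).

Definition point_flag C e a : {poly K} := \prod_(c <- C) ('X - c%:P) ^+ (e c - a).

Lemma point_flag_monic C e a : point_flag C e a \is monic.
Proof. by apply: monic_prod => c _; rewrite monic_exp ?monicXsubC. Qed.

Lemma size_point_flag C e a : (size (point_flag C e a)).-1 = (\sum_(c <- C) (e c - a))%N.
Proof.
rewrite /point_flag; elim: C => [|c C IHC]; first by rewrite !big_nil size_poly1.
rewrite !big_cons size_Mmonic ?expf_neq0 ?polyXsubC_eq0 //; last exact: point_flag_monic.
rewrite size_exp_XsubC addSn /=.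
have: (0 < size (point_flag C e a))%N by rewrite size_poly_gt0 monic_neq0 ?point_flag_monic.
by rewrite -IHC /point_flag; case: (size _) => //= k _; rewrite addnS.
Qed.

Lemma point_flag_dvd C e (u : {poly K}) a : uniq C ->
  (forall c, c \in C -> ('X - c%:P) ^+ (e c - a) %| u) -> point_flag C e a %| u.
Proof.
elim: C => [|c C IHC] /=; first by rewrite /point_flag big_nil dvd1p.
move=> /andP[cC uC] dvd; rewrite /point_flag big_cons Gauss_dvdp.
  rewrite dvd ?mem_head //=; apply: IHC => // k kC; apply: dvd.
  by rewrite inE kC orbT.
rewrite coprimep_sym coprimep_expr // coprimep_XsubC.
rewrite rootE horner_prod prodf_seq_neq0; apply/allP => k kC /=.
rewrite horner_exp !hornerE expf_neq0 // subr_eq0.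
by apply: contraNneq cC => ->.
Qed.

(** The divisibility hypotheses say that [f] and [v] have multiplicities at least [r c] and [s c] at
    (c, 0), so this is the lower bound of intersection numbers by products of multiplicities. The
    lattices of multiplicities r, s and r + s have colengths r (r + 1) / 2, s (s + 1) / 2 and (r +
    s) (r + s + 1) / 2, and the last exceeds the sum of the others by r s. *)
Lemma norm_mod_multiplicity C (r s : K -> nat) d (f v : {poly {poly K}}) :
    uniq C -> f \is monic -> size f = d.+1 -> (size v <= d.+1)%N ->
    (\sum_(c <- C) r c <= d)%N -> (\sum_(c <- C) s c <= d)%N ->
    (forall c a, c \in C -> ('X - c%:P) ^+ (r c - a) %| (swapXY f)`_a) ->
    (forall c a, c \in C -> ('X - c%:P) ^+ (s c - a) %| (swapXY v)`_a) ->
  'X^(\sum_(c <- C) r c * s c) %| norm_mod d f v.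
Proof.
move=> uC f_monic size_f size_v le_r le_s r_f s_v.
(* [M] only has to exceed every [n c], so that all three flags have become trivial. *)
pose n c := (r c + s c)%N; pose M := (\sum_(c <- C) n c)%N.
have le_nM c : c \in C -> (n c <= M)%N.
  by move=> cC; rewrite /M (big_rem c) //= leq_addr.
have le_M e : (forall c, e c <= n c)%N -> point_flag C e M = 1.
  move=> le_en; rewrite /point_flag big_seq big1 // => c cC.
  suff /eqP -> : (e c - M == 0)%N by rewrite expr0.
  by rewrite subn_eq0 (leq_trans (le_en c)) // le_nM.
have flag_dvd e a : point_flag C e a.+1 %| point_flag C e a.
  rewrite /point_flag; elim: (C) => [|c C' IHC]; first by rewrite !big_nil dvdpp.
  by rewrite !big_cons dvdp_mul // dvdp_exp2l // leq_sub2l.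
have sum_tri e : (forall c, e c <= n c)%N ->
    (2 * \sum_(a < M) (size (point_flag C e a)).-1 = \sum_(c <- C) e c * (e c).+1)%N.
  move=> le_en; rewrite (eq_bigr (fun a : 'I_M => \sum_(c <- C) (e c - a))%N) => [|a _];
    last exact: size_point_flag.
  rewrite exchange_big big_distrr /= big_seq [in RHS]big_seq; apply: eq_bigr => c cC.
  by apply: double_sum_subn; rewrite (leq_trans (le_en c)) // le_nM.
have deg0 e : (size (point_flag C e 0)).-1 = (\sum_(c <- C) e c)%N.
  by rewrite size_point_flag; apply: eq_bigr => c _; rewrite subn0.
have := @flag_norm_dvd K (point_flag C r) (point_flag C s) (point_flag C n) M d d f v
   f_monic size_f size_v
   (point_flag_monic C r) (point_flag_monic C s) (point_flag_monic C n)
   (flag_dvd r) (flag_dvd s) (flag_dvd n) (le_M r _) (le_M s _) (le_M n _).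
rewrite !deg0 /n big_split /=.
move=> /(_ (fun c => leq_addr _ _) (fun c => leq_addl _ _) (fun c => leqnn _)).
move=> /(_ le_r le_s (leq_add le_r le_s)).
have dvd_mul a b : point_flag C n (a + b) %| point_flag C r a * point_flag C s b.
  rewrite /point_flag -big_split /=.
  elim: (C) => [|c C' IHC]; first by rewrite !big_nil dvdpp.
  rewrite !big_cons dvdp_mul // -exprD dvdp_exp2l // /n; lia.
move=> /(_ dvd_mul (fun a => point_flag_dvd uC (fun c => r_f c a))
  (fun a => point_flag_dvd uC (fun c => s_v c a))).
have -> : (\sum_(a < M) (size (point_flag C n a)).-1 =
    (\sum_(a < M) (size (point_flag C r a)).-1 + \sum_(a < M) (size (point_flag C s a)).-1)
    + \sum_(c <- C) r c * s c)%N.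
  apply/eqP; rewrite -(eqn_pmul2l (isT : 0 < 2)%N) !mulnDr !sum_tri ?leqnn //.
  - rewrite big_distrr /= -!big_split /=; apply/eqP/eq_bigr => c _; rewrite /n; lia.
  - by move=> c; apply: leq_addl.
  - by move=> c; apply: leq_addr.
by rewrite exprD dvdp_mul2l // expf_neq0 ?polyX_eq0.
Qed.

End MultiPoint.

(** * Plane curves *)

(* [dilate u] is u(XZ, Z) in K[X][Z]: its degree in Z is the total degree of u,
   its order in Z is the multiplicity of u at the origin, and its leading
   coefficient describes the points at infinity of the curve u = 0. *)
Definition dilate (R : comNzRingType) (u : {poly {poly R}}) : {poly {poly R}} :=
  (map_poly (map_poly polyC) u).['X * 'Y].

Section Dilate.

Variable R : comNzRingType.
Implicit Types u v : {poly {poly R}}.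

Lemma dilateE u : dilate u = horner_eval ('X * 'Y) (map_poly (map_poly polyC) u).
Proof. by []. Qed.

Lemma dilateM u v : dilate (u * v) = dilate u * dilate v.
Proof. by rewrite !dilateE !rmorphM. Qed.

Lemma coef_dilate u n j :
  (dilate u)`_n`_j = if (j <= n)%N then u`_j`_(n - j) else 0.
Proof.
have -> : dilate u = \sum_(i < size u) map_poly polyC u`_i * ('X ^+ i * ('X ^+ i)%:P).
  rewrite /dilate (@horner_coef_wide _ (size u)) ?size_poly //.
  apply: eq_bigr => i _; rewrite coef_map_id0 ?map_poly0 // exprMn.
  by rewrite polyC_exp.
rewrite !coef_sum (eq_bigr (fun i : 'I_(size u) =>
  (if (j <= n)%N then u`_j`_(n - j) else 0) * (i == j :> nat)%:R)) => [|i _].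
  have [lt_j|le_j] := ltnP j (size u).
    rewrite (bigD1 (Ordinal lt_j)) //= eqxx mulr1 big1 ?addr0 // => i.
    by rewrite -val_eqE /= => /negPf ->; rewrite mulr0.
  rewrite (nth_default _ le_j) coef0 if_same big1 // => i _.
  by rewrite mul0r.
rewrite mulrA coefMC mulrC coefMXn; case: (ltnP n i) => [lt_ni|le_in].
  rewrite mulr0 coef0; have [<-|_] := eqVneq (i : nat) j; last by rewrite mulr0.
  by rewrite leqNgt lt_ni mul0r.
rewrite coef_map /= mulrC mul_polyC coefZ coefXn eq_sym.
by have [<-|_] := eqVneq (i : nat) j; rewrite ?mulr0 // le_in.
Qed.

Lemma dilate_coef_eq0 u n : (size (dilate u) <= n)%N ->
  forall i j, (n <= i + j)%N -> u`_i`_j = 0.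
Proof.
move=> le_n i j le_ij; have := coef_dilate u (i + j) i.
by rewrite leq_addr addKn (nth_default 0 (leq_trans le_n le_ij)) coef0 => <-.
Qed.

Lemma size_dilate_le u n : (forall i j, (n <= i + j)%N -> u`_i`_j = 0) ->
  (size (dilate u) <= n)%N.
Proof.
move=> u0; apply/leq_sizeP => k le_nk; apply/polyP => j.
rewrite coef_dilate coef0; case: leqP => // le_jk.
by rewrite u0 // subnKC.
Qed.

Lemma dilate_neq0 u : u != 0 -> dilate u != 0.
Proof.
apply: contra_neq => du0; apply/polyP => i; apply/polyP => j.
by have := coef_dilate u (i + j) i; rewrite leq_addr addKn du0 !coef0.
Qed.

Lemma size_dilate_ge u : lead_coef u = ((lead_coef u)`_0)%:P -> (size u <= size (dilate u))%N.
Proof.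
have [-> _|u_neq0 lcu] := eqVneq u 0; first by rewrite size_poly0.
rewrite [X in (X <= _)%N]polySpred //; apply: contraT; rewrite -leqNgt => le_u.
have := dilate_coef_eq0 le_u (_ : ((size u).-1 <= (size u).-1 + 0)%N).
rewrite addn0 leqnn => /(_ isT); rewrite -lead_coefE => lc0.
by move: u_neq0; rewrite -lead_coef_eq0 lcu lc0 polyC0 eqxx.
Qed.

End Dilate.

Section Tight.

Variable K : fieldType.
Implicit Types u v f : {poly {poly K}}.

(* The curve u = 0 has neither (1 : 0 : 0) nor (0 : 1 : 0) at infinity. *)
Definition tight u :=
  [/\ size (lead_coef u) = 1, size (dilate u) = size u & size u`_0 = size u].

Lemma tight_neq0 u : tight u -> u != 0.
Proof. by case=> + _ _; apply: contra_eq_neq => ->; rewrite lead_coef0 size_poly0. Qed.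

Lemma size_lead_const u : size (lead_coef u) = 1 -> lead_coef u = ((lead_coef u)`_0)%:P.
Proof. by move=> sz; apply: size1_polyC; rewrite sz. Qed.

Lemma size_dilate_coef u n i : (size (dilate u) <= n)%N -> (size (u`_i)%R <= n - i)%N.
Proof.
move=> le_n; apply/leq_sizeP => j le_j.
by apply: (dilate_coef_eq0 le_n); move: le_j; lia.
Qed.

(** The degree in x of u and the degree of u(0, y) are at most the total degree, and all three are
    additive; equality for a product forces equality for its factors. *)
Lemma tightMl u v : tight (u * v) -> tight u.
Proof.
move=> tuv; have uv_neq0 := tight_neq0 tuv; case: tuv => szl szd sz0.
have [u_neq0 v_neq0] : u != 0 /\ v != 0.
  by move: uv_neq0; rewrite mulf_eq0 negb_or => /andP.
move: szl; rewrite lead_coefM => /eqP; rewrite size_mul_eq1 => /andP[/eqP lu /eqP lv].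
have := size_dilate_ge (size_lead_const lu).
have := size_dilate_ge (size_lead_const lv).
move: szd (sz0); rewrite coef0M dilateM (size_mul u_neq0 v_neq0).
rewrite (size_mul (dilate_neq0 u_neq0) (dilate_neq0 v_neq0)).
have: u`_0 * v`_0 != 0.
  rewrite -size_poly_eq0 -coef0M sz0.
  by rewrite size_poly_eq0.
rewrite mulf_eq0 negb_or => /andP[u0_neq0 v0_neq0].
rewrite (size_mul u0_neq0 v0_neq0).
have := size_dilate_coef 0 (leqnn (size (dilate u))).
have := size_dilate_coef 0 (leqnn (size (dilate v))).
have := size_poly_gt0 u; have := size_poly_gt0 v.
have := size_poly_gt0 (u`_0)%R; have := size_poly_gt0 (v`_0)%R.
rewrite u_neq0 v_neq0 u0_neq0 v0_neq0 !subn0.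
rewrite /tight lu; move: (size u) (size v) (size (dilate u)) (size (dilate v)) (size u`_0) (size v`_0).
by move=> *; split=> //; lia.
Qed.

Lemma tightMr u v : tight (u * v) -> tight v.
Proof. by rewrite mulrC; apply: tightMl. Qed.

(** The coefficient of x^i has degree at most deg u - i, so only u(0, y) contributes to the top
    degree of u(c, y). *)
Lemma size_tight_horner u c : tight u -> size u.[c%:P] = size u.
Proof.
move=> tu; have u_neq0 := tight_neq0 tu; case: tu => _ szd sz0.
have coefE n : u.[c%:P]`_n = \sum_(i < size u) u`_i`_n * c ^+ i.
  rewrite horner_coef coef_sum; apply: eq_bigr => i _.
  by rewrite -polyC_exp coefMC.
apply/eqP; rewrite eqn_leq; apply/andP; split.
  apply/leq_sizeP => n le_n; rewrite coefE big1 // => i _.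
  by rewrite (dilate_coef_eq0 (eq_leq szd)) ?mul0r // (leq_trans le_n) ?leq_addl.
rewrite [X in (X <= _)%N]polySpred //; apply: contraT; rewrite -leqNgt => le_sz.
have := nth_default 0 le_sz; rewrite coefE polySpred // big_ord_recl expr0 mulr1.
rewrite big1 ?addr0 => [|i _].
  rewrite -sz0 -lead_coefE => /eqP; rewrite lead_coef_eq0 -size_poly_eq0 sz0.
  by rewrite size_poly_eq0 (negPf u_neq0).
rewrite (dilate_coef_eq0 (eq_leq szd)) ?mul0r // lift0 /=.
by have := size_poly_gt0 u; rewrite u_neq0; lia.
Qed.

(** A division step subtracts a multiple of [f] with the total degree of the leading term of [u] in
    x, which is at most that of [u]. *)
Lemma size_dilate_rmodp f u n : f \is monic -> size (dilate f) = size f ->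
  (size (dilate u) <= n)%N -> (size (dilate (rmodp u f)) <= n)%N.
Proof.
move=> f_monic szf; have f_neq0 := monic_neq0 f_monic.
move: {2}(size u) (leqnn (size u)) => k.
elim: k u => [|k IHk] u le_uk le_un.
  by move: le_uk; rewrite leqn0 size_poly_eq0 => /eqP u0; rewrite u0 rmod0p -u0.
have [lt_uf|le_fu] := ltnP (size u) (size f); first by rewrite rmodp_small.
have u_neq0 : u != 0.
  by rewrite -size_poly_eq0 -lt0n (leq_trans _ le_fu) // size_poly_gt0.
pose w := (lead_coef u)%:P * 'X^(size u - size f).
pose u' := u - w * f.
have -> : rmodp u f = rmodp u' f.
  rewrite /u' rmodpD // rmodpN // rmodp_mull // subr0; by [].
have lcE : lead_coef (w * f) = lead_coef u.
  by rewrite lead_coef_Mmonic // lead_coefM lead_coefXn mulr1 lead_coefC.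
have sz_wf : size (w * f) = size u.
  rewrite size_Mmonic // /w mul_polyC ?scale_poly_eq0.
    rewrite size_scale ?lead_coef_eq0 // size_polyXn; lia.
  by rewrite negb_or lead_coef_eq0 u_neq0 /= monic_neq0 ?monicXn.
apply: IHk.
  rewrite -ltnS; apply: leq_trans le_uk; have szu := polySpred u_neq0.
  rewrite [X in (_ < X)%N]szu ltnS.
  apply/leq_sizeP => j; rewrite leq_eqVlt coefB => /predU1P[<-|lt_j].
    by rewrite -lead_coefE -sz_wf -lead_coefE lcE subrr.
  by rewrite !nth_default ?subr0 // ?sz_wf szu.
apply: size_dilate_le => i j le_ij; rewrite coefB (coefB (u`_i)).
rewrite (dilate_coef_eq0 le_un) // sub0r.
apply/eqP; rewrite oppr_eq0; apply/eqP.
apply: (dilate_coef_eq0 _ le_ij); apply: leq_trans le_un.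
have -> : size (dilate (w * f)) = size (dilate ((lead_coef u)%:P * 'X^((size u).-1))).
  have dX m : dilate ('X^m : {poly {poly K}}) = ('X * 'Y) ^+ m.
    by rewrite dilateE !rmorphXn /= map_polyX /horner_eval hornerX.
  have szdX m : size (dilate ('X^m : {poly {poly K}})) = m.+1.
    rewrite dX exprMn -polyC_exp mulrC mul_polyC size_scale ?size_polyXn //.
    by rewrite expf_neq0 ?polyX_eq0.
  have c_neq0 : (lead_coef u)%:P != 0 by rewrite polyC_eq0 lead_coef_eq0.
  have X_neq0 m : 'X^m != 0 :> {poly {poly K}} by rewrite monic_neq0 ?monicXn.
  rewrite dilateM /w !dilateM !size_mul ?mulf_neq0 ?dilate_neq0 //.
  rewrite !szdX szf; have := size_poly_gt0 f; rewrite f_neq0.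
  move: le_fu; lia.
apply: size_dilate_le => {}i {}j {}le_ij; rewrite coefCM coefXn.
have [i_eq|_] := eqVneq i (size u).-1; last by rewrite mulr0 coef0.
by rewrite mulr1 lead_coefE -i_eq; apply: (dilate_coef_eq0 (leqnn _)).
Qed.

(** A Bezout bound: the entry (i, j) has degree at most m + i - j, and i - j sums to zero along a
    permutation. *)
Lemma size_norm_mod d m f v : f \is monic -> size f = d.+1 -> size (dilate f) = d.+1 ->
  (size (dilate v) <= m.+1)%N -> (size (norm_mod d f v) <= (d * m).+1)%N.
Proof.
move=> f_monic szf szdf le_v.
have szA (i j : 'I_d) : (size (mulmod_mx d f v i j) <= (m + i).+1 - j)%N.
  rewrite !mxE; apply: size_dilate_coef; apply: size_dilate_rmodp; rewrite ?szdf //.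
  have [->|v_neq0] := eqVneq v 0; first by rewrite mulr0 /dilate map_poly0 horner0 size_poly0.
  have dX k : dilate ('X^k : {poly {poly K}}) = ('X * 'Y) ^+ k.
    by rewrite dilateE !rmorphXn /= map_polyX /horner_eval hornerX.
  rewrite dilateM dX exprMn -polyC_exp -mulrA mul_polyC.
  rewrite mulrC -scalerAl size_scale ?expf_neq0 ?polyX_eq0 // size_mulXn ?dilate_neq0 //.
  by rewrite addnC; move: le_v; rewrite -(leq_add2r i) addSn.
rewrite /norm_mod /determinant (leq_trans (size_sum _ _ _)) //; apply/bigmax_leqP => s _.
set P := \prod_i _; suff szP : (size P <= (d * m).+1)%N.
  by case: (odd_perm s); rewrite ?expr1 ?expr0 ?mulN1r ?mul1r ?size_polyN.
have [->|] := eqVneq P 0; first by rewrite size_poly0.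
move=> /prodf_neq0 A_neq0.
rewrite size_prod; last by move=> i _; apply: A_neq0.
(* The truncated subtraction is exact, since a non-zero entry forces [s i <= m + i]. *)
have sum_eq : (\sum_(i < d) ((m + i) - s i) + \sum_(i < d) s i = d * m + \sum_(i < d) s i)%N.
  rewrite -big_split /= (eq_bigr (fun i : 'I_d => m + i)%N) => [|i _].
    rewrite big_split /= sum_nat_const card_ord; congr (_ + _)%N.
    exact: (reindex_inj (@perm_inj _ s)).
  rewrite subnK //; have := A_neq0 i isT; rewrite -size_poly_gt0 => gt0.
  by have := leq_trans gt0 (szA i (s i)); rewrite subn_gt0 ltnS.
apply: (@leq_trans ((\sum_(i < d) ((m + i) - s i).+1).+1 - d)%N); last first.
  rewrite (eq_bigr (fun i : 'I_d => ((m + i) - s i) + 1)%N) => [|i _]; last by rewrite addn1.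
  rewrite big_split /= sum_nat_const card_ord muln1.
  by move/eqP: sum_eq; rewrite eqn_add2r => /eqP ->; lia.
rewrite leq_sub ?card_ord // ltnS leq_sum // => i _.
apply: leq_trans (szA i (s i)) _; lia.
Qed.

End Tight.

(** * Factorization of polynomials monic in x *)

Section Factor.

Variable K : closedFieldType.
Implicit Types u v f a b h : {poly {poly K}}.

(** Only degrees in x are compared: a factor of a monic polynomial that is constant in x is a unit,
    because the leading coefficients multiply to 1. *)
Definition monic_irreducible f :=
  [/\ f \is monic, (1 < size f)%N &
      forall a b, f = a * b -> size a = 1 \/ size b = 1].

Lemma map_horner_eq0 u (c : K) : map_poly (horner_eval c) u = 0 ->
  exists v, u = ('X - c%:P)%:P * v.
Proof.
move=> u0; exists (map_poly (fun q => q %/ ('X - c%:P)) u).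
apply/polyP => i; rewrite coefCM coef_map_id0 ?div0p //.
rewrite mulrC divpK // dvdp_XsubCl rootE.
by have := congr1 (fun q : {poly K} => q`_i) u0; rewrite coef_map coef0 /= /horner_eval => ->.
Qed.

(** Gauss's lemma when K is algebraically closed: at a root r of [c] the product a b vanishes modulo
    y - r, hence so does a or b, and y - r can be cancelled on both sides. *)
Lemma gauss_monic (c : {poly K}) f a b : c != 0 -> f \is monic ->
  c *: f = a * b -> exists a' b', [/\ f = a' * b', size a' = size a & size b' = size b].
Proof.
move: {2}(size c) (leqnn (size c)) => n; elim: n c a b => [|n IHn] c a b.
  by rewrite leqn0 size_poly_eq0 => /eqP -> /eqP.
move=> le_c c_neq0 f_monic def_cf.
have [/eqP/size_poly1P [k k_neq0 c_eq]|] := eqVneq (size c) 1%N.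
  exists ((k^-1)%:P *: a), b; split=> //.
    by rewrite -scalerAl -def_cf scalerA c_eq -polyCM mulVf // scale1r.
  by rewrite size_scale // polyC_eq0 invr_eq0.
move=> /closed_rootP [r cr]; have /dvdpP [c' c_eq] : 'X - r%:P %| c by rewrite dvdp_XsubCl.
have X_neq0 : 'X - r%:P != 0 :> {poly K} by rewrite polyXsubC_eq0.
have c'_neq0 : c' != 0 by apply: contraNneq c_neq0 => c'0; rewrite c_eq c'0 mul0r.
have le_c' : (size c' <= n)%N.
  by move: le_c; rewrite c_eq size_mul // size_XsubC addn2 /= ltnS.
have : map_poly (horner_eval r) a * map_poly (horner_eval r) b = 0.
  rewrite -rmorphM -def_cf /= c_eq; apply/polyP => i; rewrite coef_map coefZ coef0 /=.
  by rewrite /horner_eval !hornerE subrr !(mulr0, mul0r).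
have polyX_neq0 : ('X - r%:P)%:P != 0 :> {poly {poly K}} by rewrite polyC_eq0.
have def_cf' : ('X - r%:P)%:P * (c' *: f) = a * b.
  by rewrite mul_polyC scalerA [_ * c']mulrC -c_eq.
have size_X v : size (('X - r%:P)%:P * v) = size v by rewrite mul_polyC size_scale.
move/eqP; rewrite mulf_eq0 => /orP[] /eqP /map_horner_eq0 [v v_eq].
  have /(IHn _ _ _ le_c' c'_neq0 f_monic) [a' [b' [f_eq sz_a sz_b]]] : c' *: f = v * b.
    by apply: (mulfI polyX_neq0); rewrite def_cf' v_eq mulrA.
  by exists a', b'; rewrite v_eq size_X.
have /(IHn _ _ _ le_c' c'_neq0 f_monic) [a' [b' [f_eq sz_a sz_b]]] : c' *: f = a * v.
  by apply: (mulfI polyX_neq0); rewrite def_cf' v_eq mulrCA.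
by exists a', b'; rewrite v_eq size_X.
Qed.

(** Over the domain K[y], [%|] is divisibility up to a non-zero factor from K[y], that is, over
    K(y); [gauss_monic] leads back to K[y]. *)
Lemma monic_irreducible_dvd f d : monic_irreducible f -> d %| f ->
  size d = 1 \/ exists c k : {poly K}, c != 0 /\ c *: f = k *: d.
Proof.
case=> f_monic _ f_irr /Pdiv.Idomain.dvdpP [[c q] /= c_neq0 cf].
have [a [b [f_eq sz_a <-]]] := gauss_monic c_neq0 f_monic cf.
have [a1|] := f_irr _ _ f_eq; last by left.
right; exists c, q`_0; split=> //; rewrite cf {1}[q]size1_polyC ?mul_polyC //.
by rewrite -sz_a a1.
Qed.

Lemma monic_irreducible_coprime f f' : monic_irreducible f -> monic_irreducible f' ->
  f != f' -> coprimep f f'.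
Proof.
move=> irr_f irr_f'; apply: contraNT => ncop.
have sz_gcd : size (gcdp f f') <> 1 by move/eqP; apply/negP.
have [//|[c [k [c_neq0 def_f]]]] := monic_irreducible_dvd irr_f (dvdp_gcdl f f').
have [//|[c' [k' [c'_neq0 def_f']]]] := monic_irreducible_dvd irr_f' (dvdp_gcdr f f').
case: irr_f irr_f' => f_monic _ _ [f'_monic _ _].
have E : (k' * c) *: f = (k * c') *: f'.
  by rewrite -!scalerA def_f def_f' !scalerA mulrC.
have := congr1 lead_coef E; rewrite !lead_coefZ (monicP f_monic) (monicP f'_monic) !mulr1 => kc.
have k_neq0 : k != 0.
  apply: contraNneq c_neq0 => k0; move/eqP: def_f; rewrite k0 scale0r scale_poly_eq0.
  by rewrite (negPf (monic_neq0 f_monic)) orbF.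
move/eqP: E; rewrite kc -subr_eq0 -scalerBr scale_poly_eq0 mulf_eq0.
by rewrite (negPf k_neq0) (negPf c'_neq0) subr_eq0.
Qed.

(** Coprimality over K(y) yields divisibility by f f' there; as f f' is monic, the quotient has
    coefficients in K[y]. *)
Lemma monic_irreducible_mul f f' u : monic_irreducible f -> monic_irreducible f' ->
    f != f' -> (exists h, u = f * h) -> (exists h, u = f' * h) ->
  exists h, u = f * f' * h.
Proof.
move=> irr_f irr_f' ff' [h u_f] [h' u_f'].
have cop := monic_irreducible_coprime irr_f irr_f' ff'.
case: irr_f irr_f' => f_monic _ _ [f'_monic _ _].
have : f * f' %| u.
  by rewrite Pdiv.Idomain.Gauss_dvdp // {1}u_f u_f' !dvdp_mulr.
have ff'_monic : f * f' \is monic by rewrite monicMr.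
by move/(Pdiv.IdomainMonic.dvdpP ff'_monic) => [w ->]; exists w; rewrite mulrC.
Qed.

(* For a property Q of divisors that behaves like membership of a point on a curve. *)
Lemma exists_monic_irreducible (Q : {poly {poly K}} -> Prop) u :
    ~ Q 1 -> (forall a b, Q (a * b) -> Q a \/ Q b) -> u \is monic -> Q u ->
  exists f, [/\ monic_irreducible f, Q f & exists2 h, h \is monic & u = f * h].
Proof.
move=> Q1 QM; move: {2}(size u) (leqnn (size u)) => n; elim: n u => [|n IHn] u.
  by rewrite leqn0 size_poly_eq0 => /eqP -> /monic_neq0/eqP.
move=> le_u u_monic Qu.
have u_gt1 : (1 < size u)%N.
  rewrite ltnNge; apply/negP => le1; apply: Q1; suff <- : u = 1 by [].
  have u_C := size1_polyC le1; move/monicP: u_monic.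
  by rewrite u_C lead_coefC => ->.
have [[a [b [a_monic b_monic u_eq sz_a sz_b]]]|no_ab] := classic (exists a b,
    [/\ a \is monic, b \is monic, u = a * b, (1 < size a)%N & (1 < size b)%N]).
  have szu : size u = (size a + size b).-1 by rewrite u_eq size_mul ?monic_neq0.
  have [Qa|Qb] := QM a b (eq_ind _ Q Qu _ u_eq).
    have [|f [f_irr Qf [h h_monic a_eq]]] := IHn a _ a_monic Qa.
      by move: le_u; rewrite szu; move: sz_b; move: (size a) (size b); lia.
    by exists f; split=> //; exists (h * b); rewrite ?monicMr // u_eq a_eq mulrA.
  have [|f [f_irr Qf [h h_monic b_eq]]] := IHn b _ b_monic Qb.
    by move: le_u; rewrite szu; move: sz_a; move: (size a) (size b); lia.
  by exists f; split=> //; exists (a * h); rewrite ?monicMr // u_eq b_eq mulrCA.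
exists u; split=> //; last by exists 1; rewrite ?monic1 ?mulr1.
split=> // a b u_eq.
have lc_ab : lead_coef a * lead_coef b = 1 by rewrite -lead_coefM -u_eq (monicP u_monic).
pose a' := lead_coef b *: a; pose b' := lead_coef a *: b.
have la0 : lead_coef a != 0 by apply: contra_eq_neq lc_ab => ->; rewrite mul0r eq_sym oner_neq0.
have lb0 : lead_coef b != 0 by apply: contra_eq_neq lc_ab => ->; rewrite mulr0 eq_sym oner_neq0.
have a'_monic : a' \is monic by apply/monicP; rewrite lead_coefZ mulrC.
have b'_monic : b' \is monic by apply/monicP; rewrite lead_coefZ.
have [le_a|gt_a] := leqP (size a) 1.
  by left; apply/eqP; rewrite eqn_leq le_a size_poly_gt0 -lead_coef_eq0.
have [le_b|gt_b] := leqP (size b) 1.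
  by right; apply/eqP; rewrite eqn_leq le_b size_poly_gt0 -lead_coef_eq0.
case: no_ab; exists a', b'; rewrite !size_scale //; split=> //.
by rewrite -scalerAl -scalerAr scalerA mulrC lc_ab scale1r.
Qed.

Lemma monic_irreducible_elt f : monic_irreducible f -> irreducible_elt f.
Proof.
case=> f_monic f_gt1 f_irr; split.
- exact: monic_neq0.
- by rewrite poly_unitE eqn_leq leqNgt f_gt1.
- move=> a b f_eq.
  have lc_ab : lead_coef a * lead_coef b = 1 by rewrite -lead_coefM -f_eq (monicP f_monic).
  have unit1 u v : size u = 1 -> lead_coef u * lead_coef v = 1 -> u \is a GRing.unit.
    move=> sz_u uv1; rewrite poly_unitE sz_u eqxx /=.
    apply/unitrP; exists (lead_coef v); move: uv1; rewrite lead_coefE sz_u /= => uv1.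
    by rewrite mulrC.
  have [a1|b1] := f_irr _ _ f_eq; first by left; apply: unit1 lc_ab.
  by right; apply: (unit1 _ a); rewrite // mulrC.
Qed.

End Factor.

Lemma sum_count_mem_uniq (T : eqType) (C s : seq T) : uniq C -> {subset s <= C} ->
  (\sum_(c <- C) count_mem c s = size s)%N.
Proof.
move=> uC; elim: s => [|z s IHs] sC; first by rewrite big1.
rewrite /= big_split /= IHs => [|x xs]; last by rewrite sC // inE xs orbT.
rewrite (bigD1_seq z) ?sC ?mem_head //= eqxx big1 ?addn0 // => c.
by rewrite eq_sym => /negPf ->.
Qed.

Lemma size_sum_mup (K : closedFieldType) (C : seq K) (u : {poly K}) :
    uniq C -> u != 0 -> (forall x, root u x -> x \in C) ->
  ((size u).-1 = \sum_(c <- C) mup c u)%N.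
Proof.
move=> uC u_neq0 u_root; have [r u_eq] := closed_field_poly_normal u.
have lc_neq0 : lead_coef u != 0 by rewrite lead_coef_eq0.
have rC : {subset r <= C}.
  by move=> x xr; apply: u_root; rewrite u_eq rootZ // root_prod_XsubC.
rewrite {1}u_eq size_scale // size_prod_XsubC /= -(sum_count_mem_uniq uC rC).
apply: eq_bigr => c _; rewrite [in RHS]u_eq -mul_polyC mupMr ?mu_prod_XsubC //.
by rewrite rootC.
Qed.

Lemma size_prod_exp (R : idomainType) (I : Type) (s : seq I) (G : I -> {poly R}) d q :
  (forall i, size (G i) = d.+1) ->
  size (\prod_(i <- s) G i ^+ q) = (size s * (d * q)).+1.
Proof.
move=> szG; have Gq_neq0 i : G i ^+ q != 0.
  by rewrite expf_neq0 // -size_poly_eq0 szG.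
have szGq i : size (G i ^+ q) = (d * q).+1.
  by rewrite [LHS]polySpred // size_exp szG.
elim: s => [|i s IHs]; first by rewrite big_nil size_poly1.
rewrite big_cons size_mul //; last by rewrite -size_poly_eq0 IHs.
by rewrite IHs szGq /= addnS mulSn.
Qed.

(** * Norms modulo a divisor of F(x) - F(y) *)

Definition separated (R : nzRingType) (F : {poly R}) : {poly {poly R}} := F^:P - F%:P.

Section Separated.

Variables (K : closedFieldType) (C : seq K) (F : {poly K}) (kappa : K) (q : nat).
Hypotheses (C_uniq : uniq C) (kappa_neq0 : kappa != 0) (q_gt0 : (0 < q)%N).
Hypothesis F_deriv : F^`() = kappa *: \prod_(c <- C) ('X - c%:P) ^+ q.

Lemma separated_deriv : (separated F)^`() =
  kappa%:P%:P * \prod_(c <- C) ('X - c%:P%:P) ^+ q.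
Proof.
rewrite derivB derivC subr0 deriv_map F_deriv -mul_polyC rmorphM /= map_polyC rmorph_prod /=.
congr (_ * _); apply: eq_bigr => c _.
by rewrite rmorphXn rmorphB /= map_polyX map_polyC.
Qed.

Lemma F_deriv_root x : root F^`() x = (x \in C).
Proof.
rewrite F_deriv rootZ // rootE horner_prod; apply/eqP/idP => [/eqP|xC].
  apply: contraLR => xC; rewrite prodf_seq_neq0; apply/allP => c cC /=.
  rewrite horner_exp !hornerE expf_neq0 // subr_eq0.
  by apply: contraNneq xC => ->.
rewrite (big_rem x) //= horner_exp !hornerE subrr expr0n.
by rewrite eqn0Ngt q_gt0 mul0r.
Qed.

Variables (d : nat) (f v : {poly {poly K}}).
Hypotheses (f_monic : f \is monic) (size_f : size f = d.+1).
Hypothesis fv : separated F = f * v.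

(** Modulo [f], the x-derivative of f v is f' v; but it is F'(x), a product of linear factors whose
    norms are values of [f]. *)
Lemma norm_mod_deriv_separated :
  norm_mod d f f^`() * norm_mod d f v =
  kappa%:P ^+ d * \prod_(c <- C) ((-1) ^+ d * f.[c%:P]) ^+ q.
Proof.
rewrite -norm_modM // -(norm_mod_addM d f_monic _ v^`()).
have -> : f^`() * v + v^`() * f = (separated F)^`().
  by rewrite fv derivM [v^`() * _]mulrC.
rewrite separated_deriv norm_modM // norm_modC // norm_mod_prod //.
by congr (_ * _); apply: eq_bigr => c _; rewrite norm_modX // norm_modXsubC.
Qed.

(** A zero y of N(v) gives a common root x of f(., y) and v(., y). Then (x, y) is singular on f v =
    0, and the y-derivative of F(x) - F(y) vanishes there. *)
Lemma norm_mod_separated_root y : root (norm_mod d f v) y -> y \in C.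
Proof.
move=> /rootP norm0; pose fy := map_poly (horner_eval y) f.
pose vy := map_poly (horner_eval y) v.
have fy_monic : fy \is monic by rewrite monic_map.
have size_fy : size fy = d.+1.
  by rewrite size_map_poly_id0 // (monicP f_monic) rmorph1 oner_neq0.
have : ~~ coprimep fy vy.
  apply/negP => cop; have /eqP[] := norm_mod_neq0 fy_monic size_fy cop.
  by rewrite -map_norm_mod.
rewrite coprimep_def => /closed_rootP [x].
rewrite root_gcd => /andP[/rootP fx /rootP vx].
have evalE (u : {poly {poly K}}) : (map_poly (horner_eval y) u).[x] = u.[x, y].
  by rewrite -horner2_swapXY -horner_swapXY.
have := congr1 (fun u : {poly {poly K}} => u.[x%:P]) fv.
rewrite (hornerM f v) {1}/separated hornerD hornerN hornerC horner_map /=.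
move=> /(congr1 (fun u : {poly K} => u^`().[y])).
rewrite derivB derivC sub0r derivM hornerN hornerD !hornerM -!evalE fx vx.
rewrite mul0r mulr0 addr0.
by move/eqP; rewrite oppr_eq0 -F_deriv_root.
Qed.

Lemma mup_norm_mod_separated c : tight f -> v != 0 ->
  (mup c (norm_mod d f f^`()) + mup c (norm_mod d f v) =
    q * \sum_(k <- C) mup c f.[k%:P])%N.
Proof.
move=> f_tight v_neq0.
have fk_neq0 k : f.[k%:P] != 0.
  by rewrite -size_poly_eq0 size_tight_horner // size_f.
have prod_neq0 : norm_mod d f f^`() * norm_mod d f v != 0.
  rewrite norm_mod_deriv_separated mulf_neq0 ?expf_neq0 ?polyC_eq0 //.
  rewrite prodf_seq_neq0; apply/allP => k _ /=.
  by rewrite expf_neq0 // mulf_neq0 ?expf_neq0 // oppr_eq0 oner_neq0.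
move: (prod_neq0); rewrite mulf_eq0 negb_or => /andP[n1 n2].
rewrite -mupM // norm_mod_deriv_separated mupMr; last first.
  by rewrite -polyC_exp rootC expf_neq0.
elim: (C) => [|k C' IHC]; first by rewrite !big_nil muln0 mupNroot // root1.
have sgn : ~~ root ((-1) ^+ d : {poly K}) c.
  by rewrite rootE horner_exp hornerN hornerC expf_neq0 // oppr_eq0 oner_neq0.
rewrite !big_cons mupM ?IHC ?mulnDr.
- congr (_ + _)%N; elim: (q) => [|n IHn]; first by rewrite expr0 mul0n mupNroot // root1.
  rewrite exprS mupM ?IHn ?mulSn; last 2 first.
  + by rewrite mulf_neq0 ?expf_neq0 // oppr_eq0 oner_neq0.
  + by rewrite expf_neq0 // mulf_neq0 ?expf_neq0 // oppr_eq0 oner_neq0.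
  by rewrite mupMr.
- by rewrite expf_neq0 // mulf_neq0 ?expf_neq0 // oppr_eq0 oner_neq0.
- rewrite prodf_seq_neq0; apply/allP => j _ /=.
  by rewrite expf_neq0 // mulf_neq0 ?expf_neq0 // oppr_eq0 oner_neq0.
Qed.

Lemma norm_mod_separated_neq0 : tight f ->
  norm_mod d f f^`() != 0 /\ norm_mod d f v != 0.
Proof.
move=> f_tight; apply/andP; rewrite -negb_or -mulf_eq0.
rewrite norm_mod_deriv_separated mulf_neq0 ?expf_neq0 ?polyC_eq0 //.
rewrite prodf_seq_neq0; apply/allP => k _ /=.
rewrite expf_neq0 // mulf_neq0 ?expf_neq0 ?oppr_eq0 ?oner_neq0 //.
by rewrite -size_poly_eq0 size_tight_horner // size_f.
Qed.

Lemma degree_norm_mod_separated : tight f ->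
  (d * (q * size C) <= d * d.-1 + \sum_(c <- C) mup c (norm_mod d f v))%N.
Proof.
move=> f_tight; have [n1 n2] := norm_mod_separated_neq0 f_tight.
rewrite -size_sum_mup //; last by move=> x; apply: norm_mod_separated_root.
have le_n1 : ((size (norm_mod d f f^`())).-1 <= d * d.-1)%N.
  rewrite -ltnS (ltn_predK (_ : 0 < _)%N) ?size_poly_gt0 //.
  (* For d = 0 the norm is an empty determinant, and the general degree bound would involve the
     predecessor of 0. *)
  case: d size_f f_monic => [|d'] sz_f f_mon.
    by rewrite mul0n /norm_mod det_mx00 size_poly1.
  apply: size_norm_mod => //=; first by case: f_tight => _ ->.
  apply: size_dilate_le => i j le_ij; rewrite coef_deriv coefMn.
  have -> : f`_i.+1`_j = 0; last by rewrite mul0rn.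
  apply: (@dilate_coef_eq0 _ f d'.+2); first by case: f_tight => _ ->; rewrite sz_f.
  by rewrite addSn ltnS.
have := congr1 (fun u : {poly K} => (size u).-1) norm_mod_deriv_separated.
rewrite /= size_mul // => szE.
suff <- : ((size (norm_mod d f f^`()) + size (norm_mod d f v)).-1.-1 = d * (q * size C))%N.
  have := size_poly_gt0 (norm_mod d f f^`()); have := size_poly_gt0 (norm_mod d f v).
  move: le_n1; rewrite n1 n2.
  by move: (size _) (size _) => a b; lia.
rewrite szE -polyC_exp mul_polyC size_scale ?expf_neq0 //.
rewrite (@size_prod_exp _ _ _ _ d) /= => [|k]; first by rewrite mulnC -mulnA.
by rewrite size_Msign size_tight_horner // size_f.
Qed.

End Separated.

(** * The polynomial (x + 1)^n - x^n *)

Definition diff_power (R : nzRingType) (n : nat) : {poly R} := ('X + 1) ^+ n - 'X^n.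

Lemma coef_X1_exp (R : nzRingType) n j : ((('X + 1) ^+ n)`_j = 'C(n, j)%:R :> R).
Proof.
rewrite exprD1n coef_sum (eq_bigr (fun k : 'I_n.+1 => ('C(n, k) * (j == k))%:R)) => [|k _].
  have [lt_j|le_j] := ltnP j n.+1.
    rewrite (bigD1 (Ordinal lt_j)) //= eqxx muln1 big1 ?addr0 // => k.
    by rewrite -val_eqE eq_sym => /negPf /= ->; rewrite muln0.
  rewrite bin_small // big1 // => k _.
  by rewrite gtn_eqF ?muln0 // (leq_trans (ltn_ord k)).
by rewrite coefMn coefXn mulnC natrM mulr_natr.
Qed.

Lemma size_diff_power (R : nzRingType) n : n.+1%:R != 0 :> R ->
  size (diff_power R n.+1) = n.+1 /\ lead_coef (diff_power R n.+1) = n.+1%:R.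
Proof.
move=> n_neq0; have coefE j : (diff_power R n.+1)`_j = 'C(n.+1, j)%:R - (j == n.+1)%:R.
  by rewrite coefB coef_X1_exp coefXn.
have sz : size (diff_power R n.+1) = n.+1.
  apply/eqP; rewrite eqn_leq; apply/andP; split.
    apply/leq_sizeP => j; rewrite leq_eqVlt coefE => /predU1P[<-|lt_j].
      by rewrite binn eqxx subrr.
    by rewrite bin_small // gtn_eqF // subrr.
  rewrite ltnNge; apply/negP => /leq_sizeP/(_ n (leqnn n)).
  by rewrite coefE binSn ltn_eqF // subr0 => /eqP; rewrite (negPf n_neq0).
by split=> //; rewrite lead_coefE sz /= coefE binSn ltn_eqF // subr0.
Qed.

Lemma deriv_diff_power (R : comNzRingType) n :
  (diff_power R n.+1)^`() = n.+1%:R *: diff_power R n.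
Proof.
rewrite /diff_power derivB derivXn deriv_exp derivD derivX derivC addr0 mul1r /=.
by rewrite scaler_nat mulrnBl.
Qed.

Lemma diff_power_Frobenius (R : comNzRingType) p i L : p \in [pchar R] ->
  diff_power R (p ^ i * L) = diff_power R L ^+ (p ^ i).
Proof.
move=> pR; have pP : p \in [pchar {poly R}] by apply: (rmorph_pchar polyC).
have p_nat : [pchar {poly R}].-nat (p ^ i)%N.
  by rewrite pnatX (eq_pnat _ (pcharf_eq pP)) pnat_id ?(pcharf_prime pP).
rewrite /diff_power [in RHS]exprDn_pchar // exprNn_pchar // -!exprM.
by rewrite [(L * _)%N]mulnC.
Qed.

Lemma dvdp_deriv (K : fieldType) (c : K) (u : {poly K}) m :
  ('X - c%:P) ^+ m.+1 %| u -> ('X - c%:P) ^+ m %| u^`().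
Proof.
move=> /dvdpP[w ->]; rewrite derivM deriv_exp derivXsubC mul1r /= dvdp_add //.
  by rewrite exprS mulrA dvdp_mull.
by rewrite mulrnAr -mulr_natl mulrA dvdp_mull // mulrC dvdp_mull.
Qed.

Section CriticalPoints.

Variables (K : closedFieldType) (L : nat).
Hypotheses (L_gt0 : (0 < L)%N) (L_neq0 : L%:R != 0 :> K).

Lemma diff_power_root n x : root (diff_power K n) x = ((x + 1) ^+ n == x ^+ n).
Proof. by rewrite rootE !hornerE subr_eq0. Qed.

(** The roots are simple: at a double root the derivative gives (x + 1)^(L - 1) = x^(L - 1), whence
    x^(L - 1) = 0, and this is absurd even for x = 0. *)
Lemma critical_points : exists C : seq K,
  [/\ uniq C, size C = L.-1, (forall x, (x \in C) = ((x + 1) ^+ L == x ^+ L))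
    & diff_power K L = L%:R *: \prod_(c <- C) ('X - c%:P)].
Proof.
have [C hC] := closed_field_poly_normal (diff_power K L).
case: L L_gt0 L_neq0 hC => // n _ n_neq0 hC; have [sz lc] := size_diff_power n_neq0.
rewrite lc in hC; exists C.
have memC x : (x \in C) = ((x + 1) ^+ n.+1 == x ^+ n.+1).
  by rewrite -diff_power_root hC rootZ // root_prod_XsubC.
split=> //; last first.
  by have := congr1 (fun u : {poly K} => size u) hC; rewrite /= size_scale // size_prod_XsubC sz => -[].
have h_neq0 : diff_power K n.+1 != 0 by rewrite -size_poly_eq0 sz.
have C_count x : (count_mem x C <= 1)%N.
  rewrite -mu_prod_XsubC leqNgt; apply/negP => gt1.
  have x2 : ('X - x%:P) ^+ 2 %| diff_power K n.+1.
    by rewrite hC dvdpZr // -mup_geq // monic_neq0 ?monic_prod_XsubC.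
  have: root (diff_power K n.+1) x.
    by rewrite -dvdp_XsubCl; apply: dvdp_trans x2; rewrite exprS dvdp_mulr.
  have := dvdp_deriv x2; rewrite deriv_diff_power dvdpZr // expr1 dvdp_XsubCl.
  rewrite !diff_power_root => /eqP xn; rewrite !exprS xn.
  have xn_neq0 : x ^+ n != 0.
    have [x0|x_neq0] := eqVneq x 0; last by rewrite expf_neq0.
    by rewrite -xn x0 add0r expr1n oner_neq0.
  by rewrite -subr_eq0 -mulrBl mulf_eq0 addrAC subrr add0r oner_eq0 (negPf xn_neq0).
elim: (C) C_count => //= c C' IHC C_count; rewrite IHC => [|x].
  rewrite andbT; have := C_count c; rewrite eqxx add1n ltnS leqn0.
  by apply: contraL => cC; rewrite -lt0n -has_count has_pred1.
by rewrite (leq_trans _ (C_count x)) // leq_addl.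
Qed.

End CriticalPoints.

(** * Components and the Frobenius automorphism *)

Section ExtendScalars.

Variables (F L : fieldType) (phi : {rmorphism F -> L}).
Implicit Types u v f h : {poly {poly F}}.

Lemma coef_extend u i j : (extend_scalars phi u)`_i`_j = phi u`_i`_j.
Proof. by rewrite /extend_scalars !coef_map. Qed.

Lemma extend_inj : injective (extend_scalars phi).
Proof. by apply: map_inj_poly (map_poly_inj phi) _; rewrite rmorph0. Qed.

Lemma extendM u v : extend_scalars phi (u * v) = extend_scalars phi u * extend_scalars phi v.
Proof. by rewrite /extend_scalars rmorphM. Qed.

Lemma size_extend u : size (extend_scalars phi u) = size u.
Proof. by rewrite /extend_scalars (size_map_inj_poly (map_poly_inj phi)) ?rmorph0. Qed.

Lemma lead_coef_extend u : lead_coef (extend_scalars phi u) = map_poly phi (lead_coef u).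
Proof. by rewrite /extend_scalars (lead_coef_map_inj (map_poly_inj phi)) ?rmorph0. Qed.

Lemma extend_monic u : (extend_scalars phi u \is monic) = (u \is monic).
Proof.
rewrite !monicE lead_coef_extend -(rmorph1 (map_poly phi)).
by rewrite (inj_eq (map_poly_inj phi)).
Qed.

Lemma extend_g_poly t : extend_scalars phi (g_poly F t) = g_poly L t.
Proof.
have ext_num : extend_scalars phi (g_numerator F t) = g_numerator L t.
  rewrite /extend_scalars /g_numerator !(rmorphD, rmorphN, rmorphXn, rmorph1) /=.
  by rewrite !(map_polyX, map_polyC) /= map_polyX.
apply: (@mulIf _ ('X - 'Y)); first by rewrite polyXsubC_eq0.
rewrite g_polyP -ext_num -g_polyP extendM; congr (_ * _).
by rewrite /extend_scalars rmorphB /= map_polyX map_polyC /= map_polyX.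
Qed.

(** Division by the monic [f] commutes with extension of scalars, so the remainder already vanishes
    over F. *)
Lemma descend_dvd f u (h : {poly {poly L}}) : f \is monic ->
  extend_scalars phi u = extend_scalars phi f * h -> exists h', u = f * h'.
Proof.
move=> f_monic uh; exists (Pdiv.CommonRing.rdivp u f).
have u_eq := Pdiv.RingMonic.rdivp_eq f_monic u.
have F_monic : extend_scalars phi f \is monic by rewrite extend_monic.
have ext_u : extend_scalars phi u = extend_scalars phi (Pdiv.CommonRing.rdivp u f)
    * extend_scalars phi f + extend_scalars phi (Pdiv.CommonRing.rmodp u f).
  by rewrite {1}u_eq /extend_scalars rmorphD rmorphM.
have : extend_scalars phi (Pdiv.CommonRing.rmodp u f) = 0.
  have := Pdiv.RingMonic.rmodp_mull F_monic h; rewrite mulrC -uh ext_u.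
  rewrite Pdiv.RingMonic.rmodp_addl_mul_small // !size_extend.
  by rewrite Pdiv.CommonRing.ltn_rmodp monic_neq0.
rewrite -[0 in RHS](rmorph0 (map_poly (map_poly phi))) => /extend_inj r0.
by rewrite mulrC {1}u_eq r0 addr0.
Qed.

End ExtendScalars.

Lemma descend_scalars (F : finFieldType) (L : fieldType) (phi : {rmorphism F -> L})
    (u : {poly {poly L}}) :
  (forall i j, exists a, phi a = u`_i`_j) -> exists u', extend_scalars phi u' = u.
Proof.
move=> u_im; pose psi (x : L) : F := odflt 0 [pick a | phi a == x].
have psiK x : (exists a, phi a = x) -> phi (psi x) = x.
  by rewrite /psi; case: pickP => [a /eqP //|no_a [a /eqP]]; rewrite no_a.
have psi0 : psi 0 = 0.
  by apply: (fmorph_inj phi); rewrite rmorph0 psiK //; exists 0; rewrite rmorph0.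
exists (map_poly (map_poly psi) u); apply/polyP => i; apply/polyP => j.
rewrite coef_extend coef_map_id0 ?map_poly0 // coef_map_id0 //.
exact: psiK.
Qed.

Lemma g_poly_separated (R : fieldType) t :
  g_poly R t * ('X - 'Y) = separated (diff_power R t).
Proof.
rewrite g_polyP /g_numerator /separated /diff_power.
rewrite rmorphB !rmorphXn rmorphD /= !(map_polyX, map_polyC) rmorph1.
rewrite rmorphB !rmorphXn rmorphD rmorph1 /=.
by rewrite opprB addrA addrAC.
Qed.

(** The proof [pK] is an argument so that the instances of ring morphism can be attached to
    [frob pK m]. *)
Definition frob (K : closedFieldType) (p : nat) (pK : p \in [pchar K]) (m : nat)
  (x : K) : K := x ^+ (p ^ m).

Lemma pchar_nat_expn (R : nzRingType) p m : p \in [pchar R] -> [pchar R].-nat (p ^ m)%N.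
Proof.
by move=> pR; rewrite pnatX (eq_pnat _ (pcharf_eq pR)) pnat_id ?(pcharf_prime pR).
Qed.

Section Frobenius.

Variables (K : closedFieldType) (p : nat) (pK : p \in [pchar K]).
Implicit Types (u v f : {poly {poly K}}).

Lemma frob_is_zmod_morphism m : zmod_morphism (frob pK m).
Proof. by move=> x y; rewrite /frob exprDn_pchar ?exprNn_pchar ?pchar_nat_expn. Qed.

Lemma frob_is_monoid_morphism m : monoid_morphism (frob pK m).
Proof. by split=> [|x y]; rewrite /frob ?expr1n ?exprMn. Qed.

HB.instance Definition _ m :=
  GRing.isZmodMorphism.Build K K (frob pK m) (frob_is_zmod_morphism m).
HB.instance Definition _ m :=
  GRing.isMonoidMorphism.Build K K (frob pK m) (frob_is_monoid_morphism m).

Lemma frobD a b x : frob pK a (frob pK b x) = frob pK (a + b) x.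
Proof. by rewrite /frob -exprM -expnD addnC. Qed.

Definition conj_poly m u := extend_scalars (frob pK m) u.

Lemma conj_polyD a b u : conj_poly a (conj_poly b u) = conj_poly (a + b) u.
Proof. by apply/polyP => i; apply/polyP => j; rewrite !coef_extend /= frobD. Qed.

Lemma conj_poly0 u : conj_poly 0 u = u.
Proof. by apply/polyP => i; apply/polyP => j; rewrite coef_extend /= /frob expn0 expr1. Qed.

Lemma conj_poly_fix_mul a k u : conj_poly a u = u -> conj_poly (k * a) u = u.
Proof.
move=> fix_a; elim: k => [|k IHk]; first by rewrite mul0n conj_poly0.
by rewrite mulSn -conj_polyD IHk.
Qed.

Lemma conj_poly_fix_gcd a b u : conj_poly a u = u -> conj_poly b u = u ->
  conj_poly (gcdn a b) u = u.
Proof.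
case: a => [|a] fix_a fix_b; first by rewrite gcd0n.
have [k l kl _] := @egcdnP a.+1 b isT.
have := conj_poly_fix_mul k fix_a; rewrite kl addnC -conj_polyD.
by rewrite conj_poly_fix_mul.
Qed.

Lemma frob_surj m (y : K) : exists x, frob pK m x = y.
Proof.
have q_gt0 : (0 < p ^ m)%N by rewrite expn_gt0 prime_gt0 ?(pcharf_prime pK).
have /closed_rootP [x] : size ('X^(p ^ m) - y%:P) != 1 by rewrite size_XnsubC // eqSS -lt0n.
by rewrite rootE !hornerE subr_eq0 => /eqP xy; exists x.
Qed.

Lemma conj_poly_surj m u : exists v, conj_poly m v = u.
Proof.
have surj y : exists x, frob pK m x == y by have [x <-] := frob_surj m y; exists x.
pose psi y := xchoose (surj y).
have psiK y : frob pK m (psi y) = y by apply/eqP; apply: (xchooseP (surj y)).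
have psi0 : psi 0 = 0.
  by apply: (fmorph_inj (frob pK m)); rewrite /= psiK rmorph0.
exists (map_poly (map_poly psi) u); apply/polyP => i; apply/polyP => j.
rewrite coef_extend coef_map_id0 ?map_poly0 // coef_map_id0 //.
exact: psiK.
Qed.

Lemma conj_polyM m u v : conj_poly m (u * v) = conj_poly m u * conj_poly m v.
Proof. exact: extendM. Qed.

Lemma conj_g_poly m t : conj_poly m (g_poly K t) = g_poly K t.
Proof. exact: extend_g_poly. Qed.

Lemma conj_monic_irreducible m f : monic_irreducible f -> monic_irreducible (conj_poly m f).
Proof.
case=> f_monic f_gt1 f_irr; split; rewrite /conj_poly ?extend_monic ?size_extend //.
move=> a b; have [a' <-] := conj_poly_surj m a; have [b' <-] := conj_poly_surj m b.
rewrite -extendM => /extend_inj /f_irr.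
by rewrite /conj_poly !size_extend.
Qed.

Lemma conj_dvd_g m t f : (exists h, g_poly K t = f * h) ->
  exists h, g_poly K t = conj_poly m f * h.
Proof. by case=> h g_eq; exists (conj_poly m h); rewrite -conj_polyM -g_eq conj_g_poly. Qed.

End Frobenius.

(** X^|L| - X splits over L, so its roots in K all come from L. *)
Lemma frob_fixed_im (K : closedFieldType) p (pK : p \in [pchar K]) (L : finFieldType)
    (psi : {rmorphism L -> K}) m x :
  #|L| = (p ^ m)%N -> frob pK m x = x -> exists a, psi a = x.
Proof.
move=> cardL fix_x.
have : root (map_poly psi ('X^#|L| - 'X)) x.
  rewrite rmorphB /= map_polyXn map_polyX rootE !hornerE cardL.
  by move: fix_x; rewrite /frob => ->; rewrite subrr.
rewrite finField_genPoly rmorph_prod /= rootE horner_prod => /eqP/eqP.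
rewrite prodf_seq_eq0 => /hasP[a _] /=.
by rewrite rmorphB /= map_polyX map_polyC !hornerE subr_eq0 => /eqP ->; exists a.
Qed.

Lemma coef_separated (R : nzRingType) (F : {poly R}) i j :
  (separated F)`_i`_j = F`_i * (j == 0)%:R - F`_j * (i == 0)%:R.
Proof.
rewrite /separated !coefB coef_map /= !coefC; congr (_ - _).
  by case: (j == 0)%N; rewrite ?mulr1 ?mulr0.
by case: (i == 0)%N; rewrite ?mulr1 ?mulr0 ?coef0.
Qed.

Section SeparatedTight.

Variables (K : fieldType) (F : {poly K}).
Hypothesis F_gt1 : (1 < size F)%N.

Lemma size_separated : size (separated F) = size F /\
  lead_coef (separated F) = (lead_coef F)%:P.
Proof.
have lt : (size (- F%:P : {poly {poly K}}) < size F^:P)%N.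
  rewrite size_map_polyC size_polyN size_polyC.
  by case: (_ != 0); rewrite // ltnW.
rewrite /separated size_polyDl // lead_coefDl // size_map_polyC.
by split=> //; rewrite lead_coef_map_inj //; apply: polyC_inj.
Qed.

Lemma tight_separated : tight (separated F).
Proof.
have [szN lcN] := size_separated; have F_neq0 : F != 0.
  by rewrite -size_poly_gt0 ltnW.
have lc1 : size (lead_coef (separated F)) = 1.
  by rewrite lcN size_polyC lead_coef_eq0 F_neq0.
split=> //.
  apply/eqP; rewrite eqn_leq size_dilate_ge ?andbT; last exact: size_lead_const.
  apply: size_dilate_le => i j; rewrite szN coef_separated => le_ij.
  have [j0|_] := eqVneq j 0; have [i0|_] := eqVneq i 0%N; rewrite ?mulr0 ?mulr1 ?subr0 ?sub0r //.
  - by move: le_ij F_gt1; rewrite i0 j0; lia.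
  - by rewrite nth_default //; move: le_ij; rewrite j0 addn0.
  - by rewrite nth_default ?oppr0 //; move: le_ij; rewrite i0 add0n.
rewrite szN -(size_polyN F) /separated coefB coef_map coefC /=.
by rewrite addrC size_polyDl // size_polyN size_polyC (leq_ltn_trans (leq_b1 _)).
Qed.

Lemma top_separated :
  lead_coef (dilate (separated F)) = lead_coef F *: ('X^((size F).-1) - 1).
Proof.
have [szN lcN] := size_separated; have [_ szd _] := tight_separated.
apply/polyP => j; rewrite lead_coefE szd szN coef_dilate coef_separated.
rewrite coefZ coefB coefXn coef1 !lead_coefE.
have [n nE] : {n | size F = n.+2} by exists (size F).-2; move: F_gt1; case: (size F) => [|[]].
rewrite nE /=; have [->|j_neq] := eqVneq j n.+1.
  by rewrite leqnn subnn !mulr1 mulr0 !subr0 mulr1.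
have [->|j0] := eqVneq j 0; first by rewrite leq0n subn0 mulr0 !sub0r !mulr1 mulrN1.
rewrite subr0 !mulr0 subr0; case: leqP => // le_j.
by rewrite subn_eq0 leqNgt ltn_neqAle j_neq le_j mulr0.
Qed.

End SeparatedTight.

(** * Components through points fixed by Frobenius *)

Section Components.

Variables (K : closedFieldType) (p t : nat).
Hypotheses (p_prime : prime p) (pK : p \in [pchar K]).
Hypotheses (t_ge3 : (3 <= t)%N) (t_neq0 : t%:R != 0 :> K).

Let F := diff_power K t.
Let g := g_poly K t.

Definition component f := monic_irreducible f /\ exists h, g_poly K t = f * h.

Lemma size_F : size F = t /\ lead_coef F = t%:R.
Proof. by rewrite /F; case: (t) t_ge3 t_neq0 => // n _; apply: size_diff_power. Qed.

Lemma F_gt1 : (1 < size F)%N.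
Proof. by have [-> _] := size_F; apply: leq_trans t_ge3. Qed.

Lemma g_mul : g * ('X - 'Y) = separated F.
Proof. exact: g_poly_separated. Qed.

Lemma tight_g : tight g.
Proof. by apply: (@tightMl _ _ ('X - 'Y)); rewrite g_mul; apply: tight_separated F_gt1. Qed.

Lemma size_g : size g = t.-1.
Proof.
have [szN _] := size_separated F_gt1; have [szF _] := size_F.
move: szN; rewrite -g_mul size_Mmonic ?monicXsubC // ?size_XsubC ?szF; last first.
  exact: tight_neq0 tight_g.
by rewrite addn2 /= => <-.
Qed.

Lemma lead_coef_g : lead_coef g = t%:R%:P.
Proof.
have [_ lcN] := size_separated F_gt1; have [_ lcF] := size_F.
by move: lcN; rewrite -g_mul lead_coef_Mmonic ?monicXsubC // lcF.
Qed.

Definition monic_g := t%:R^-1%:P *: g.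

Lemma g_monic_g : g = t%:R%:P%:P * monic_g.
Proof. by rewrite mul_polyC scalerA -polyCM mulfV // scale1r. Qed.

Lemma monic_g_monic : monic_g \is monic.
Proof. by apply/monicP; rewrite lead_coefZ lead_coef_g -polyCM mulVf. Qed.

Lemma monic_g_dvd u : (exists h, monic_g = u * h) <-> (exists h, g = u * h).
Proof.
split=> [[h gh]|[h gh]].
  by exists (t%:R%:P%:P * h); rewrite g_monic_g gh mulrCA.
by exists (t%:R^-1%:P *: h); rewrite /monic_g gh scalerAr.
Qed.

Lemma component_tight f : component f -> tight f.
Proof. by case=> _ [h gh]; apply: (@tightMl _ _ h); rewrite -gh; exact: tight_g. Qed.

Lemma exists_component (Q : {poly {poly K}} -> Prop) :
    (forall c, c != 0 -> ~ Q c%:P%:P) -> (forall a b, Q (a * b) -> Q a \/ Q b) -> Q g ->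
  exists2 f, component f & Q f.
Proof.
move=> QC QM Qg; have Qg1 : Q monic_g.
  by move: Qg; rewrite g_monic_g => /QM[/(QC _ t_neq0) //|].
have [|f [f_irr Qf [h _ gh]]] := exists_monic_irreducible _ QM monic_g_monic Qg1.
  by apply: (QC 1); rewrite oner_neq0.
by exists f => //; split=> //; apply/monic_g_dvd; exists h.
Qed.

Lemma conj_component m f : component f -> component (conj_poly pK m f).
Proof.
by case=> irr_f dvd_f; split; [apply: conj_monic_irreducible | apply: conj_dvd_g].
Qed.

Lemma component_mul f f' : component f -> component f' -> f != f' ->
  exists h, g = f * f' * h.
Proof. by case=> i1 d1 [i2 d2] ff'; apply: monic_irreducible_mul. Qed.

(** A product is singular at a common zero of two of its factors, and the partial derivatives of
    F(x) - F(y) are F'(x) and -F'(y). *)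
Lemma common_point f f' h a b : separated F = f * f' * h ->
  f.[a, b] = 0 -> f'.[a, b] = 0 -> F^`().[a] = 0 /\ F^`().[b] = 0.
Proof.
move=> def_N fab f'ab; split.
  have <- : (separated F)^`().[a, b] = F^`().[a].
    by rewrite /separated derivB derivC subr0 deriv_map horner_map /= hornerC.
  rewrite def_N -mulrA !derivM !(hornerD, hornerM) fab f'ab.
  by rewrite !(mul0r, mulr0, addr0).
have := congr1 (fun u : {poly {poly K}} => u.[a%:P]) def_N.
rewrite !hornerM {1}/separated hornerD hornerN hornerC horner_map /=.
move=> /(congr1 (fun u : {poly K} => u^`().[b])).
rewrite derivB derivC sub0r hornerN -mulrA !derivM !(hornerD, hornerM) fab f'ab.
rewrite !(mul0r, mulr0, addr0) => /eqP; rewrite oppr_eq0 => /eqP; exact.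
Qed.

Lemma horner2_conj m f a b :
  (conj_poly pK m f).[frob pK m a, frob pK m b] = frob pK m f.[a, b].
Proof.
have -> : (frob pK m a)%:P = map_poly (frob pK m) a%:P by rewrite map_polyC.
by rewrite /conj_poly /extend_scalars !horner_map.
Qed.

(** Otherwise the component and its conjugate are two factors through the fixed point (a, b), and
    F'(a) = 0 follows. *)
Lemma component_fixed_affine m f a b : component f -> f.[a, b] = 0 ->
    frob pK m a = a -> frob pK m b = b -> F^`().[a] != 0 ->
  conj_poly pK m f = f.
Proof.
move=> comp_f fab fix_a fix_b; apply: contraNeq => ne_f.
have fab' : (conj_poly pK m f).[a, b] = 0.
  by rewrite -fix_a -fix_b horner2_conj fab rmorph0.
have [h gh] := component_mul (conj_component m comp_f) comp_f ne_f.
have N_eq : separated F = conj_poly pK m f * f * (h * ('X - 'Y)).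
  by rewrite -g_mul gh mulrA.
by have [-> _] := common_point N_eq fab' fab.
Qed.

(** The form of highest degree, written in w = x / y: its roots are the points (w : 1 : 0) at
    infinity. *)
Definition top (u : {poly {poly K}}) := lead_coef (dilate u).

Lemma topM u v : top (u * v) = top u * top v.
Proof. by rewrite /top dilateM lead_coefM. Qed.

Lemma top_XsubY : top ('X - 'Y) = 'X - 1.
Proof.
have -> : top ('X - 'Y) = lead_coef (('X - 1)%:P * 'X).
  rewrite /top dilateE !rmorphB /= !(map_polyX, map_polyC) /= map_polyX.
  by rewrite /horner_eval !hornerE mulrBl mul1r mulrC.
by rewrite lead_coef_Mmonic ?monicX // lead_coefC.
Qed.

(** The leading form of F(x) - F(y) is t (w^(t - 1) - 1), whose non-zero roots are simple because t
    - 1 is non-zero in K. This replaces the condition F'(a) <> 0 of affine points. *)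
Lemma top_simple A B D w : (t.-1)%:R != 0 :> K -> top (separated F) = A * B * D ->
  w != 0 -> root A w -> ~~ root B w.
Proof.
move=> t1_neq0; have [szF lcF] := size_F; rewrite /top (top_separated F_gt1) szF lcF.
move=> def_top w_neq0 /rootP Aw; apply/negP => /rootP Bw.
have := congr1 (fun u : {poly K} => u^`().[w]) def_top.
rewrite !derivM !(hornerD, hornerM) Aw Bw !(mul0r, mulr0, addr0).
rewrite derivZ derivB derivXn derivC subr0 hornerZ hornerMn hornerXn => /eqP.
rewrite mulf_eq0 (negPf t_neq0) -mulr_natl mulf_eq0 (negPf t1_neq0).
by rewrite expf_eq0 (negPf w_neq0) andbF.
Qed.

Lemma top_root_neq0 f w : component f -> root (top f) w -> w ^+ t.-1 = 1.
Proof.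
case=> _ [h gh] /rootP fw.
have [szF lcF] := size_F; have := top_separated F_gt1; rewrite szF lcF -/(top _).
rewrite -g_mul [g]gh !topM => /(congr1 (fun u : {poly K} => u.[w])).
rewrite !hornerM fw !mul0r hornerZ !hornerE => /esym/eqP.
by rewrite mulf_eq0 (negPf t_neq0) subr_eq0 => /eqP.
Qed.

Lemma top_conj m f w : tight f -> (top (conj_poly pK m f)).[frob pK m w] = frob pK m (top f).[w].
Proof.
move=> tf; suff -> : top (conj_poly pK m f) = map_poly (frob pK m) (top f) by rewrite horner_map.
have E : dilate (conj_poly pK m f) = extend_scalars (frob pK m) (dilate f).
  apply/polyP => i; apply/polyP => j; rewrite coef_extend !coef_dilate.
  by case: ifP => _; rewrite ?rmorph0 // coef_extend.
by rewrite /top E lead_coef_extend.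
Qed.

Lemma component_fixed_infinity m f w : (t.-1)%:R != 0 :> K ->
  component f -> root (top f) w -> frob pK m w = w -> conj_poly pK m f = f.
Proof.
move=> t1_neq0 comp_f fw fix_w; apply/eqP; apply: contraT => ne_f.
have w_neq0 : w != 0.
  have := top_root_neq0 comp_f fw; apply: contra_eq_neq => ->.
  by rewrite expr0n -subn1 subn_eq0 leqNgt (ltn_trans _ t_ge3) // eq_sym oner_neq0.
have fw' : root (top (conj_poly pK m f)) w.
  by rewrite rootE -{1}fix_w top_conj ?(rootP fw) ?rmorph0 //; apply: component_tight.
have [h gh] := component_mul (conj_component m comp_f) comp_f ne_f.
have topN : top (separated F) =
    top (conj_poly pK m f) * top f * (top h * top ('X - 'Y)).
  by rewrite -g_mul gh !topM mulrA.
by have := top_simple t1_neq0 topN w_neq0 fw'; rewrite fw.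
Qed.

End Components.

Section FixedComponents.

Variables (K : closedFieldType) (p t : nat).
Hypotheses (p_prime : prime p) (pK : p \in [pchar K]).
Hypotheses (t_ge3 : (3 <= t)%N) (t_neq0 : t%:R != 0 :> K).

Let F := diff_power K t.
Let g := g_poly K t.

(** The quotient (b + 1) / b is an n-th root of unity. Put u = b^(p^m - 1) = (b + 1)^(p^m - 1): then
    (b + 1)^(p^m) = b^(p^m) + 1 reads (b + 1) u = b u + 1, so u = 1. *)
Lemma frob_fix_quotient n m b : (n %| p ^ m - 1)%N -> (b + 1) ^+ n = b ^+ n ->
  frob pK m b = b.
Proof.
have pm_gt0 : (0 < p ^ m)%N by rewrite expn_gt0 prime_gt0.
move=> /dvdnP[k k_eq] bn; have b1 : (b + 1) ^+ (p ^ m - 1) = b ^+ (p ^ m - 1).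
  by rewrite k_eq mulnC !exprM bn.
have b_neq0 : b ^+ (p ^ m - 1) != 0.
  have [b0|nz] := eqVneq b 0; last by rewrite expf_neq0.
  by rewrite -b1 b0 add0r expr1n oner_neq0.
have := exprDn_pchar b 1 (pchar_nat_expn m pK); rewrite expr1n /frob.
have -> : (p ^ m)%N = (p ^ m - 1).+1 by rewrite subn1 prednK.
rewrite !exprSr b1 mulrDr mulr1 => /addrI ->.
by rewrite mul1r.
Qed.

Lemma natr_dvd_neq0 (d n : nat) : (d %| n)%N -> n%:R != 0 :> K -> d%:R != 0 :> K.
Proof. by move=> /dvdnP[k ->]; rewrite natrM mulf_eq0 negb_or => /andP[]. Qed.

Lemma F_deriv_neq0 a n : (n %| t)%N -> (a + 1) ^+ n = a ^+ n -> F^`().[a] != 0.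
Proof.
move=> /dvdnP[k t_eq] an.
have at' : (a + 1) ^+ t = a ^+ t by rewrite t_eq mulnC !exprM an.
have [t' t'E] : {t' | t = t'.+1} by exists t.-1; rewrite prednK // (ltn_trans _ t_ge3).
have a_neq0 : a ^+ t' != 0.
  have [a0|nz] := eqVneq a 0; last by rewrite expf_neq0.
  move/eqP: at'; rewrite t'E a0 add0r expr1n expr0n /=.
  by rewrite oner_eq0.
rewrite /F t'E deriv_diff_power hornerZ mulf_neq0 -?t'E //.
rewrite -/(root _ _) diff_power_root; apply: contra_neq a_neq0 => at1.
move: at'; rewrite t'E !exprSr at1 mulrDr mulr1 => /eqP.
by rewrite -subr_eq0 addrAC subrr add0r => /eqP.
Qed.

Lemma g_horner2 a b : g.[a, b] * (a - b) = F.[a] - F.[b].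
Proof.
have := congr1 (fun u : {poly {poly K}} => u.[a%:P]) (g_mul K t).
rewrite hornerM hornerXsubC /separated hornerD hornerN hornerC horner_map /=.
move=> /(congr1 (fun u : {poly K} => u.[b])).
by rewrite hornerM ![(_%:P - _).[b]]hornerD !hornerN !hornerC hornerX.
Qed.

Lemma g_point a b : a != b -> F.[a] = F.[b] -> g.[a, b] = 0.
Proof.
move=> ne_ab Fab; have /eqP := g_horner2 a b.
by rewrite Fab subrr mulf_eq0 subr_eq0 (negPf ne_ab) orbF => /eqP.
Qed.

(** The equation (x + 1)^d = x^d has d - 1 solutions, and a point off the diagonal needs two of
    them; hence 3 <= d. They are zeros of F, not critical, and fixed by the m-th power of
    Frobenius. *)
Lemma fixed_component_affine m : (3 <= gcdn (p ^ m - 1) t)%N ->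
  exists2 f, component t f & conj_poly pK m f = f.
Proof.
set d := gcdn _ _ => d_ge3; have d_dvd : (d %| t)%N by apply: dvdn_gcdr.
have d_neq0 := natr_dvd_neq0 d_dvd t_neq0.
have [C [uC szC memC _]] := critical_points (ltnW (ltnW d_ge3)) d_neq0.
have [a [b [C' CE]]] : exists a b C', C = a :: b :: C'.
  by move: szC d_ge3; case: (C) => [|a [|b C']] /=; [lia|lia|exists a, b, C'].
have aP : (a + 1) ^+ d = a ^+ d by apply/eqP; rewrite -memC CE mem_head.
have bP : (b + 1) ^+ d = b ^+ d by apply/eqP; rewrite -memC CE !inE eqxx orbT.
have ne_ab : a != b by move: uC; rewrite CE /= inE negb_or => /andP[/andP[]].
have F0 x : (x + 1) ^+ d = x ^+ d -> F.[x] = 0.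
  move=> xP; apply/rootP; rewrite diff_power_root; have /dvdnP[k ->] := d_dvd.
  by rewrite mulnC !exprM xP.
have gab : g.[a, b] = 0 by apply: g_point; rewrite ?F0.
have [||f comp_f fab] := @exists_component K t t_ge3 t_neq0 (fun u => u.[a, b] = 0) _ _ gab.
- by move=> c c_neq0 /eqP; rewrite !hornerC (negPf c_neq0).
- by move=> u v /eqP; rewrite !hornerM mulf_eq0 => /orP[]/eqP; [left|right].
exists f => //; apply: component_fixed_affine fab _ _ (F_deriv_neq0 d_dvd aP) => //.
  by apply: frob_fix_quotient aP; apply: dvdn_gcdl.
by apply: frob_fix_quotient bP; apply: dvdn_gcdl.
Qed.

(** Here all zeros of F are fixed. A component meets the line x = a, with a such a zero, and since
    F(b) = F(a) on it the ordinate b is another zero or a itself. *)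
Lemma component_fixed_t m f : component t f -> (t %| p ^ m - 1)%N -> conj_poly pK m f = f.
Proof.
move=> comp_f t_dvd; have tf := component_tight t_ge3 t_neq0 comp_f.
have [C [uC szC memC _]] := critical_points (ltnW (ltnW t_ge3)) t_neq0.
have [a [C' CE]] : exists a C', C = a :: C'.
  by move: szC t_ge3; case: (C) => [|a C'] /=; [lia|exists a, C'].
have aP : (a + 1) ^+ t = a ^+ t by apply/eqP; rewrite -memC CE mem_head.
have : size f.[a%:P] != 1.
  rewrite size_tight_horner //; case: comp_f => [[_ f_gt1 _] _].
  by rewrite gtn_eqF.
move=> /closed_rootP [b /rootP fab].
have F0 : F.[a] = 0 by apply/rootP; rewrite diff_power_root aP.
have bP : (b + 1) ^+ t = b ^+ t.
  apply/eqP; rewrite -diff_power_root; apply/rootP.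
  case: comp_f => _ [h gh].
  have /esym/eqP := g_horner2 a b; rewrite F0 sub0r /g gh !hornerM fab !mul0r.
  by rewrite oppr_eq0 => /eqP.
apply: component_fixed_affine fab _ _ (F_deriv_neq0 (dvdnn t) aP) => //.
  exact: frob_fix_quotient aP.
exact: frob_fix_quotient bP.
Qed.

Section Infinity.

Hypothesis t1_neq0 : (t.-1)%:R != 0 :> K.

Lemma top_g_mul : top g * ('X - 1) = t%:R *: ('X^(t.-1) - 1).
Proof.
have [szF lcF] := size_F t_ge3 t_neq0.
have := top_separated (F_gt1 t_ge3 t_neq0); rewrite szF lcF -/(top _) => <-.
by rewrite -(g_mul K t) topM top_XsubY.
Qed.

Lemma frob_fix_unity n m (w : K) : (n %| p ^ m - 1)%N -> w ^+ n = 1 -> frob pK m w = w.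
Proof.
have pm_gt0 : (0 < p ^ m)%N by rewrite expn_gt0 prime_gt0.
move=> /dvdnP[k k_eq] wn.
by rewrite /frob -(subnK pm_gt0) addn1 exprSr k_eq mulnC exprM wn expr1n mul1r.
Qed.

(** One root of unity w <> 1 suffices, hence 2 <= d; the direction w = 1 is lost to the factor x -
    y. The solution a of (a + 1)^d = a^d only serves to produce w = (a + 1) / a. *)
Lemma fixed_component_infinity m : (2 <= gcdn (p ^ m - 1) (t - 1))%N ->
  exists2 f, component t f & conj_poly pK m f = f.
Proof.
rewrite (subn1 t); set d := gcdn _ _ => d_ge2.
have d_dvd : (d %| t.-1)%N by apply: dvdn_gcdr.
have d_neq0 := natr_dvd_neq0 d_dvd t1_neq0.
have [C [uC szC memC _]] := critical_points (ltnW d_ge2) d_neq0.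
have [a [C' CE]] : exists a C', C = a :: C'.
  by move: szC d_ge2; case: (C) => [|a C'] /=; [lia|exists a, C'].
have aP : (a + 1) ^+ d = a ^+ d by apply/eqP; rewrite -memC CE mem_head.
have a_neq0 : a != 0.
  apply: contra_eq_neq aP => ->; rewrite add0r expr1n expr0n.
  by rewrite gtn_eqF ?oner_neq0 // ltnW.
pose w := (a + 1) / a.
have wd : w ^+ d = 1 by rewrite expr_div_n aP divff // expf_neq0.
have w_neq1 : w != 1.
  rewrite -subr_eq0 /w -[1 in X in _ - X](divff a_neq0) -mulrBl addrAC subrr add0r.
  by rewrite mul1r invr_eq0.
have gw : root (top g) w.
  have := congr1 (fun u : {poly K} => u.[w]) top_g_mul.
  have /dvdnP[k ->] := d_dvd.
  rewrite hornerM !hornerE mulnC exprM wd expr1n subrr mulr0 => /eqP.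
  by rewrite mulf_eq0 subr_eq0 (negPf w_neq1) orbF.
have [||f comp_f fw] := @exists_component K t t_ge3 t_neq0 (fun u => root (top u) w) _ _ gw.
- move=> c c_neq0; have -> : top c%:P%:P = c%:P.
    by rewrite /top /dilate map_polyC /= hornerC map_polyC /= lead_coefC.
  by rewrite rootC (negPf c_neq0).
- by move=> u v; rewrite topM rootM => /orP[]; [left|right].
exists f => //; apply: (component_fixed_infinity t_ge3 t_neq0 t1_neq0 comp_f fw).
by apply: frob_fix_unity wd; apply: dvdn_gcdl.
Qed.

(** Every component has a point at infinity, and all of these are now fixed. *)
Lemma component_fixed_t1 m f : component t f -> (t.-1 %| p ^ m - 1)%N ->
  conj_poly pK m f = f.
Proof.
move=> comp_f t_dvd; have tf := component_tight t_ge3 t_neq0 comp_f.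
have f_mon : f \is monic by case: comp_f => [[]].
have f_gt1 : (1 < size f)%N by case: comp_f => [[]].
have : size (top f) != 1.
  rewrite gtn_eqF //; apply: leq_trans f_gt1 _; apply: contraT; rewrite -ltnNge => lt_sz.
  have := nth_default 0 (_ : size (top f) <= (size f).-1)%N.
  rewrite -ltnS prednK ?size_poly_gt0 ?monic_neq0 // => /(_ lt_sz).
  case: tf => _ szd _; rewrite /top lead_coefE szd coef_dilate leqnn subnn -lead_coefE.
  by rewrite (monicP f_mon) coef1 => /eqP; rewrite oner_eq0.
move=> /closed_rootP [w fw]; apply: (component_fixed_infinity t_ge3 t_neq0 t1_neq0 comp_f fw).
by apply: frob_fix_unity t_dvd _; apply: top_root_neq0 fw.
Qed.

End Infinity.

End FixedComponents.

(** * Descent to the prime field *)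

Lemma ex_least (P : nat -> Prop) : (exists n, P n) ->
  exists2 n, P n & forall m, P m -> (n <= m)%N.
Proof.
case=> n; elim: {n}n.+1 {-2}n (ltnSn n) => // k IHk n lt_nk Pn.
have [[m [lt_mn Pm]]|no_m] := classic (exists m, (m < n)%N /\ P m).
  by apply: (IHk m) => //; apply: leq_trans lt_mn _.
exists n => // m Pm; rewrite leqNgt; apply/negP => lt_mn.
by apply: no_m; exists m.
Qed.

Lemma finField_generator (L : finFieldType) : exists x : L,
  forall y : L, y != 0 -> exists k, y = x ^+ k.
Proof.
have /cyclicP[x genx] := field_unit_group_cyclic [set: {unit L}]%G.
exists (val x) => y y_neq0; have y_unit : y \is a GRing.unit by rewrite unitfE.
have : FinRing.unit L y_unit \in <[x]>%g by rewrite -genx inE.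
by case/cycleP => k /(congr1 val); rewrite /= FinRing.val_unitX => ->; exists k.
Qed.

(** Let [x] generate the units of L, let [mu] be a polynomial of least size over F vanishing at [x],
    and let [z] be a root of [mu] in K: each element of L is q(x) for some q over F, and is sent to
    q(z). A bare morphism is enough, since [extend_g_poly] holds for every morphism. *)
Lemma finField_embedding (F L : finFieldType) (K : closedFieldType)
    (phi : {rmorphism F -> L}) (psi : {rmorphism F -> K}) :
  exists chi : {rmorphism L -> K}, True.
Proof.
have [x x_gen] := finField_generator L.
pose vanish (q : {poly F}) := (map_poly phi q).[x] = 0.
have vanishB q r : vanish q -> vanish r -> vanish (q - r).
  by rewrite /vanish rmorphB hornerD hornerN => -> ->; rewrite subrr.
have [|n [mu [mu_neq0 mu_x szmu]] n_min] := ex_least (P := fun n => exists q,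
    [/\ q != 0, vanish q & size q = n]).
  exists (size ('X^(#|L|) - 'X : {poly F})), ('X^(#|L|) - 'X); split=> //; last first.
    by rewrite /vanish rmorphB /= map_polyXn map_polyX !hornerE expf_card subrr.
  apply/eqP => /(congr1 (fun q : {poly F} => q`_#|L|)).
  rewrite coefB coefXn coefX eqxx coef0 gtn_eqF ?finNzRing_gt1 // subr0 => /eqP.
  by rewrite oner_eq0.
have vanish_dvd q : vanish q -> mu %| q.
  move=> q_x; apply/modp_eq0P/eqP; apply: contraT => r_neq0.
  have r_x : vanish (q %% mu).
    have -> : q %% mu = q - q %/ mu * mu by rewrite {2}(divp_eq q mu) addrAC subrr add0r.
    by apply: vanishB => //; rewrite /vanish rmorphM hornerM mu_x mulr0.
  have := n_min _ (ex_intro _ _ (And3 r_neq0 r_x erefl)).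
  by rewrite leqNgt -szmu ltn_modp mu_neq0.
have : size (map_poly psi mu) != 1.
  rewrite size_map_poly; apply/negP => /size_poly1P[c c_neq0 mu_c].
  by move: mu_x; rewrite /vanish mu_c map_polyC hornerC => /eqP; rewrite fmorph_eq0 (negPf c_neq0).
move=> /closed_rootP[z mu_z]; pose ev (q : {poly F}) := (map_poly psi q).[z].
have ev0 q : vanish q -> ev q = 0.
  by move=> /vanish_dvd/dvdpP[w ->]; rewrite /ev rmorphM hornerM (rootP mu_z) mulr0.
have rep_ex (y : L) : exists q : {poly F}, (map_poly phi q).[x] == y.
  have [->|/x_gen[k ->]] := eqVneq y 0; first by exists 0; rewrite map_poly0 horner0.
  by exists 'X^k; rewrite map_polyXn hornerXn.
pose rep y := xchoose (rep_ex y).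
have repK y : (map_poly phi (rep y)).[x] = y by apply/eqP/(xchooseP (rep_ex y)).
pose chi y := ev (rep y).
have ev_eq q r : (map_poly phi q).[x] = (map_poly phi r).[x] -> ev q = ev r.
  move=> qr; apply/eqP; rewrite -subr_eq0; apply/eqP.
  transitivity (ev (q - r)); first by rewrite /ev rmorphB hornerD hornerN.
  by apply: ev0; rewrite /vanish rmorphB hornerD hornerN qr subrr.
have chiB : zmod_morphism chi.
  move=> y1 y2; transitivity (ev (rep y1 - rep y2)); last by rewrite /ev rmorphB hornerD hornerN.
  by apply: ev_eq; rewrite rmorphB hornerD hornerN !repK.
have chiM : monoid_morphism chi.
  split=> [|y1 y2].
    transitivity (ev 1); last by rewrite /ev rmorph1 hornerC.
    by apply: ev_eq; rewrite repK rmorph1 hornerC.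
  transitivity (ev (rep y1 * rep y2)); last by rewrite /ev rmorphM hornerM.
  by apply: ev_eq; rewrite rmorphM hornerM !repK.
pose mixB := GRing.isZmodMorphism.Build L K chi chiB.
pose mixM := GRing.isMonoidMorphism.Build L K chi chiM.
pose chi' : {rmorphism L -> K} := HB.pack chi mixB mixM.
by exists chi'.
Qed.

Section Cases.

Variables (p t : nat).
Hypotheses (p_prime : prime p) (t_ge3 : (3 <= t)%N) (p_t : ~~ (p %| t)%N).
Variables (K : closedFieldType) (emb : {rmorphism 'F_p -> K}).

Lemma pchar_K : p \in [pchar K].
Proof. by apply: (rmorph_pchar emb); apply: pchar_Fp. Qed.

Local Notation pK := pchar_K.

Lemma natr_neq0 n : (n%:R != 0 :> K) = ~~ (p %| n)%N.
Proof. by rewrite (dvdn_pcharf pK). Qed.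

Lemma t_neq0 : t%:R != 0 :> K. Proof. by rewrite natr_neq0. Qed.

Lemma fixed_descends u : conj_poly pK 1 u = u -> exists v, extend_scalars emb v = u.
Proof.
move=> fix_u; apply: descend_scalars => i j.
apply: (@frob_fixed_im _ _ pK _ emb 1); first by rewrite card_Fp // expn1.
by rewrite -[in RHS]fix_u coef_extend.
Qed.

Lemma fixed_component_factor f : component t f -> conj_poly pK 1 f = f ->
  has_abs_irreducible_factor emb (g_poly 'F_p t).
Proof.
move=> [irr_f [h gh]] /fixed_descends[f0 f_eq]; exists f0; split.
  apply: (@descend_dvd _ _ emb _ _ h); last by rewrite extend_g_poly f_eq.
  by case: irr_f; rewrite -f_eq extend_monic.
by rewrite /absolutely_irreducible f_eq; apply: monic_irreducible_elt.
Qed.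

Lemma conj_natr m n : conj_poly pK m (n%:R)%:P%:P = (n%:R)%:P%:P.
Proof. by rewrite /conj_poly /extend_scalars map_polyC /= map_polyC /= rmorph_nat. Qed.

Lemma conj_monic_g m : conj_poly pK m (monic_g K t) = monic_g K t.
Proof.
have c_neq0 : (t%:R : K)%:P%:P != 0 by rewrite !polyC_eq0 t_neq0.
apply: (mulfI c_neq0); rewrite -{1}(conj_natr m) -conj_polyM.
by rewrite -(g_monic_g t_neq0) conj_g_poly.
Qed.

Lemma full_divisor f h : f \is monic -> g_poly K t = f * h -> size h = 1 -> f = monic_g K t.
Proof.
move=> f_monic gh /eqP/size_poly1P[c c_neq0 h_c].
have c_eq : c = t%:R%:P.
  by rewrite -(lead_coef_g t_ge3 t_neq0) gh lead_coef_monicM // h_c lead_coefC.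
have tC_neq0 : (t%:R : K)%:P%:P != 0 by rewrite !polyC_eq0 t_neq0.
by apply: (mulfI tC_neq0); rewrite -(g_monic_g t_neq0) gh h_c c_eq mulrC.
Qed.

(** A component fixed by the m-th power of Frobenius is defined over the image of L, where g is
    irreducible; so it is g made monic, which is already defined over the prime field. *)
Lemma case_extension m (L : finFieldType) (phi : {rmorphism 'F_p -> L}) :
    #|L| = (p ^ m)%N -> irreducible_elt (extend_scalars phi (g_poly 'F_p t)) ->
    (exists2 f, component t f & conj_poly pK m f = f) ->
  has_abs_irreducible_factor emb (g_poly 'F_p t).
Proof.
move=> cardL [_ _ g_irr] [f comp_f fix_f]; apply: (fixed_component_factor comp_f).
have [chi _] := finField_embedding phi emb.
have [f0 f_eq] : exists f0, extend_scalars chi f0 = f.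
  apply: descend_scalars => i j; apply: (frob_fixed_im (pK := pK) chi cardL).
  by rewrite -[in RHS]fix_f coef_extend.
have [[f_monic f_gt1 _] [h gh]] := comp_f.
have f0_monic : f0 \is monic by rewrite -(extend_monic chi) f_eq.
have [h0 gh0] : exists h0, g_poly L t = f0 * h0.
  by apply: (@descend_dvd _ _ chi _ _ h); rewrite ?extend_g_poly ?f_eq.
have /g_irr[] : extend_scalars phi (g_poly 'F_p t) = f0 * h0 by rewrite extend_g_poly.
  by rewrite poly_unitE -(size_extend chi) f_eq gtn_eqF.
rewrite poly_unitE => /andP[/eqP h0_1 _].
suff -> : f = monic_g K t by apply: conj_monic_g.
apply: (@full_divisor _ (extend_scalars chi h0)) => //; last by rewrite size_extend.
by rewrite -f_eq -extendM -gh0 extend_g_poly.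
Qed.

Lemma irreducible_prod_dvd (s : seq {poly {poly K}}) u : uniq s ->
    (forall f, f \in s -> monic_irreducible f /\ exists h, u = f * h) ->
  exists h, u = \prod_(f <- s) f * h.
Proof.
elim: s u => [|f s IHs] u /=; first by exists u; rewrite big_nil mul1r.
move=> /andP[fs us] dvd_u; have [irr_f [h u_eq]] := dvd_u f (mem_head _ _).
have [|w h_eq] := IHs h us; last by exists w; rewrite big_cons u_eq h_eq mulrA.
move=> f' f's; have [|irr_f' dvd_f'] := dvd_u f'; first by rewrite inE f's orbT.
have ff' : f != f' by apply: contraNneq fs => ->.
split=> //; have [w w_eq] := monic_irreducible_mul irr_f irr_f' ff' (ex_intro _ _ u_eq) dvd_f'.
exists w; have f_neq0 : f != 0 by apply: monic_neq0; case: irr_f.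
by apply: (mulfI f_neq0); rewrite -u_eq w_eq mulrA.
Qed.

(** The product of the conjugates of [f] is fixed by Frobenius and descends to a factor of the
    irreducible g. So all components are conjugate to [f], and powers of Frobenius commute. *)
Lemma conj_fixed_all m f : irreducible_elt (g_poly 'F_p t) -> (0 < m)%N ->
    component t f -> conj_poly pK m f = f ->
  forall f', component t f' -> conj_poly pK m f' = f'.
Proof.
move=> [_ _ g_irr] m_gt0 comp_f fix_f f' comp_f'.
pose P r := (0 < r)%N && (conj_poly pK r f == f).
have Pm : exists r, P r by exists m; rewrite /P m_gt0 fix_f eqxx.
have [r /andP[r_gt0 /eqP fix_r] r_min] := ex_minnP Pm.
pose s := [seq conj_poly pK j f | j <- iota 0 r].
have conj_comp j : component t (conj_poly pK j f) by apply: conj_component.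
have s_comp f1 : f1 \in s -> component t f1 by case/mapP => j _ ->.
have uniq_s : uniq s.
  rewrite map_inj_in_uniq ?iota_uniq // => j k; rewrite !mem_iota !add0n /=.
  wlog le_jk : j k / (j <= k)%N => [wlg lt_jr lt_kr E|lt_jr lt_kr].
    by case: (leqP j k) => [|/ltnW] le; [apply: wlg | apply/esym/wlg].
  rewrite -{1}(subnKC le_jk) -conj_polyD => /extend_inj E.
  have [gt0|] := posnP (k - j); first by apply/eqP; rewrite eqn_leq le_jk -subn_eq0 gt0.
  move=> gt0; have := r_min (k - j)%N; rewrite /P gt0 -E eqxx => /(_ isT).
  by rewrite leqNgt (leq_ltn_trans (leq_subr _ _) lt_kr).
pose u := \prod_(f1 <- s) f1.
have [h gh] : exists h, g_poly K t = u * h by apply: irreducible_prod_dvd => // f1 /s_comp.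
have u_monic : u \is monic.
  by rewrite /u big_seq; apply: monic_prod => f1 /s_comp [[]].
have conj1 : conj_poly pK 1 1 = 1 by rewrite /conj_poly /extend_scalars rmorph1.
have fix_u : conj_poly pK 1 u = u.
  rewrite /u (big_morph _ (conj_polyM pK 1) conj1) /s !big_map -[X in iota _ X]subn0 -/(index_iota 0 r).
  (* Frobenius permutes the factors cyclically: the last one is sent to the first. *)
  rewrite !big_mkord; case: (r) r_gt0 fix_r => // r' _ fix_r.
  rewrite big_ord_recr [in RHS]big_ord_recl /= conj_polyD fix_r conj_poly0 mulrC.
  by congr (_ * _); apply: eq_bigr => j _; rewrite conj_polyD.
have [u0 u_eq] := fixed_descends fix_u.
have [h0 gh0] : exists h0, g_poly 'F_p t = u0 * h0.
  apply: (@descend_dvd _ _ emb _ _ h); last by rewrite extend_g_poly u_eq.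
  by rewrite -(extend_monic emb) u_eq.
have f_s : f \in s by apply/mapP; exists 0%N; rewrite ?conj_poly0 ?mem_iota.
have [w u_w] : exists w, u = f * w by exists (\prod_(f1 <- rem f s) f1); rewrite /u (big_rem f).
have [[f_monic f_gt1 _] _] := comp_f.
have u_gt1 : size u != 1.
  rewrite u_w; apply/negP; rewrite size_mul_eq1 => /andP[/eqP f1 _].
  by rewrite f1 in f_gt1.
have h_eq : h = extend_scalars emb h0.
  apply: (mulfI (monic_neq0 u_monic)); rewrite -gh -{1}u_eq -extendM -gh0.
  by rewrite extend_g_poly.
have h_1 : size h == 1.
  case: (g_irr _ _ gh0); rewrite poly_unitE => /andP[sz1 _]; last by rewrite h_eq size_extend.
  by move: u_gt1; rewrite -u_eq size_extend sz1.
(* Otherwise f' u would divide g, whereas g / u is constant in x. *)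
have : f' \in s.
  apply: contraT => f's.
  have [|f1|h' gh'] := @irreducible_prod_dvd (f' :: s) (g_poly K t).
  - by rewrite /= f's.
  - by rewrite inE => /predU1P[->|/s_comp] //.
  move: gh'; rewrite big_cons -/u gh -mulrA mulrCA => /(mulfI (monic_neq0 u_monic)) h_f'.
  move: h_1; rewrite h_f' size_mul_eq1 => /andP[/eqP f'1 _].
  by case: comp_f' => [[_ + _] _]; rewrite f'1.
case/mapP => j _ ->; rewrite conj_polyD addnC -conj_polyD fix_f; exact.
Qed.

Lemma case_irreducible (E : pred nat) : irreducible_elt (g_poly 'F_p t) ->
    (forall d, (3 <= d)%N -> E d ->
      exists2 f, component t f & conj_poly pK (mult_order p d) f = f) ->
    \big[gcdn/0%N]_(3 <= d < t.+1 | E d) mult_order p d = 1%N ->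
  has_abs_irreducible_factor emb (g_poly 'F_p t).
Proof.
rewrite big_nat_cond => g_irr E_fix gcd1.
(* An empty gcd is 0, so the value 1 provides an index. *)
have [d [d_ge3 Ed]] : exists d, (3 <= d)%N /\ E d.
  apply: NNPP => noE; move: gcd1; rewrite big1 // => d /andP[/andP[d_ge3 _] Ed].
  by case: noE; exists d.
have [f comp_f _] := E_fix d d_ge3 Ed; apply: (fixed_component_factor comp_f).
rewrite -[X in conj_poly _ X]gcd1; elim/big_ind: _ => [|a b|e /andP[/andP[e_ge3 _] Ee]].
- exact: conj_poly0.
- exact: conj_poly_fix_gcd.
have [f1 comp_f1 fix_f1] := E_fix e e_ge3 Ee.
by apply: conj_fixed_all comp_f1 fix_f1 _ comp_f => //; apply: order_gt0.
Qed.

Lemma mult_order_dvd n : (0 < n)%N -> ~~ (p %| n)%N -> (n %| p ^ mult_order p n - 1)%N.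
Proof.
move=> n_gt0 p_n; rewrite -eqn_mod_dvd ?expn_gt0 ?prime_gt0 //.
by rewrite mult_orderP // prime_coprime.
Qed.

Lemma case_multiplicative_order d : ~~ (p %| t - 1)%N ->
    (exists2 f, component t f & conj_poly pK (mult_order p d) f = f) ->
    gcdn (gcdn (mult_order p (t - 1)) (mult_order p t)) (mult_order p d) = 1%N ->
  has_abs_irreducible_factor emb (g_poly 'F_p t).
Proof.
move=> p_t1 [f comp_f fix_f] gcd1; apply: (fixed_component_factor comp_f).
rewrite -[X in conj_poly _ X]gcd1; apply: conj_poly_fix_gcd fix_f; apply: conj_poly_fix_gcd.
  apply: (@component_fixed_t1 K p t p_prime pK t_ge3 t_neq0) => //.
    by rewrite natr_neq0 -subn1.
  by rewrite -subn1 mult_order_dvd // subn_gt0 (leq_trans _ t_ge3).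
apply: (@component_fixed_t K p t p_prime pK t_ge3 t_neq0) => //.
by rewrite mult_order_dvd // (leq_trans _ t_ge3).
Qed.

End Cases.

(** * Critical values *)

Section Core.

Variables (K : closedFieldType) (p i L : nat).
Hypotheses (p_prime : prime p) (pK : p \in [pchar K]).

Let q := (p ^ i)%N.
Let t := (q * L).+1.
Let F := diff_power K t.
Let g := g_poly K t.

Hypotheses (t_ge3 : (3 <= t)%N) (t_neq0 : t%:R != 0 :> K) (L_neq0 : L%:R != 0 :> K).
Hypothesis no_fixed : forall f, component t f -> conj_poly pK 1 f <> f.

Variable C : seq K.
Hypotheses (C_uniq : uniq C) (C_size : size C = L.-1)
  (C_mem : forall x, (x \in C) = ((x + 1) ^+ L == x ^+ L))
  (C_prod : diff_power K L = L%:R *: \prod_(c <- C) ('X - c%:P)).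

(** These are ordered pairs, the diagonal included. *)
Definition num_equal_values : nat :=
  (\sum_(c <- C) \sum_(k <- C) (F.[c] == F.[k]))%N.

Lemma q_gt0 : (0 < q)%N. Proof. by rewrite expn_gt0 prime_gt0. Qed.

Lemma kappa_neq0 : t%:R * L%:R ^+ q != 0 :> K.
Proof. by rewrite mulf_neq0 ?expf_neq0. Qed.

Lemma F_derivE : F^`() = (t%:R * L%:R ^+ q) *: \prod_(c <- C) ('X - c%:P) ^+ q.
Proof.
rewrite /F deriv_diff_power diff_power_Frobenius // C_prod exprZn scalerA.
by rewrite prodrXl.
Qed.

Lemma half_degree (f : {poly {poly K}}) : component t f -> (2 * (size f).-1 <= t - 2)%N.
Proof.
move=> comp_f; have ne_f : conj_poly pK 1 f != f by apply/eqP/no_fixed.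
have [h gh] := component_mul (conj_component pK 1 comp_f) comp_f ne_f.
have g_neq0 := tight_neq0 (tight_g t_ge3 t_neq0).
have f_neq0 : f != 0 by apply: monic_neq0; case: comp_f => [[]].
have f'_neq0 : conj_poly pK 1 f != 0 by rewrite -size_poly_eq0 size_extend size_poly_eq0.
have h_neq0 : h != 0 by apply: contraNneq g_neq0 => h0; rewrite gh h0 mulr0.
have := size_g t_ge3 t_neq0; rewrite gh size_mul ?mulf_neq0 // size_mul // size_extend.
have := size_poly_gt0 f; have := size_poly_gt0 h; rewrite f_neq0 h_neq0.
by move: (size f) (size h) (t) => a b c; clear; lia.
Qed.

(** A zero of order q + 2 of F(k) - F would be a zero of order at least q + 1 of F', whose zeros
    have order exactly q. *)
Lemma mup_F_value c k : c \in C -> k \in C ->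
  (mup c (F.[k]%:P - F)%R <= q.+1 * (F.[c] == F.[k]))%N.
Proof.
move=> cC kC; set u := _ - _; have [Fck|neF] := eqVneq F.[c] F.[k]; last first.
  by rewrite mupNroot // rootE hornerD hornerN hornerC subr_eq0 eq_sym.
have u_neq0 : u != 0.
  apply: contraTneq (F_gt1 t_ge3 t_neq0); rewrite /u => /eqP.
  by rewrite subr_eq0 -/F => /eqP <-; rewrite -leqNgt size_polyC leq_b1.
have u' : u^`() = - F^`() by rewrite /u derivB derivC sub0r.
rewrite muln1 leqNgt mup_geq //; apply/negP => /dvdp_deriv.
have F'_neq0 : F^`() != 0.
  rewrite F_derivE scale_poly_eq0 negb_or kappa_neq0 prodf_seq_neq0.
  by apply/allP => x _ /=; rewrite expf_neq0 // polyXsubC_eq0.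
rewrite u' dvdpNr -mup_geq // F_derivE -mul_polyC mupMr ?rootC ?kappa_neq0 // (big_rem c) //=.
rewrite mupMl ?mup_XsubCX ?eqxx ?ltnn // rootE horner_prod prodf_seq_neq0.
apply/allP => x; rewrite mem_rem_uniq // inE => /andP[xc _] /=.
by rewrite horner_exp !hornerE expf_neq0 // subr_eq0 eq_sym.
Qed.

Definition total_order (u : {poly {poly K}}) : nat :=
  (\sum_(c <- C) \sum_(k <- C) mup c u.[k%:P])%N.

Lemma total_orderM u v : tight u -> tight v ->
  total_order (u * v) = (total_order u + total_order v)%N.
Proof.
move=> tu tv; rewrite /total_order -big_split; apply: eq_bigr => c _.
rewrite -big_split; apply: eq_bigr => k _ /=; rewrite hornerM mupM //.
  by rewrite -size_poly_eq0 size_tight_horner // size_poly_eq0 tight_neq0.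
by rewrite -size_poly_eq0 size_tight_horner // size_poly_eq0 tight_neq0.
Qed.

(** The orders of F(k) - F(y) are those of g plus those of x - y; the latter contribute 1 for each
    of the L - 1 diagonal pairs. *)
Lemma total_order_monic_g :
  (total_order (monic_g K t) + L.-1 <= q.+1 * num_equal_values)%N.
Proof.
have mg_neq0 k : (monic_g K t).[k%:P] != 0.
  rewrite /monic_g hornerZ mulf_neq0 ?polyC_eq0 ?invr_eq0 //.
  by rewrite -size_poly_eq0 size_tight_horner ?size_poly_eq0 ?tight_neq0 //; apply: tight_g.
have E c k : c \in C -> k \in C ->
    mup c (F.[k]%:P - F) = (mup c (monic_g K t).[k%:P] + (k == c))%N.
  move=> cC kC; have := congr1 (fun u : {poly {poly K}} => u.[k%:P]) (g_mul K t).
  rewrite hornerM hornerXsubC /separated hornerD hornerN hornerC horner_map /= => <-.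
  rewrite (g_monic_g t_neq0) hornerM hornerC -mulrA mupMr ?rootC // mupM //; last first.
    by rewrite -opprB oppr_eq0 polyXsubC_eq0.
  congr (_ + _)%N; rewrite -opprB -mulN1r mupMr; last first.
    by rewrite -[-1]/(- (1%:P)) -polyCN rootC oppr_eq0 oner_neq0.
  by rewrite -[_ - _]expr1 mup_XsubCX; case: (k == c).
have inner c : c \in C -> (\sum_(k <- C) mup c (F.[k]%:P - F)%R =
    \sum_(k <- C) mup c (monic_g K t).[k%:P]%R + 1)%N.
  move=> cC; rewrite big_seq (eq_bigr _ (E c ^~ cC)) -big_seq big_split /=.
  congr (_ + _)%N; rewrite (bigD1_seq c) //= eqxx big1 // => k /negPf ->.
  by [].
have -> : (total_order (monic_g K t) + L.-1 =
    \sum_(c <- C) \sum_(k <- C) mup c (F.[k]%:P - F)%R)%N.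
  rewrite -C_size -sum1_size /total_order -big_split big_seq [RHS]big_seq.
  by apply: eq_bigr => c cC; rewrite inner.
rewrite /num_equal_values big_distrr /= !big_seq; apply: leq_sum => c cC.
rewrite big_distrr /= !big_seq; apply: leq_sum => k kC.
exact: mup_F_value.
Qed.

Lemma divisor_norm_bound P h : P \is monic -> g_poly K t = P * h ->
  let d := (size P).-1 in
  [/\ (d * (q * L.-1) <= d * d.-1 + \sum_(c <- C) mup c (norm_mod d P (h * ('X - 'Y))))%N
    & forall c, (mup c (norm_mod d P P^`()) + mup c (norm_mod d P (h * ('X - 'Y))) =
        q * \sum_(k <- C) mup c P.[k%:P])%N].
Proof.
move=> P_monic gh d; have size_P : size P = d.+1.
  by rewrite prednK // size_poly_gt0 monic_neq0.
have PN : separated F = P * (h * ('X - 'Y)) by rewrite -(g_mul K t) gh mulrA.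
have P_tight : tight P.
  by apply: (@tightMl _ _ h); rewrite -gh; apply: tight_g.
split; last first.
  move=> c; apply: (mup_norm_mod_separated kappa_neq0 F_derivE P_monic size_P PN) => //.
  by apply: contraNneq (tight_neq0 (tight_separated (F_gt1 t_ge3 t_neq0))) => v0;
     rewrite PN v0 mulr0.
have := degree_norm_mod_separated C_uniq kappa_neq0 q_gt0 F_derivE P_monic size_P PN P_tight.
by rewrite C_size.
Qed.

(** Both sides are additive in P, so it suffices to treat a component, whose degree is at most (t -
    2) / 2. *)
Lemma divisor_total_order P h : q = 1%N -> P \is monic -> g_poly K t = P * h ->
  ((size P).-1 * t <= 2 * total_order P)%N.
Proof.
move=> q1; move: {2}(size P) (leqnn (size P)) => n.
elim: n P h => [|n IHn] P h.
  by rewrite leqn0 size_poly_eq0 => /eqP -> /monic_neq0/eqP.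
move=> le_n P_monic gh.
have [le1|P_gt1] := leqP (size P) 1.
  by move: le1; case: (size P) => [|[|k]].
have [||f [f_irr _ [P' P'_monic P_eq]]] := exists_monic_irreducible
    (Q := fun u => (1 < size u)%N) _ _ P_monic P_gt1.
- by rewrite size_poly1.
- move=> a b ab; apply/orP; apply: contraTT ab; rewrite negb_or -!leqNgt => /andP[a1 b1].
  rewrite (leq_trans (size_polyMleq _ _)) //.
  by move: a1 b1; move: (size a) (size b); lia.
have f_dvd : g_poly K t = f * (P' * h) by rewrite gh P_eq mulrA.
have comp_f : component t f by split=> //; exists (P' * h).
have [f_monic f_gt1 _] := f_irr.
have tf := component_tight t_ge3 t_neq0 comp_f.
have P_tight : tight P by apply: (@tightMl _ _ h); rewrite -gh; apply: tight_g.
have tP' : tight P' by apply: (@tightMr _ f); rewrite -P_eq.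
have szP : size P = (size f + size P').-1 by rewrite P_eq size_Mmonic ?monic_neq0.
have := IHn P' (f * h) _ P'_monic; rewrite gh P_eq mulrCA mulrA => /(_ _ erefl) IH.
have {}IH : ((size P').-1 * t <= 2 * total_order P')%N.
  by apply: IH; move: le_n f_gt1; rewrite szP; move: (size f) (size P'); clear; lia.
have [deg_le mup_eq] := divisor_norm_bound f_monic f_dvd.
have half_f := half_degree comp_f.
have norm_le : (\sum_(c <- C) mup c (norm_mod (size f).-1 f (P' * h * ('X - 'Y)))
    <= total_order f)%N.
  apply: leq_sum => c _; have := mup_eq c; rewrite q1 mul1n => <-.
  exact: leq_addl.
have {norm_le}deg_f : ((size f).-1 * L.-1 <= (size f).-1 * (size f).-1.-1 + total_order f)%N.
  by move: deg_le; rewrite q1 mul1n => /leq_trans; apply; rewrite leq_add2l.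
have L_eq : L.-1 = (t - 2)%N by rewrite /t q1 mul1n; case: (L) => // k; rewrite subn2.
have szP1 : ((size P).-1 = (size f).-1 + (size P').-1)%N.
  have := size_poly_gt0 P'; rewrite monic_neq0 // szP; move: f_gt1.
  by move: (size f) (size P'); clear; lia.
(* For a component of degree d and total order T: d (t - 2) <= d (d - 1) + T and 2 d <= t - 2 give d
   t <= 2 T. *)
rewrite total_orderM // -P_eq szP1 mulnDl mulnDr leq_add //.
move: deg_f half_f t_ge3; rewrite L_eq.
move: (size f).-1 (total_order f) (t) => d T t'; clear.
case: d => [|d]; first by lia.
case: t' => [|[|t']]; rewrite ?subn2 //= => H1 H2 _; nia.
Qed.

(** Let T be the total order of g and n the number of pairs: eliminate T between (t - 2) t <= 2 T
    and T + (t - 2) <= 2 n. *)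
Lemma num_equal_values_ge : q = 1%N -> ((t - 2) * (t + 2) <= 4 * num_equal_values)%N.
Proof.
move=> q1; have g_dvd : g_poly K t = monic_g K t * (t%:R : K)%:P%:P.
  by rewrite mulrC -(g_monic_g t_neq0).
have := divisor_total_order q1 (monic_g_monic t_ge3 t_neq0) g_dvd.
have -> : size (monic_g K t) = t.-1.
  by rewrite /monic_g size_scale ?polyC_eq0 ?invr_eq0 // size_g.
have := total_order_monic_g; rewrite q1.
have L_eq : L.-1 = (t - 2)%N by rewrite /t q1 mul1n; case: (L) => // k; rewrite subn2.
rewrite L_eq; move: (total_order _) => T; move: num_equal_values => n.
move: t_ge3; move: (t) => t'; clear.
case: t' => [|[|t']]; rewrite ?subn2 //=; nia.
Qed.

End Core.

Lemma horner_map_deriv (K : fieldType) (u : {poly {poly K}}) (a : K) :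
  (map_poly (@deriv K) u).[a%:P] = (u.[a%:P])^`().
Proof.
rewrite (@horner_coef_wide _ (size u)) ?size_poly // horner_coef linear_sum /=.
apply: eq_bigr => i _; rewrite coef_map_id0 ?deriv0 // -polyC_exp.
by rewrite mulrC mul_polyC mulrC mul_polyC derivZ.
Qed.

(** * The tame case q = 1 *)

Section TameCore.

Variables (K : closedFieldType) (p t : nat).
Hypotheses (p_prime : prime p) (pK : p \in [pchar K]).
Hypotheses (t_ge3 : (3 <= t)%N) (t_neq0 : t%:R != 0 :> K) (t1_neq0 : (t.-1)%:R != 0 :> K).
Hypothesis no_fixed : forall f, component t f -> conj_poly pK 1 f <> f.

Let F := diff_power K t.

Lemma tame_critical_values : exists C : seq K,
  [/\ uniq C, size C = (t - 2)%N, (forall x, (x \in C) = ((x + 1) ^+ t.-1 == x ^+ t.-1)),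
      (forall x, (x \in C) = root F^`() x)
    & ((t - 2) * (t + 2) <= 4 * \sum_(c <- C) \sum_(k <- C) (F.[c] == F.[k]))%N].
Proof.
have [t' t'E] : {t' | t = t'.+1} by exists t.-1; rewrite prednK // ltnW ?(ltnW t_ge3).
have tE : t = (p ^ 0 * t').+1 by rewrite mul1n.
have t'1 : t.-1 = t' by rewrite t'E.
have t'_gt0 : (0 < t')%N by rewrite -t'1; move: t_ge3; case: (t) => [|[]].
have t'_neq0 : t'%:R != 0 :> K by rewrite -t'1.
have [C [uC szC memC prodC]] := critical_points t'_gt0 t'_neq0.
exists C; split=> //.
- by rewrite szC -t'1 subn2.
- by move=> x; rewrite t'1.
- move=> x; rewrite /F t'E deriv_diff_power rootZ -?t'E // diff_power_root.
  exact: memC.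
have := t_ge3; have := t_neq0; have nf := no_fixed; rewrite /F.
rewrite tE in nf *; move=> h1 h2.
exact: (num_equal_values_ge p_prime h2 h1 t'_neq0 nf uC szC prodC).
Qed.

Hypothesis t_even : ~~ odd t.
Hypothesis p_odd : odd p.

Lemma two_neq0 : 2%:R != 0 :> K.
Proof.
rewrite -(dvdn_pcharf pK) dvdn_prime2 //.
by apply: contraTneq p_odd => ->.
Qed.

Lemma FE x : F.[x] = (x + 1) ^+ t - x ^+ t.
Proof. by rewrite /F /diff_power !hornerE. Qed.

(** For even t this symmetry maps C to itself and exchanges the fibres of F over v and -v, which
    therefore have equal size. *)
Lemma F_opp x : F.[- 1 - x] = - F.[x].
Proof.
have opp y : (- y) ^+ t = y ^+ t by rewrite exprNn -signr_odd (negPf t_even) mul1r.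
rewrite !FE opprB.
have -> : - 1 - x + 1 = - x by rewrite addrAC addNr add0r.
by rewrite -opprD !opp [1 + x]addrC.
Qed.

Lemma frob_F m x : frob pK m F.[x] = F.[frob pK m x].
Proof.
by rewrite !FE rmorphB !rmorphXn rmorphD rmorph1.
Qed.

Section WithCritical.

Variable C : seq K.
Hypotheses (C_uniq : uniq C) (C_size : size C = (t - 2)%N)
  (C_mem : forall x, (x \in C) = ((x + 1) ^+ t.-1 == x ^+ t.-1)).

Lemma C_neq0 c : c \in C -> c != 0.
Proof.
rewrite C_mem; apply: contraTneq => ->; rewrite add0r expr1n expr0n.
by rewrite -subn1 subn_eq0 leqNgt (ltn_trans _ t_ge3) // oner_eq0.
Qed.

Lemma F_critical c : c \in C -> F.[c] = c ^+ t.-1.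
Proof.
rewrite C_mem => /eqP cE; have tE : t = t.-1.+1 by rewrite prednK // ltnW ?(ltnW t_ge3).
rewrite FE tE !exprSr cE.
by rewrite -mulrBr addrAC subrr add0r mulr1.
Qed.

Lemma F_critical_neq0 c : c \in C -> F.[c] != 0.
Proof. by move=> cC; rewrite F_critical // expf_neq0 // C_neq0. Qed.

Lemma C_opp c : c \in C -> - 1 - c \in C.
Proof.
have t1_odd : odd t.-1 by move: t_even t_ge3; case: (t) => //= n; rewrite negbK.
have opp y : (- y) ^+ t.-1 = - y ^+ t.-1 by rewrite exprNn -signr_odd t1_odd expr1 mulN1r.
rewrite !C_mem => /eqP cE; have -> : - 1 - c + 1 = - c by rewrite addrAC addNr add0r.
by rewrite -opprD !opp [1 + c]addrC cE.
Qed.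

Lemma C_frob m c : c \in C -> frob pK m c \in C.
Proof.
rewrite !C_mem => /eqP cE.
by rewrite -{1}(rmorph1 (frob pK m)) -rmorphD -!rmorphXn /= cE.
Qed.

Definition fiber_size (v : K) := count (fun k => F.[k] == v) C.

Lemma fiber_sizeE v : (\sum_(k <- C) (v == F.[k]) = fiber_size v)%N.
Proof.
rewrite /fiber_size -sum1_count [RHS]big_mkcond /=.
by apply: eq_bigr => k _; rewrite eq_sym; case: (_ == _).
Qed.

Lemma num_pairsE : (\sum_(c <- C) \sum_(k <- C) (F.[c] == F.[k]) =
  \sum_(c <- C) fiber_size F.[c])%N.
Proof.
by apply: eq_bigr => c _; apply: fiber_sizeE.
Qed.

Lemma fiber_size_le (phi : K -> K) v w : injective phi -> (forall c, c \in C -> phi c \in C) ->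
  (forall c, F.[c] = v -> F.[phi c] = w) -> (fiber_size v <= fiber_size w)%N.
Proof.
move=> phi_inj phiC Fphi; rewrite /fiber_size -!size_filter -(size_map phi).
apply: uniq_leq_size; first by rewrite map_inj_uniq ?filter_uniq.
move=> x /mapP[c]; rewrite !mem_filter => /andP[/eqP Fc cC] ->.
by rewrite phiC // (Fphi c Fc) eqxx.
Qed.

Lemma fiber_size_opp v : fiber_size (- v) = fiber_size v.
Proof.
have inj : injective (fun c : K => - 1 - c) by move=> x y /addrI /eqP; rewrite eqr_opp => /eqP.
have le u : (fiber_size u <= fiber_size (- u))%N.
  by apply: (fiber_size_le inj C_opp) => c <-; rewrite F_opp.
by apply/eqP; rewrite eqn_leq le -{2}(opprK v) le.
Qed.

Lemma fiber_size_frob m v : (fiber_size v <= fiber_size (frob pK m v))%N.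
Proof.
apply: (@fiber_size_le (frob pK m)); [exact: fmorph_inj | exact: C_frob | move=> c <- /=].
by rewrite frob_F.
Qed.

Lemma fiber_size_disjoint (vs : seq K) : uniq vs ->
  (\sum_(v <- vs) fiber_size v <= size C)%N.
Proof.
move=> uvs; rewrite /fiber_size.
elim: (C) => [|c C' IHC]; first by rewrite big1.
rewrite /= big_split /= -add1n leq_add //.
have -> : (\sum_(v <- vs) (F.[c] == v) = count_mem F.[c] vs)%N.
  rewrite -sum1_count [RHS]big_mkcond /=; apply: eq_bigr => v _.
  by rewrite /= eq_sym; case: (_ == _).
by rewrite count_uniq_mem // leq_b1.
Qed.

Lemma not_opp_self (v : K) : v != 0 -> v != - v.
Proof.
move=> v_neq0; rewrite -subr_eq0 opprK -mulr2n -mulr_natl mulf_neq0 //.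
exact: two_neq0.
Qed.

(** The four values v, -v, Frob v, -Frob v are distinct for each v = F(c), and their fibres are at
    least as large as that of v. So each fibre has at most (t - 2) / 4 points, and the number of
    pairs is at most (t - 2)^2 / 4, below the lower bound (t - 2) (t + 2) / 4. *)
Lemma separated_values_absurd :
    ((t - 2) * (t + 2) <= 4 * \sum_(c <- C) \sum_(k <- C) (F.[c] == F.[k]))%N ->
    (forall c, c \in C -> frob pK 1 F.[c] != F.[c] /\ frob pK 1 F.[c] != - F.[c]) ->
  False.
Proof.
rewrite num_pairsE => n_ge sepv.
have le4 c : c \in C -> (4 * fiber_size F.[c] <= t - 2)%N.
  move=> cC; have [ne1 ne2] := sepv c cC; set v := F.[c] in ne1 ne2 *.
  have v0 : v != 0 by apply: F_critical_neq0.
  have fv0 : frob pK 1 v != 0 by rewrite fmorph_eq0.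
  have := @fiber_size_disjoint [:: v; - v; frob pK 1 v; - frob pK 1 v].
  have e1 : v != - v by apply: not_opp_self.
  have e2 : v != frob pK 1 v by rewrite eq_sym.
  have e3 : v != - frob pK 1 v by apply: contra_neq ne2 => E; rewrite [X in _ = - X]E opprK.
  have e4 : - v != frob pK 1 v by rewrite eq_sym.
  have e5 : - v != - frob pK 1 v by rewrite eqr_opp.
  have e6 : frob pK 1 v != - frob pK 1 v by apply: not_opp_self.
  rewrite C_size /= !inE !negb_or e1 e2 e3 e4 e5 e6 => /(_ isT); apply: leq_trans.
  rewrite !big_cons big_nil !fiber_size_opp.
  have := fiber_size_frob 1 v; move: (fiber_size v) (fiber_size _) => a b; clear; lia.
have : (4 * \sum_(c <- C) fiber_size F.[c] <= (t - 2) * (t - 2))%N.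
  rewrite big_distrr /= -[X in (_ <= X * _)%N]C_size -sum1_size big_distrl /= !big_seq.
  by apply: leq_sum => c cC; rewrite mul1n le4.
move=> /(leq_trans n_ge); rewrite leq_pmul2l ?subn_gt0 //.
by move: t_ge3; clear; case: (t) => [|[|[|n]]] //= _; rewrite !subSS subn0; lia.
Qed.

End WithCritical.
End TameCore.

Section TameCases.

Variables (K : closedFieldType) (p t : nat).
Hypotheses (p_prime : prime p) (pK : p \in [pchar K]).
Hypotheses (t_ge3 : (3 <= t)%N) (t_neq0 : t%:R != 0 :> K) (t1_neq0 : (t.-1)%:R != 0 :> K).
Hypothesis no_fixed : forall f, component t f -> conj_poly pK 1 f <> f.
Hypotheses (t_even : ~~ odd t) (p_odd : odd p).

Let F := diff_power K t.

Lemma singular_point_critical a b : a != b -> F.[a] = F.[b] ->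
  F^`().[a] = 0 -> F^`().[b] = 0 -> singular_point (g_poly K t) (a, b).
Proof.
move=> ne_ab Fab Fa Fb; have gab : (g_poly K t).[a, b] = 0 by apply: g_point.
have ab_neq0 : a - b != 0 by rewrite subr_eq0.
split=> //=.
  have N' : (separated F)^`().[a%:P] = (F^`().[a])%:P.
    by rewrite /separated derivB derivC subr0 deriv_map horner_map.
  move: N'; rewrite -(g_mul K t) derivM derivXsubC mulr1 hornerD hornerM hornerXsubC Fa.
  move=> /(congr1 (fun u : {poly K} => u.[b])); rewrite hornerD hornerM gab addr0 hornerC.
  by rewrite hornerD hornerN hornerC hornerX => /eqP; rewrite mulf_eq0 (negPf ab_neq0) orbF => /eqP.
rewrite horner_map_deriv.
have N' : ((separated F).[a%:P])^`() = - F^`().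
  by rewrite /separated hornerD hornerN hornerC horner_map derivB derivC sub0r.
move: N'; rewrite -(g_mul K t) hornerM hornerXsubC derivM.
move=> /(congr1 (fun u : {poly K} => u.[b])); rewrite hornerN Fb oppr0.
rewrite hornerD !hornerM gab mul0r addr0 hornerD hornerN hornerC hornerX => /eqP.
by rewrite mulf_eq0 (negPf ab_neq0) orbF => /eqP.
Qed.

(** Off the diagonal, pairs of critical points with equal values are singular points of g. Removing
    the t - 2 diagonal pairs from (t - 2) (t + 2) / 4 leaves exactly the bound (t - 2)^2 / 4. *)
Lemma few_singular_points_absurd (s : seq (K * K)) : uniq s ->
    (forall a, a \in s <-> singular_point (g_poly K t) a) ->
    (size s)%:R < (t%:R - 2) ^+ 2 / 4 :> rat ->
  False.
Proof.
move=> uniq_s s_sing.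
have t2E : t%:R - 2 = (t - 2)%:R :> rat by rewrite natrB // ltnW.
rewrite t2E ltr_pdivlMr // -natrX -natrM ltr_nat => size_s.
have [C [uC szC memC rootC n_ge]] :=
  tame_critical_values p_prime t_ge3 t_neq0 t1_neq0 no_fixed.
pose bad (a : K * K) := (a.1 != a.2) && (F.[a.1] == F.[a.2]).
pose P := [seq a <- [seq (c, k) | c <- C, k <- C] | bad a].
have uniq_P : uniq P by rewrite filter_uniq ?allpairs_uniq // => -[a b] [c d].
have /(uniq_leq_size uniq_P) : {subset P <= s}.
  move=> [a b]; rewrite mem_filter => /andP[/andP[/= ne_ab /eqP Fab]].
  case/allpairsP=> -[c k] /= [cC kC [aE bE]]; apply/s_sing.
  by apply: singular_point_critical => //; apply/rootP; rewrite -rootC ?aE ?bE.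
have -> : (size P = \sum_(c <- C) \sum_(k <- C) ((c != k) && (F.[c] == F.[k])))%N.
  rewrite size_filter -sum1_count [LHS]big_mkcond big_allpairs /=.
  by apply: eq_bigr => c _; apply: eq_bigr => k _; rewrite /bad /=; case: (_ && _).
have nE : (\sum_(c <- C) \sum_(k <- C) (F.[c] == F.[k]) =
    \sum_(c <- C) \sum_(k <- C) ((c != k) && (F.[c] == F.[k])) + (t - 2))%N.
  rewrite -szC -sum1_size -big_split big_seq [RHS]big_seq; apply: eq_bigr => c cC /=.
  rewrite (bigD1_seq c) //= [in RHS](bigD1_seq c) //= !eqxx add0n addnC.
  by congr (_ + _)%N; apply: eq_bigr => k kc; have -> : c != k by rewrite eq_sym.
move: n_ge size_s; rewrite nE; move: (\sum_(c <- C) _)%N (size s) => n m.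
move: t_ge3; clear; case: (t) => [|[|[|t']]] // _; rewrite !subSS subn0; nia.
Qed.

Lemma critical_ratio (C : seq K) c :
    (forall x, (x \in C) = ((x + 1) ^+ t.-1 == x ^+ t.-1)) -> c \in C ->
  let s := (c + 1) / c in
  [/\ s ^+ t.-1 = 1, s != 1 & (s - 1) ^+ t.-1 = F.[c]^-1].
Proof.
move=> memC cC; have c_neq0 := C_neq0 t_ge3 memC cC.
have s1 : (c + 1) / c - 1 = c^-1 by rewrite mulrDl divff // mul1r addrAC subrr add0r.
split; last by rewrite s1 (F_critical t_ge3 memC cC) exprVn.
  by move: (cC); rewrite memC expr_div_n => /eqP ->; rewrite divff // expf_neq0.
by rewrite -subr_eq0 s1 invr_eq0.
Qed.

Lemma root_of_unity_condition_absurd (emb : {rmorphism 'F_p -> K}) :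
    (forall s : K, t.-1.-unity_root s -> s <> 1 ->
       ~ (exists c : 'F_p, (s - 1) ^+ t.-1 = emb c) /\
       (s - 1) ^+ (t.-1 * (p - 1)) <> -1) ->
  False.
Proof.
move=> cond; have [C [uC szC memC rootC n_ge]] :=
  tame_critical_values p_prime t_ge3 t_neq0 t1_neq0 no_fixed.
apply: (separated_values_absurd p_prime t_ge3 t_even p_odd uC szC memC n_ge (pK := pK)).
move=> c cC; have Fc_neq0 := F_critical_neq0 t_ge3 memC cC.
have [s1 s_neq1 sF] := critical_ratio memC cC.
have [no_c no_m1] := cond _ (introT unity_rootP s1) (elimN eqP s_neq1).
rewrite sF in no_c; rewrite exprM sF in no_m1.
have pE : p = (p - 1).+1 by rewrite subn1 prednK // prime_gt0.
split; apply/eqP => E.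
  apply: no_c; have [||a aE] := @frob_fixed_im _ _ pK _ emb 1 F.[c]^-1.
  - by rewrite card_Fp // expn1.
  - by rewrite fmorphV /= E.
  by exists a.
apply: no_m1; rewrite exprVn; move: E; rewrite /frob expn1 {1}pE exprS mulrC -[X in _ = X]mulN1r.
by move=> /(mulIf Fc_neq0) ->; rewrite invrN1.
Qed.

(** The 2k-th power of Frobenius maps c to -1 - c, hence negates F(c). Were F(c) sent to F(c) or
    -F(c) by Frobenius, its square, and so its 2k-th power, would fix F(c). *)
Lemma order_condition_absurd k : (0 < k)%N -> (t.-1 %| p ^ (2 * k) + 1)%N -> False.
Proof.
move=> k_gt0 t1_dvd; have [C [uC szC memC rootC n_ge]] :=
  tame_critical_values p_prime t_ge3 t_neq0 t1_neq0 no_fixed.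
apply: (separated_values_absurd p_prime t_ge3 t_even p_odd uC szC memC n_ge (pK := pK)).
move=> c cC; have Fc_neq0 := F_critical_neq0 t_ge3 memC cC.
have c_neq0 := C_neq0 t_ge3 memC cC.
have cE : (c + 1) ^+ t.-1 = c ^+ t.-1 by apply/eqP; rewrite -memC.
have fc : frob pK (2 * k) c = - 1 - c.
  have := frob_is_zmod_morphism pK (2 * k) (c + 1) 1; rewrite addrK.
  rewrite [frob _ _ 1]rmorph1 => fcE.
  have : (c + 1) ^+ (p ^ (2 * k) + 1) = c ^+ (p ^ (2 * k) + 1).
    by have /dvdnP[j ->] := t1_dvd; rewrite mulnC !exprM cE.
  rewrite !addn1 !exprSr -!/(frob pK _ _) => E.
  have : frob pK (2 * k) c + (c + 1) = 0.
    move: E; have -> : frob pK (2 * k) (c + 1) = frob pK (2 * k) c + 1 by rewrite rmorphD rmorph1.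
    rewrite mulrDl mulrDr mulr1 mul1r -addrA => /eqP; rewrite addrC -subr_eq0 addrK.
    by rewrite addrC => /eqP.
  by move/eqP; rewrite addr_eq0 => /eqP ->; rewrite opprD addrC.
have Fk : frob pK (2 * k) F.[c] = - F.[c] by rewrite frob_F fc F_opp.
have not_fixed2 : frob pK 2 F.[c] <> F.[c].
  move=> F2; have : frob pK (2 * k) F.[c] = F.[c].
    elim: (k) => [|j IHj]; first by rewrite muln0 /frob expn0 expr1.
    by rewrite mulnS -frobD IHj.
  by rewrite Fk => /esym/eqP; apply/negP/(not_opp_self p_prime pK p_odd).
split; apply/eqP => E; apply: not_fixed2; rewrite -(frobD pK 1 1) E ?E //.
by rewrite rmorphN /= E opprK.
Qed.

End TameCases.

(** * Prime t - 1 modulo which p has order (t - 2) / 2 *)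

Lemma power_of_additive (K : fieldType) p n : p \in [pchar K] -> (0 < n)%N ->
  ('X + 1) ^+ n = 'X^n + 1 :> {poly K} -> exists k, n = (p ^ k)%N.
Proof.
move=> pK; elim/ltn_ind: n => n IHn n_gt0 nE.
have pP : p \in [pchar {poly K}] by apply: (rmorph_pchar polyC).
have [n1|n_neq1] := eqVneq n 1%N; first by exists 0%N; rewrite n1 expn0.
(* Compare the coefficients of X; a p-th root of the identity can then be extracted. *)
have p_dvd : (p %| n)%N.
  rewrite (dvdn_pcharf pK); have := congr1 (fun u : {poly K} => u`_1) nE.
  rewrite /= coef_X1_exp bin1 coefD coefXn coef1 eq_sym (negPf n_neq1) addr0.
  by move=> ->.
have [m mE] := dvdnP p_dvd; have p_gt1 := prime_gt1 (pcharf_prime pK).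
have m_gt0 : (0 < m)%N by move: n_gt0; rewrite mE muln_gt0 => /andP[].
have [||k mk] := IHn m _ m_gt0; last by exists k.+1; rewrite mE mk expnSr.
  by rewrite mE -{1}[m]muln1 ltn_pmul2l.
have : (('X + 1) ^+ m - ('X^m + 1)) ^+ p = 0 :> {poly K}; last first.
  by move=> /eqP; rewrite expf_eq0 subr_eq0 => /andP[_ /eqP].
rewrite -(pFrobenius_autE pP) pFrobenius_autB_comm ?pFrobenius_autE; last exact: mulrC.
rewrite -exprM -mE nE -(pFrobenius_autE pP) pFrobenius_autD_comm ?pFrobenius_autE; last exact: mulrC.
by rewrite -exprM -mE expr1n subrr.
Qed.

Lemma prime_unity_root (R : nzRingType) l k (s : R) : prime l ->
  s ^+ l = 1 -> s ^+ k = 1 -> s != 1 -> (l %| k)%N.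
Proof.
move=> l_prime sl sk; apply: contraNT; rewrite -prime_coprime // => cop.
case: (egcdnP k (prime_gt0 l_prime)) => u v; rewrite (eqP cop) => uv _.
have := congr1 (fun m => s ^+ m) uv.
by rewrite exprD mulnC exprM sl expr1n mulnC exprM sk expr1n mul1r expr1 => <-.
Qed.

Section ShiftClosed.

Variables (K : fieldType) (p l : nat) (a : K).
Hypotheses (l_prime : prime l) (l_ge5 : (5 <= l)%N) (two_neq0 : 2%:R != 0 :> K).

Let U := [pred s : K | (s ^+ l == 1) && (s != 1)].

Hypothesis U_shift : forall s, s \in U -> (s - 1) ^+ (2 * l) = a.
Variable s0 : K.
Hypothesis s0U : s0 \in U.

Lemma U_exp s k : (0 < k < l)%N -> s \in U -> s ^+ k \in U.
Proof.
move=> /andP[k_gt0 k_lt]; rewrite !inE => /andP[/eqP sl s_neq1].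
rewrite exprAC sl expr1n eqxx /=; apply/eqP => sk.
by have := prime_unity_root l_prime sl sk s_neq1; rewrite gtnNdvd.
Qed.

Lemma U_shift_neq0 : a != 0.
Proof.
rewrite -(U_shift s0U) expf_neq0 // subr_eq0.
by move: s0U; rewrite inE => /andP[].
Qed.

(** The sum is (s^k - 1) / (s - 1), a quotient of two elements with the same 2l-th power [a]. *)
Lemma U_cyclotomic s k : (0 < k < l)%N -> s \in U -> (\sum_(i < k) s ^+ i) ^+ (2 * l) = 1.
Proof.
move=> k_int sU; have := U_shift (U_exp k_int sU).
rewrite subrX1 exprMn U_shift // => /(canRL (mulKf U_shift_neq0)) ->.
by rewrite mulVf // U_shift_neq0.
Qed.

Lemma U_succ s : s \in U -> (s + 1) ^+ (2 * l) = 1.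
Proof.
move=> sU; have := @U_cyclotomic s 2 _ sU.
by rewrite !big_ord_recr big_ord0 /= add0r expr0 expr1 addrC; apply; rewrite (leq_trans _ l_ge5).
Qed.

Lemma exp2l (x : K) : x ^+ (2 * l) = 1 -> x ^+ l = 1 \/ x ^+ l = -1.
Proof.
by rewrite mulnC exprM => /eqP; rewrite sqrf_eq1 => /orP[] /eqP ->; [left|right].
Qed.

(** For w = (s + 1)^2 / s both w and w - 1 = (1 + s + s^2) / s are 2l-th roots of unity, w even an
    l-th one; so w lies in [U] and a = (w - 1)^(2l) = 1. The sum 1 + s + s^2 is where l > 3 is
    needed. *)
Lemma U_shift_eq1 : a = 1.
Proof.
have [s_neq0 sl] : s0 != 0 /\ s0 ^+ l = 1.
  move: s0U; rewrite inE => /andP[/eqP sl _]; split=> //.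
  apply: contra_eq_neq sl => ->.
  by rewrite expr0n -leqn0 leqNgt prime_gt0 // eq_sym oner_neq0.
have c2 := U_succ s0U; have := @U_cyclotomic s0 3 _ s0U.
rewrite !big_ord_recr big_ord0 /= add0r expr0 expr1 (leq_trans _ l_ge5) // => /(_ isT) c3.
pose w := (s0 + 1) ^+ 2 / s0.
have wl : w ^+ l = 1 by rewrite expr_div_n -exprM sl divr1.
have w1 : w - 1 = (1 + s0 + s0 ^+ 2) / s0.
  apply: (mulIf s_neq0); rewrite mulrBl !divfK // mul1r; ring.
have w1l : (w - 1) ^+ (2 * l) = 1.
  by rewrite w1 expr_div_n c3 [(2 * l)%N]mulnC exprM sl expr1n divr1.
rewrite -(@U_shift w) // inE wl eqxx /=; apply: contra_eq_neq w1l => ->.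
by rewrite subrr expr0n muln_eq0 /= -leqn0 leqNgt prime_gt0 // eq_sym oner_neq0.
Qed.

Lemma sqr_opp (x : K) : (- x) ^+ (2 * l) = x ^+ (2 * l).
Proof. by rewrite !exprM sqrrN. Qed.

Lemma opp_exp (x : K) : (- x) ^+ l = - x ^+ l.
Proof.
rewrite exprNn -signr_odd; case: (even_prime l_prime) => [l2|->].
  by move: l_ge5; rewrite l2.
by rewrite expr1 mulN1r.
Qed.

Lemma U_opp_succ s : s \in U -> (- s + 1) ^+ (2 * l) = 1.
Proof. by move=> sU; rewrite addrC -opprB sqr_opp U_shift // U_shift_eq1. Qed.

Lemma exp2l_cases (x : K) : x ^+ (2 * l) = 1 ->
  [\/ x = 1, x = -1, x \in U | - x \in U].
Proof.
move=> /exp2l[] xl.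
  by have [->|x1] := eqVneq x 1; [constructor 1|constructor 3; rewrite inE xl eqxx].
have [xE|x1] := eqVneq (- x) 1; first by constructor 2; rewrite -xE opprK.
by constructor 4; rewrite inE opp_exp xl opprK eqxx.
Qed.

(** With y = 1 + s and z = 1 - s, both 2l-th roots of unity, 2 = y + z = z (y / z + 1), and the
    earlier results apply to y / z. *)
Lemma U_two : 2%:R ^+ (2 * l) = 1 :> K.
Proof.
have y1 := U_succ s0U; have z1 := U_opp_succ s0U.
have [y_neq0 z_neq0] : s0 + 1 != 0 /\ - s0 + 1 != 0.
  have l2_neq0 : (0 ^+ (2 * l) == 1 :> K) = false.
    by rewrite expr0n muln_eq0 /= -leqn0 leqNgt prime_gt0 // eq_sym oner_eq0.
  by split; [apply: contraFneq l2_neq0 => E; rewrite -y1 E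
            | apply: contraFneq l2_neq0 => E; rewrite -z1 E].
set y := s0 + 1 in y1 y_neq0; set z := - s0 + 1 in z1 z_neq0.
have yz : y + z = 2%:R by rewrite /y /z addrACA subrr add0r.
have tau1 : (y / z) ^+ (2 * l) = 1 by rewrite expr_div_n y1 z1 divr1.
have -> : 2%:R = z * (y / z + 1) by rewrite mulrDr mulr1 mulrC divfK.
rewrite exprMn z1 mul1r.
have s0_neq0 : s0 != 0.
  move: s0U; rewrite inE => /andP[sl _]; apply: contraTneq sl => ->.
  by rewrite expr0n -leqn0 leqNgt prime_gt0 // eq_sym oner_eq0.
case: (exp2l_cases tau1) => [tE|tE|tU|tU].
- have /eqP : y = z by rewrite -[y](divfK z_neq0) tE mul1r.
  rewrite (inj_eq (addIr 1)) -subr_eq0 opprK -mulr2n -mulr_natr mulf_eq0.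
  by rewrite (negPf s0_neq0) (negPf two_neq0).
- have /eqP : y + z = 0 by rewrite -[y](divfK z_neq0) tE mulN1r addNr.
  by rewrite yz (negPf two_neq0).
- exact: U_succ.
by rewrite -[y / z]opprK U_opp_succ.
Qed.

Lemma U_shift_closed (x : K) : x ^+ (2 * l) = 1 -> x + 1 != 0 -> (x + 1) ^+ (2 * l) = 1.
Proof.
case/exp2l_cases => [->|->|xU|xU] x1.
- exact: U_two.
- by rewrite addNr eqxx in x1.
- exact: U_succ.
by rewrite -[x]opprK U_opp_succ.
Qed.

End ShiftClosed.

Section HalfOrder.

Variables (K : closedFieldType) (p t : nat).
Hypotheses (p_prime : prime p) (pK : p \in [pchar K]).
Hypotheses (t_ge3 : (3 <= t)%N) (t_neq0 : t%:R != 0 :> K) (t1_neq0 : (t.-1)%:R != 0 :> K).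
Hypothesis no_fixed : forall f, component t f -> conj_poly pK 1 f <> f.
Hypotheses (t_even : ~~ odd t) (p_odd : odd p).
Hypotheses (t1_prime : prime t.-1).

Let F := diff_power K t.
Let e := mult_order p t.-1.
Hypothesis eE : (2 * e)%N = (t - 2)%N.

(** Frobenius acts on c as it does on the root of unity s = (c + 1) / c, of prime order t - 1. *)
Lemma frob_critical_period c j : c ^+ t.-1 = (c + 1) ^+ t.-1 -> c != 0 -> 
  (frob pK j c == c) = (e %| j)%N.
Proof.
move=> cl c_neq0; have t1_gt1 := prime_gt1 t1_prime.
have t1_coprime : coprime p t.-1.
  by rewrite prime_coprime // (dvdn_pcharf pK).
rewrite /e -mult_orderP // ?prime_gt0 // eqn_mod_dvd ?expn_gt0 ?prime_gt0 //.
pose s := (c + 1) / c.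
have sl : s ^+ t.-1 = 1 by rewrite expr_div_n -cl divff // expf_neq0.
have s1 : s - 1 = c^-1 by rewrite /s mulrDl divff // mul1r addrAC subrr add0r.
have s_neq0 : s != 0.
  apply: contra_eq_neq sl => ->.
  by rewrite expr0n -leqn0 leqNgt prime_gt0 // eq_sym oner_neq0.
have [n pj] : exists n, (p ^ j = n.+1)%N by exists (p ^ j).-1; rewrite prednK // expn_gt0 prime_gt0.
have -> : (frob pK j c == c) = (frob pK j s == s).
  have fs : frob pK j s - 1 = (frob pK j c)^-1.
    by rewrite -fmorphV /= -s1 rmorphB rmorph1.
  apply/eqP/eqP => E; last by apply: invr_inj; rewrite -fs E s1.
  by apply: (addIr (- 1)); rewrite fs E s1.
rewrite /frob pj subn1 /= exprS -[X in _ == X]mulr1 (inj_eq (mulfI s_neq0)).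
apply/eqP/idP => [sp|/dvdnP[k ->]]; last by rewrite mulnC exprM sl expr1n.
apply: (prime_unity_root t1_prime sl sp).
by rewrite -subr_eq0 s1 invr_eq0.
Qed.

Section Critical.

Variable C : seq K.
Hypotheses (C_uniq : uniq C) (C_size : size C = (t - 2)%N)
  (C_mem : forall x, (x \in C) = ((x + 1) ^+ t.-1 == x ^+ t.-1)).

Let orbit c := [seq frob pK j c | j <- iota 0 e].

Lemma critical_period c j : c \in C -> (frob pK j c == c) = (e %| j)%N.
Proof.
move=> cC; apply: frob_critical_period; last exact: (C_neq0 t_ge3 C_mem cC).
by apply/esym/eqP; rewrite -C_mem.
Qed.

Lemma e_gt0 : (0 < e)%N.
Proof. by move: eE t_ge3; case: (e) => // ; rewrite muln0; case: (t) => [|[|[|]]]. Qed.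

Lemma orbit_uniq c : c \in C -> uniq (orbit c).
Proof.
move=> cC; rewrite map_inj_in_uniq ?iota_uniq //.
suff lt_inj j k : (j <= k < e)%N -> frob pK j c = frob pK k c -> j = k.
  move=> j k; rewrite !mem_iota !add0n /= => j_lt k_lt E.
  by case: (leqP j k) => [le|/ltnW le]; [|apply/esym]; apply: lt_inj; rewrite ?le.
move=> /andP[le_jk lt_k]; rewrite -[in RHS](subnKC le_jk) -frobD => /(fmorph_inj (frob pK j))/esym/eqP.
rewrite critical_period // => /dvdn_leq; rewrite subn_gt0.
move: le_jk lt_k; clear; lia.
Qed.

Lemma orbit_mem c j : c \in C -> frob pK j c \in orbit c.
Proof.
move=> cC; apply/mapP; exists (j %% e)%N; first by rewrite mem_iota ltn_mod e_gt0.
rewrite {1}(divn_eq j e) addnC -frobD; congr frob; apply/eqP.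
by rewrite critical_period // dvdn_mull.
Qed.

Lemma fiber_size_orbit j c : c \in C ->
  fiber_size t C F.[frob pK j c] = fiber_size t C F.[c].
Proof.
move=> cC; rewrite -frob_F; apply/eqP; rewrite eqn_leq (fiber_size_frob pK C_uniq) // andbT.
have -> : fiber_size t C F.[c] = fiber_size t C (frob pK (j * e.-1) (frob pK j F.[c])).
  rewrite frobD addnC -mulnS prednK ?e_gt0 // frob_F; congr (fiber_size _ _ _.[_]).
  by apply/esym/eqP; rewrite critical_period // dvdn_mull.
exact: fiber_size_frob.
Qed.

Lemma orbits_perm c c' : c \in C -> c' \in C -> c' \notin orbit c ->
  perm_eq C (orbit c ++ orbit c').
Proof.
move=> cC c'C c'_out; have orbC b : b \in C -> {subset orbit b <= C}.
  by move=> bC _ /mapP[j _ ->]; apply: C_frob.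
have uO : uniq (orbit c ++ orbit c').
  rewrite cat_uniq !orbit_uniq // andbT; apply/hasPn => _ /mapP[j j_lt ->].
  apply: contra c'_out => /mapP[k _ E].
  have <- : frob pK (j * e.-1) (frob pK j c') = c'.
    rewrite frobD addnC -mulnS prednK ?e_gt0 //; apply/eqP.
    by rewrite critical_period // dvdn_mull.
  by rewrite E frobD orbit_mem.
have [||_ memO] := @uniq_min_size _ (orbit c ++ orbit c') C uO.
- by move=> x; rewrite mem_cat => /orP[]; apply: orbC.
- by rewrite size_cat !size_map size_iota C_size -eE mul2n addnn.
by apply: uniq_perm.
Qed.

(** C consists of two Frobenius orbits of size e, on each of which the fibre size m is constant. The
    lower bound on pairs gives m(c) + m(c') > e, whereas values that differ by more than a sign
    yield four disjoint fibres, so that 2 (m(b) + m(b')) <= 2 e. *)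
Lemma sqr_value_constant :
  ((t - 2) * (t + 2) <= 4 * \sum_(c <- C) \sum_(k <- C) (F.[c] == F.[k]))%N ->
  forall c k, c \in C -> k \in C -> F.[c] ^+ 2 = F.[k] ^+ 2.
Proof.
rewrite num_pairsE => n_ge c k cC kC; apply/eqP; rewrite eqf_sqr.
pose m b := fiber_size t C F.[b].
have [c' c'C c'_out] : exists2 c', c' \in C & c' \notin orbit c.
  apply/allPn/negP => /allP sub; have := uniq_leq_size C_uniq sub.
  by rewrite size_map size_iota C_size -eE; move: e_gt0; clear; case: (e) => // n; lia.
have perm_C := orbits_perm cC c'C c'_out.
have m_orbit b x : b \in C -> x \in orbit b -> m x = m b.
  by move=> bC /mapP[j _ ->]; apply: fiber_size_orbit.
have sum_orbit b : b \in C -> (\sum_(x <- orbit b) m x = e * m b)%N.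
  move=> bC; rewrite big_seq (eq_bigr (fun=> m b)) => [|x]; last exact: m_orbit.
  by rewrite -big_seq big_const_seq count_predT size_map size_iota iter_addn_0 mulnC.
have nE : (\sum_(c <- C) fiber_size t C F.[c] = e * m c + e * m c')%N.
  by rewrite (perm_big _ perm_C) big_cat /= !sum_orbit.
rewrite nE in n_ge.
have m_le b b' : b \in C -> b' \in C -> F.[b] != F.[b'] -> F.[b] != - F.[b'] ->
    (m b + m b' <= e)%N.
  move=> bC b'C ne1 ne2; have Fb0 := F_critical_neq0 t_ge3 C_mem bC.
  have Fb'0 := F_critical_neq0 t_ge3 C_mem b'C.
  have := @fiber_size_disjoint _ t C [:: F.[b]; - F.[b]; F.[b']; - F.[b']].
  rewrite C_size /= !inE !negb_or ne1 ne2 eqr_opp ne1 !(not_opp_self p_prime pK p_odd) //.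
  rewrite -[X in - X != F.[b']]opprK opprK; move: ne2; rewrite -eqr_opp opprK => ne2.
  rewrite ne2 => /(_ isT); rewrite !big_cons big_nil !(fiber_size_opp t_ge3 t_even C_uniq) //.
  by rewrite -/(m b) -/(m b') -eE; move: (m b) (m b') (e); clear; lia.
have m_gt : (e < m c + m c')%N.
  move: n_ge; rewrite -eE; have -> : (t + 2 = 2 * e + 4)%N.
    by move: eE t_ge3; move: (e) (t); clear; lia.
  by move: e_gt0; move: (m c) (m c') (e); clear; nia.
have m_c' : m c' = m c.
  apply/eqP; apply: contraTT m_gt; rewrite -leqNgt => ne_m; apply: m_le => //.
    by apply: contra_neq ne_m => E; rewrite /m E.
  by apply: contra_neq ne_m => E; rewrite /m E (fiber_size_opp t_ge3 t_even C_uniq).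
have m_k : m k = m c.
  have := kC; rewrite (perm_mem perm_C) mem_cat => /orP[] /m_orbit -> //.
apply: contraTT m_gt; rewrite negb_or -leqNgt m_c' -{2}m_k => /andP[ne1 ne2].
exact: m_le.
Qed.

End Critical.

(* The solutions of x^(2(t-1)+1) = x turn out to be closed under x |-> x + 1, so
   that (x + 1)^n and x^n + 1 coincide for n = 2(t-1)+1. *)
Lemma half_order_shift (C : seq K) : (forall x, (x \in C) = ((x + 1) ^+ t.-1 == x ^+ t.-1)) ->
  (forall c k, c \in C -> k \in C -> F.[c] ^+ 2 = F.[k] ^+ 2) ->
  (5 <= t.-1)%N -> uniq C -> size C = (t - 2)%N ->
  exists k, (2 * t.-1).+1 = (p ^ k)%N.
Proof.
move=> memC F2 l_ge5 uC szC; set l := t.-1.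
pose U := [pred s : K | (s ^+ l == 1) && (s != 1)].
have [c0 c0C] : exists c0, c0 \in C.
  move: szC t_ge3; case: (C) => [|c0 C'] /=; last by exists c0; rewrite mem_head.
  by case: (t) => [|[|[|]]].
have toC s : s \in U -> (s - 1)^-1 \in C /\ ((s - 1)^-1 + 1) / (s - 1)^-1 = s.
  rewrite inE => /andP[/eqP sl]; rewrite -subr_eq0 => s1; rewrite memC.
  have sE : (s - 1)^-1 + 1 = s / (s - 1).
    by apply: (mulIf s1); rewrite divfK // mulrDl mulVf // mul1r addrC subrK.
  by rewrite sE exprMn sl mul1r eqxx invrK divfK.
have toU c : c \in C -> (c + 1) / c \in U.
  by move=> cC; have [sl s1 _] := critical_ratio t_ge3 memC cC; rewrite inE s1 sl eqxx.
have shift s : s \in U -> (s - 1) ^+ (2 * l) = F.[c0]^-1 ^+ 2.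
  move=> /toC[cC sE]; have [_ _] := critical_ratio t_ge3 memC cC; rewrite sE => E.
  by rewrite mulnC exprM E !exprVn (F2 _ _ cC c0C).
have closed := U_shift_closed t1_prime l_ge5 (two_neq0 p_prime pK p_odd) shift (toU _ c0C).
pose us := 1 :: [seq (c + 1) / c | c <- C].
have us_uniq : uniq us.
  rewrite /= map_inj_in_uniq ?uC ?andbT => [|c k cC kC].
    by apply/mapP => -[c /toU]; rewrite inE => /andP[_ /negP ne] E; apply: ne; rewrite -E.
  have [c_neq0 k_neq0] := (C_neq0 t_ge3 memC cC, C_neq0 t_ge3 memC kC).
  by rewrite !mulrDl !divff // => /addrI; rewrite !mul1r => /invr_inj.
have us1 x : x \in us -> x ^+ l = 1.
  rewrite inE => /predU1P[->|/mapP[c /toU]]; first by rewrite expr1n.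
  by rewrite inE => /andP[/eqP cl _] ->.
have oppl (x : K) : (- x) ^+ l = - x ^+ l by apply: (opp_exp t1_prime l_ge5).
have l_neq0 : 0 ^+ l = 0 :> K by rewrite expr0n -leqn0 leqNgt prime_gt0.
have neg1 : (1 : K) != -1 by apply: (not_opp_self p_prime pK p_odd); apply: oner_neq0.
(* These 2 l + 1 points are 0 and all the 2l-th roots of unity. *)
pose rs := 0 :: us ++ [seq - x | x <- us].
have rs_uniq : uniq rs.
  rewrite cons_uniq cat_uniq us_uniq map_inj_uniq ?us_uniq ?andbT; last exact: oppr_inj.
  rewrite mem_cat negb_or -andbA; apply/and3P; split.
  - by apply/negP => /us1/eqP; rewrite l_neq0 eq_sym oner_eq0.
  - apply/mapP => -[x /us1 xl] /esym/eqP; rewrite oppr_eq0 => /eqP x0; move: xl.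
    by rewrite x0 l_neq0 => /eqP; rewrite eq_sym oner_eq0.
  apply/hasPn => _ /mapP[x /us1 xl ->]; apply: contra neg1 => /us1.
  by rewrite oppl xl => ->.
have rs_size : size rs = (2 * l).+1.
  rewrite /= size_cat size_map /us /= !size_map szC /l.
  move: t_ge3; clear; case: (t) => [|[|n]] //; rewrite !subSS subn0 /=. lia.
have rs_exp x : x \in rs -> x = 0 \/ x ^+ (2 * l) = 1.
  rewrite inE => /predU1P[->|]; first by left.
  rewrite mem_cat => /orP[/us1 xl|/mapP[y /us1 yl ->]]; right; rewrite mulnC exprM.
    by rewrite xl expr1n.
  by rewrite oppl yl sqrrN expr1n.
apply: (@power_of_additive K p) => //.
apply/eqP; rewrite -subr_eq0; set D := _ - _; apply/negPn/negP => D_neq0.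
(* The leading terms of [D] cancel, so its degree is at most 2 l, while it vanishes at the 2 l + 1
   points. *)
have /(max_poly_roots D_neq0) : all (root D) rs.
  apply/allP => x /rs_exp x_exp; rewrite /D rootE !hornerE subr_eq0.
  have -> : x ^+ (2 * l).+1 = x by case: x_exp => [->|xl]; rewrite ?expr0n // exprS xl mulr1.
  have [->|x1_neq0] := eqVneq (x + 1) 0; first by rewrite expr0n.
  rewrite exprS; case: x_exp => [->|xl]; first by rewrite add0r expr1n mulr1.
  by rewrite closed // mulr1.
move=> /(_ rs_uniq); rewrite rs_size ltnNge => /negP; apply.
apply/leq_sizeP => j; rewrite /D coefB coef_X1_exp coefD coefXn coef1.
rewrite leq_eqVlt => /predU1P[<-|lt_j]; first by rewrite binn eqxx addr0 subrr.
by rewrite bin_small // gtn_eqF // (gtn_eqF (leq_trans _ lt_j)) // addr0 subrr.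
Qed.

(** From 2 (t - 1) + 1 = p^k it follows that t - 1 divides p^k - 1, so e divides k. As t - 1 = 2 e +
    1, this reads 4 e + 3 = p^k >= 3^e, which leaves e = 2, and 11 is not a square. *)
Lemma half_order_absurd : False.
Proof.
have t1_gt1 := prime_gt1 t1_prime.
have t1_dvd : (t.-1 %| p ^ e - 1)%N.
  by rewrite mult_order_dvd // ?prime_gt0 // (dvdn_pcharf pK).
(* For t = 4 the order is 1, so 3 divides p - 1 and there is a fixed point at infinity. *)
have t_neq4 : t != 4.
  apply/eqP => t4; have e1 : e = 1%N by move: eE; rewrite t4; lia.
  have [|f comp_f] := @fixed_component_infinity K p t p_prime pK t_ge3 t_neq0 t1_neq0 1%N;
    last exact: no_fixed.
  by move: t1_dvd; rewrite e1 !subn1 => /gcdn_idPr ->; rewrite t4.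
have l_ge5 : (5 <= t.-1)%N.
  move: t_ge3 t_even t1_prime t_neq4; case: (t) => [|[|[|[|[|[|n]]]]]] //.
have [C [uC szC memC _ n_ge]] :=
  tame_critical_values p_prime t_ge3 t_neq0 t1_neq0 no_fixed.
have [k kE] := half_order_shift memC (sqr_value_constant uC szC memC n_ge) l_ge5 uC szC.
have e_dvd : (e %| k)%N.
  rewrite -mult_orderP ?prime_gt0 // ?prime_coprime // ?(dvdn_pcharf pK) //.
  rewrite eqn_mod_dvd ?expn_gt0 ?prime_gt0 // -kE subn1 /=.
  exact: dvdn_mull.
have lE : (t.-1 = 2 * e + 1)%N by move: eE t_ge3; move: (e) (t); clear; lia.
have p_ge3 : (3 <= p)%N by have := prime_gt1 p_prime; move: p_odd; case: (p) => [|[|[|]]].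
rewrite lE in kE l_ge5.
have [j jE] := dvdnP e_dvd.
have j_gt0 : (0 < j)%N.
  by case: j jE kE => // ->; rewrite mul0n expn0; lia.
have pk_ge : (3 ^ e <= p ^ k)%N.
  apply: leq_trans (leq_pexp2l (prime_gt0 p_prime) _); last first.
    by rewrite jE; apply: leq_pmull j_gt0.
  by rewrite leq_exp2r // (leq_trans _ (e_gt0)).
rewrite -kE in pk_ge.
have e_lt3 : (e < 3)%N.
  rewrite ltnNge; apply/negP => e_ge3; move: pk_ge; rewrite leqNgt => /negP; apply.
  elim: (e) e_ge3 => // n IHn; rewrite leq_eqVlt => /predU1P[[<-]//|]; rewrite ltnS => /IHn.
  by rewrite expnS; lia.
have e2 : e = 2 by move: e_lt3 l_ge5; lia.
rewrite e2 in kE jE; move: kE; rewrite jE expnM.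
case: (p ^ j)%N => [|[|[|[|m]]]] //.
by rewrite -mulnn; lia.
Qed.

End HalfOrder.

(** * Wild ramification *)

(** Orders of vanishing at 0 add up over a domain; it will be applied to dilated polynomials, whose
    order is a multiplicity. *)
Lemma order_of_factor (R : idomainType) (u v : {poly R}) n e :
    (forall j, (j < n)%N -> (u * v)`_j = 0) -> v`_e != 0 ->
  forall j, (j + e < n)%N -> u`_j = 0.
Proof.
move=> uv0 ve j lt_n; apply/eqP; apply: contraT => uj.
have [a ua min_a] := @ex_minnP (fun i => u`_i != 0) (ex_intro _ j uj).
have [b vb min_b] := @ex_minnP (fun i => v`_i != 0) (ex_intro _ e ve).
have /uv0/eqP : (a + b < n)%N by apply: leq_ltn_trans lt_n; rewrite leq_add ?min_a ?min_b.
rewrite coefM (bigD1 (Ordinal (leq_addr b a : (a < (a + b).+1)%N))) //= addKn.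
rewrite big1 ?addr0 => [|i]; first by rewrite mulf_eq0 (negPf ua) (negPf vb).
rewrite -val_eqE /= => ne_ia; have [lt_ia|le_ai] := ltnP i a.
  have -> : u`_i = 0; last by rewrite mul0r.
  by apply/eqP; apply: contraTT lt_ia => ui; rewrite -leqNgt min_a.
have -> : v`_(a + b - i) = 0; last by rewrite mulr0.
apply/eqP; apply: contraT => vi; have := min_b _ vi.
by have := ltn_ord i; move: ne_ia le_ai; clear; lia.
Qed.

(** * Multiplicity at a point *)

Section LocalMultiplicity.

Variable K : fieldType.
Implicit Types (u v : {poly {poly K}}) (w : {poly K}) (k c : K).

Definition translateY c u : {poly {poly K}} := map_poly (comp_poly ('X + c%:P)) u.

(* [translate k c u] is u(x + k, y + c). *)
Definition translate k c u : {poly {poly K}} :=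
  swapXY (translateY k (swapXY (translateY c u))).

Definition multiplicity_ge k c u r :=
  forall a b, (a + b < r)%N -> (translate k c u)`_a`_b = 0.

Lemma coef_translate k c u a b :
  (translate k c u)`_a`_b = ((swapXY (translateY c u))`_b \Po ('X + k%:P))`_a.
Proof. by rewrite /translate coef_swapXY coef_map. Qed.

Lemma translateM k c u v : translate k c (u * v) = translate k c u * translate k c v.
Proof. by rewrite /translate /translateY !rmorphM. Qed.

Lemma translate_horner k c u : (translate k c u)`_0 = u.[k%:P] \Po ('X + c%:P).
Proof.
have -> : u.[k%:P] \Po ('X + c%:P) = (translateY c u).[k%:P].
  by rewrite /translateY -[in RHS](comp_polyC k ('X + c%:P)) horner_map.
apply/polyP => b; rewrite coef_translate horner_polyC coef_map /= -horner_coef0.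
by rewrite horner_comp /horner_eval hornerD hornerX hornerC add0r.
Qed.

Lemma comp_translateK c w : (w \Po ('X + c%:P)) \Po ('X - c%:P) = w.
Proof.
by rewrite -comp_polyA comp_polyD comp_polyX comp_polyC subrK comp_polyXr.
Qed.

Lemma dvd_comp_translate c w r : 'X^r %| w \Po ('X + c%:P) -> ('X - c%:P) ^+ r %| w.
Proof.
case/dvdpP => w' /(congr1 (fun u : {poly K} => u \Po ('X - c%:P))).
by rewrite /= comp_translateK comp_polyM comp_Xn_poly => ->; rewrite dvdp_mull.
Qed.

Lemma coef_mup_comp c w : w != 0 -> (w \Po ('X + c%:P))`_(mup c w) != 0.
Proof.
move=> w_neq0; have /dvdpP[w' wE] : ('X - c%:P) ^+ mup c w %| w by rewrite -mup_geq.
have w'c : w'.[c] != 0.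
  apply: contraTneq (leqnn (mup c w)) => /eqP; rewrite -/(root w' c) => w'c.
  rewrite -ltnNge mup_geq // {2}wE exprS.
  by rewrite dvdp_mul // dvdp_XsubCl.
rewrite {1}wE comp_polyM; have -> : ('X - c%:P) ^+ mup c w \Po ('X + c%:P) = 'X^(mup c w).
  by rewrite rmorphXn /= comp_polyB comp_polyX comp_polyC addrK.
by rewrite coefMXn ltnn subnn -horner_coef0 horner_comp hornerD hornerX hornerC add0r.
Qed.

Lemma multiplicity_ge_dvd k c u r : multiplicity_ge k c u r ->
  forall a, ('X - k%:P) ^+ (r - a) %| (swapXY (translateY c u))`_a.
Proof.
move=> mult_r a; apply: dvd_comp_translate; apply/dvdpP.
set w := _ \Po _; exists (drop_poly (r - a) w).
rewrite -[LHS](poly_take_drop (r - a)) [take_poly _ _](_ : _ = 0) ?add0r //.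
apply/polyP => b; rewrite coef_take_poly coef0; case: ifP => // lt_b.
by rewrite -coef_translate mult_r // addnC -ltn_subRL.
Qed.

(** The order of v(k, y) at c bounds the multiplicity of v at (k, c) from above, since it exhibits a
    term of that degree; multiplicities are additive. *)
Lemma multiplicity_ge_factor k c u v n e : multiplicity_ge k c (u * v) n ->
  v.[k%:P] != 0 -> (mup c v.[k%:P] <= e)%N -> multiplicity_ge k c u (n - e).
Proof.
move=> mult_uv v_neq0 le_e a b lt_ab.
have low0 : (dilate (translate k c u))`_(a + b) = 0.
  apply: (@order_of_factor _ _ (dilate (translate k c v)) n (mup c v.[k%:P])) => [j lt_j||].
  - rewrite -dilateM -translateM; apply/polyP => i; rewrite coef_dilate coef0.
    by case: leqP => // le_ij; rewrite mult_uv // subnKC.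
  - apply: contraTneq (coef_mup_comp c v_neq0) => v0; rewrite negbK -translate_horner.
    by rewrite -[mup _ _]subn0 -[X in X == 0](coef_dilate (translate k c v) (mup c v.[k%:P]) 0) v0 coef0.
  by move: lt_ab le_e; clear; lia.
have := coef_dilate (translate k c u) (a + b) a.
by rewrite leq_addr addKn low0 coef0 => <-.
Qed.

Lemma translateYB c u v : translateY c (u - v) = translateY c u - translateY c v.
Proof. exact: rmorphB. Qed.

Lemma translateY_const c w : translateY c w%:P = (w \Po ('X + c%:P))%:P.
Proof. exact: map_polyC. Qed.

Lemma translateY_map c w : translateY c w^:P = w^:P.
Proof. by rewrite /translateY -map_poly_comp; apply: eq_map_poly => x /=; rewrite comp_polyC. Qed.

Lemma translate_separated k c w :
  translate k c (separated w) = (w \Po ('X + k%:P))^:P - (w \Po ('X + c%:P))%:P.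
Proof.
have swapB u v : swapXY (u - v) = swapXY u - swapXY v by exact: rmorphB.
rewrite /translate /separated translateYB translateY_map translateY_const swapB.
rewrite swapXY_map_polyC swapXY_polyC translateYB translateY_const translateY_map.
by rewrite swapB swapXY_polyC swapXY_map_polyC.
Qed.

Lemma multiplicity_ge_separated k c (F : {poly K}) n : F.[k] = F.[c] ->
    ('X - k%:P) ^+ n %| F - F.[k]%:P -> ('X - c%:P) ^+ n %| F - F.[c]%:P ->
  multiplicity_ge k c (separated F) n.
Proof.
have low (x : K) : ('X - x%:P) ^+ n %| F - F.[x]%:P ->
    forall b, (0 < b < n)%N -> (F \Po ('X + x%:P))`_b = 0.
  case/dvdpP => w /(canRL (subrK _)) -> b /andP[b_gt0 lt_b].
  rewrite comp_polyD comp_polyC coefD coefC gtn_eqF // addr0 comp_polyM rmorphXn /=.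
  by rewrite comp_polyB comp_polyX comp_polyC addrK coefMXn lt_b.
move=> Fkc /low Fk /low Fc a b lt_ab.
rewrite translate_separated coefB coefB coef_map /= !coefC.
case: a b lt_ab => [|a] [|b] lt_ab; rewrite ?coef0 ?sub0r ?subr0 ?oppr0 //=.
- rewrite -!horner_coef0 !horner_comp !hornerD !hornerX !hornerC !add0r Fkc.
  by rewrite subrr.
- by rewrite Fc ?oppr0.
- by rewrite Fk //; move: lt_ab; rewrite addn0.
Qed.

Lemma swapXY_deriv_coef u a : (swapXY u^`())`_a = ((swapXY u)`_a)^`().
Proof.
by apply/polyP => b; rewrite coef_swapXY !coef_deriv coefMn coef_swapXY.
Qed.

(** The derivative has multiplicity at least r - 1 where f has r. Translating y = c to y = 0 reduces
    this to [norm_mod_multiplicity]. *)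
Lemma norm_mod_deriv_multiplicity (C : seq K) c (r : K -> nat) d (f : {poly {poly K}}) :
    uniq C -> f \is monic -> size f = d.+1 ->
    (forall k, k \in C -> multiplicity_ge k c f (r k)) -> norm_mod d f f^`() != 0 ->
  (\sum_(k <- C) r k * (r k).-1 <= mup c (norm_mod d f f^`()))%N.
Proof.
move=> uC f_monic size_f mult_f norm_neq0; rewrite mup_geq //.
have fc_monic : translateY c f \is monic by apply: monic_map.
have size_fc : size (translateY c f) = d.+1.
  by rewrite size_map_poly_id0 // (monicP f_monic) rmorph1 oner_neq0.
have r_dvd k a (kC : k \in C) := multiplicity_ge_dvd (mult_f k kC) a.
(* f(x, c) has degree d and is divisible by every (x - k)^(r k). *)
have sum_r : (\sum_(k <- C) r k <= d)%N.
  have := @point_flag_dvd _ C r (swapXY (translateY c f))`_0 0 uC.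
  move=> /(_ (fun k => @r_dvd k 0%N)) /dvdp_leq le.
  have size_u : (size ((swapXY (translateY c f))`_0)%R <= d.+1)%N.
    apply/leq_sizeP => j lt_j; rewrite coef_swapXY [_`_j]nth_default ?coef0 //.
    by rewrite size_fc.
  have u_neq0 : (swapXY (translateY c f))`_0 != 0.
    apply: contra_neq (oner_neq0 K) => u0.
    have : (swapXY (translateY c f))`_0`_d = 1.
      rewrite coef_swapXY; have := monicP fc_monic.
      by rewrite lead_coefE size_fc => ->; rewrite coef1.
    by rewrite u0 coef0 => ->.
  have := leq_trans (le u_neq0) size_u.
  rewrite -[size _]prednK ?size_poly_gt0 ?monic_neq0 ?point_flag_monic // ltnS size_point_flag.
  by under eq_bigr do rewrite subn0.
apply: dvd_comp_translate.
have -> : norm_mod d f f^`() \Po ('X + c%:P) =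
    norm_mod d (translateY c f) (translateY c f)^`().
  rewrite /translateY deriv_map -map_norm_mod //.
apply: norm_mod_multiplicity => //.
- rewrite -size_fc; apply: leq_trans (leq_pred _); exact: size_poly.
- by apply: leq_trans sum_r; apply: leq_sum => k _; apply: leq_pred.
move=> k a kC; rewrite swapXY_deriv_coef.
have := r_dvd k a kC; case E : (r k - a)%N => [|m] dvd.
  have -> : ((r k).-1 - a = 0)%N by move: E; clear; lia.
  by rewrite expr0 dvd1p.
have -> : ((r k).-1 - a = m)%N by move: E; clear; lia.
exact: dvdp_deriv.
Qed.

End LocalMultiplicity.

(** The two sides differ by (2 r - q - 1)^2 when r > 0. *)
Lemma square_completion q r : (4 * (q * r) <= 4 * (r * r.-1) + (q + 1) ^ 2)%N.
Proof.
have [+ _] := nat_Cauchy (2 * r) (q + 1); case: r => [|r]; first by rewrite !muln0.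
have -> : (2 * (2 * r.+1 * (q + 1)) = 4 * (q * r.+1) + 4 * r.+1)%N by ring.
have -> : ((2 * r.+1) ^ 2 = 4 * (r.+1 * r) + 4 * r.+1)%N by ring.
by rewrite /= addnAC leq_add2r.
Qed.

Section Wild.

Variables (K : closedFieldType) (p i L : nat).
Hypotheses (p_prime : prime p) (pK : p \in [pchar K]).

Let q := (p ^ i)%N.
Let t := (q * L).+1.
Let F := diff_power K t.
Let g := g_poly K t.

Hypotheses (t_ge3 : (3 <= t)%N) (t_neq0 : t%:R != 0 :> K) (L_neq0 : L%:R != 0 :> K).

Variable C : seq K.
Hypotheses (C_uniq : uniq C) (C_size : size C = L.-1)
  (C_mem : forall x, (x \in C) = ((x + 1) ^+ L == x ^+ L))
  (C_prod : diff_power K L = L%:R *: \prod_(c <- C) ('X - c%:P)).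

(** The order of F(c) - F at a critical point c is q or q + 1; this tells which. *)
Let order_excess c := (q < mup c (F.[c]%:P - F)%R)%N.

Lemma polyB_pchar_expn (u v : {poly K}) : (u - v) ^+ q = u ^+ q - v ^+ q.
Proof.
have pP : p \in [pchar {poly K}] by apply: (rmorph_pchar polyC).
by rewrite exprDn_pchar ?exprNn_pchar // pchar_nat_expn.
Qed.

Lemma F_expansion c : c \in C ->
  F - F.[c]%:P = ('X + 1) * (('X + 1) ^+ L - (c ^+ L)%:P) ^+ q - 'X * ('X ^+ L - (c ^+ L)%:P) ^+ q.
Proof.
rewrite C_mem => /eqP cL.
have Fc : F.[c] = (c ^+ L) ^+ q.
  rewrite /F /diff_power hornerD hornerN !horner_exp hornerD hornerX hornerC.
  rewrite !exprS [(q * L)%N]mulnC !exprM cL.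
  by rewrite mulrDl mul1r addrAC subrr add0r.
rewrite !polyB_pchar_expn Fc polyC_exp /F /diff_power !exprS [(q * L)%N]mulnC !exprM; ring.
Qed.

Lemma F_order c : c \in C -> ('X - c%:P) ^+ q %| F - F.[c]%:P.
Proof.
move=> cC; rewrite F_expansion //.
have dvd (u : {poly K}) : u.[c] = 0 -> ('X - c%:P) ^+ q %| u ^+ q.
  by move=> uc; rewrite dvdp_exp2r // dvdp_XsubCl; apply/rootP.
rewrite dvdp_sub // dvdp_mull // dvd //; rewrite !hornerE ?subrr //.
by move: cC; rewrite C_mem => /eqP ->; rewrite subrr.
Qed.

Lemma critical_neq0 c : c \in C -> c != 0.
Proof.
rewrite C_mem; apply: contraTneq => ->; rewrite add0r expr1n expr0n.
have /negPf -> : L != 0 by apply: contraNneq L_neq0 => ->.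
by rewrite oner_eq0.
Qed.

Lemma F_sub_neq0 c : F.[c]%:P - F != 0.
Proof.
apply: contraTneq (F_gt1 t_ge3 t_neq0) => /eqP; rewrite subr_eq0 -/F => /eqP <-.
by rewrite -leqNgt size_polyC leq_b1.
Qed.

Lemma factor_deriv (u : {poly K}) c : u.[c] = 0 ->
  exists2 w, u = w * ('X - c%:P) & w.[c] = u^`().[c].
Proof.
move=> /rootP/factor_theorem[w ->]; exists w => //.
by rewrite derivM derivXsubC !hornerE subrr mulr0 add0r.
Qed.

(** F - F(c) is (X - c)^q ((X + 1) A^q - X B^q) with A(c) = L (c + 1)^(L - 1) and B(c) = L c^(L -
    1). If the second factor vanishes at c, then (c + 1) (c + 1)^((L - 1) q) = c c^((L - 1) q);
    compare with (c + 1)^(L q) = c^(L q). *)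
Lemma order_excess_root c : c \in C -> order_excess c ->
  (c + 1) ^+ q.-1 = c ^+ q.-1.
Proof.
move=> cC; have cL : (c + 1) ^+ L = c ^+ L by apply/eqP; rewrite -C_mem.
have c_neq0 := critical_neq0 cC.
have L_gt0 : (0 < L)%N by rewrite lt0n; apply: contraNneq L_neq0 => ->.
have q_pos : (0 < q)%N by apply: q_gt0.
have c1_neq0 : c + 1 != 0.
  have := expf_neq0 L c_neq0; rewrite -cL; apply: contraNneq => ->.
  by rewrite expr0n eqn0Ngt L_gt0.
rewrite /order_excess mup_geq ?F_sub_neq0 // -[_ - F]opprB dvdpNr F_expansion //.
have [|A AE Ac] := @factor_deriv (('X + 1) ^+ L - (c ^+ L)%:P) c.
  by rewrite !hornerE cL subrr.
have [|B BE Bc] := @factor_deriv ('X ^+ L - (c ^+ L)%:P) c; first by rewrite !hornerE subrr.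
rewrite AE BE !exprMn !mulrA -mulrBl exprS dvdp_mul2r ?expf_neq0 ?polyXsubC_eq0 //.
rewrite dvdp_XsubCl => /rootP; rewrite hornerD hornerN !hornerM !horner_exp Ac Bc.
rewrite !derivB !derivC !subr0 deriv_exp derivXn derivD derivX derivC addr0 mul1r.
rewrite !hornerMn !horner_exp hornerD hornerX hornerC.
rewrite -[(c + 1) ^+ _ *+ L]mulr_natl -[c ^+ _ *+ L]mulr_natl !exprMn mulrCA [X in _ - X]mulrCA.
rewrite -mulrBr => /eqP; rewrite mulf_eq0 expf_eq0 (negPf L_neq0) andbF /= subr_eq0.
have expE (x : K) : x != 0 -> x * (x ^+ L.-1) ^+ q * x ^+ q.-1 = (x ^+ L) ^+ q.
  move=> x_neq0; rewrite -[in RHS](prednK L_gt0) exprS [in RHS]exprMn.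
  by rewrite mulrAC -exprS prednK.
move=> /eqP E; apply: (mulfI (_ : c * (c ^+ L.-1) ^+ q != 0)).
  by rewrite mulf_neq0 ?expf_neq0.
by rewrite -{1}E !expE // cL.
Qed.

Hypothesis p_odd : odd p.
Hypothesis L_odd : odd L.

(** For such c the ratio z = (c + 1) / c satisfies z^(q - 1) = 1 and z^L = 1. With h = (q - 1) / 2,
    z^h is 1 or -1, and -1 is excluded because L is odd. So z is one of at most h - 1 = (q - 3) / 2
    roots of unity other than 1. *)
Lemma num_order_excess_le : (2 < q)%N -> (2 * count order_excess C <= q - 3)%N.
Proof.
move=> q_gt2; pose h := (q.-1)./2; pose z (c : K) := (c + 1) / c.
have q_odd : odd q by rewrite oddX p_odd orbT.
have qE : q = (2 * h).+1 by move: q_odd q_gt2; rewrite /h; move: q; lia.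
have h_gt0 : (0 < h)%N by move: q_gt2 qE; lia.
pose zs := 1 :: [seq z c | c <- C & order_excess c].
have zs_uniq : uniq zs.
  rewrite /= map_inj_in_uniq ?filter_uniq ?andbT // => [|c k].
    apply/mapP => -[c]; rewrite mem_filter => /andP[_ /critical_neq0 c_neq0].
    by rewrite /z mulrDl divff // mul1r -[LHS]addr0 => /addrI/esym/eqP; rewrite invr_eq0 (negPf c_neq0).
  rewrite !mem_filter => /andP[_ /critical_neq0 c_neq0] /andP[_ /critical_neq0 k_neq0].
  by rewrite /z !mulrDl !divff // !mul1r => /addrI /invr_inj.
have zs_root : all (root ('X^h - 1)) zs.
  apply/allP => x; rewrite inE => /predU1P[->|].
    by rewrite rootE !hornerE expr1n subrr.
  case/mapP => c; rewrite mem_filter => /andP[exc cC] ->.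
  have c_neq0 := critical_neq0 cC; have := order_excess_root cC exc.
  have zL : z c ^+ L = 1.
    by move: (cC); rewrite C_mem expr_div_n => /eqP ->; rewrite divff // expf_neq0.
  rewrite qE /= mulnC => /(congr1 (fun x => x / c ^+ (h * 2))).
  rewrite -expr_div_n divff ?expf_neq0 // exprM => /eqP; rewrite sqrf_eq1 rootE !hornerE subr_eq0.
  case/orP => // /eqP zh; have : (z c ^+ h) ^+ L = 1 by rewrite exprAC zL expr1n.
  by rewrite zh -signr_odd L_odd expr1 => ->.
have : 'X^h - 1 != 0 :> {poly K} by rewrite -size_poly_eq0 size_XnsubC.
move=> /max_poly_roots/(_ zs_root zs_uniq); rewrite size_XnsubC //= size_map size_filter.
by rewrite ltnS qE; move: (count _ _); clear; lia.
Qed.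

Section Divisor.

Variables P h : {poly {poly K}}.
Hypotheses (P_monic : P \is monic) (g_eq : g = P * h).

Let d := (size P).-1.
Let V := h * ('X - 'Y).

Lemma separated_divisor : separated F = P * V.
Proof. by rewrite /V -(g_mul K t) -/g g_eq mulrA. Qed.

Lemma divisor_tight : tight P.
Proof. by apply: (@tightMl _ _ h); rewrite -g_eq; apply: tight_g. Qed.

Lemma divisor_horner k : P.[k%:P] * V.[k%:P] = F.[k]%:P - F.
Proof.
have := congr1 (fun u : {poly {poly K}} => u.[k%:P]) separated_divisor.
by rewrite (hornerM P) /separated hornerD hornerN hornerC horner_map /= => <-.
Qed.

Lemma divisor_root c k : root P.[k%:P] c -> F.[k] = F.[c].
Proof.
move=> /rootP Pkc; have := congr1 (fun u : {poly K} => u.[c]) (divisor_horner k).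
rewrite hornerM Pkc mul0r hornerD hornerN hornerC => /esym/eqP.
by rewrite subr_eq0 => /eqP.
Qed.

(* P V = F(x) - F(y) has multiplicity at least q at (k, c), while its restriction
   to x = k vanishes to order at most q + order_excess c at y = c. *)
Lemma divisor_multiplicity c k : c \in C -> k \in C ->
  multiplicity_ge k c P (mup c P.[k%:P] - order_excess c).
Proof.
move=> cC kC; have F_k := divisor_horner k.
have := F_sub_neq0 k; rewrite -F_k mulf_eq0 negb_or => /andP[Pk_neq0 Vk_neq0].
have [/divisor_root Fkc|/mupNroot ->] := boolP (root P.[k%:P] c); last by rewrite sub0n.
have mult_N := multiplicity_ge_separated Fkc (F_order kC) (F_order cC).
rewrite separated_divisor in mult_N.
have mult_P := multiplicity_ge_factor mult_N Vk_neq0 (leqnn _).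
have le_sum : (mup c P.[k%:P] + mup c V.[k%:P] <= q + order_excess c)%N.
  rewrite -mupM // F_k; have := mup_F_value pK t_ge3 t_neq0 L_neq0 C_uniq C_prod cC kC.
  rewrite -/q -/t -/F Fkc eqxx muln1 /order_excess.
  by case: ltnP => [_|le_q _]; rewrite ?addn1 ?addn0.
move=> a b lt_ab; apply: mult_P; apply: leq_trans lt_ab _.
by move: le_sum; move: (mup c _) (mup c _) (nat_of_bool _); clear; lia.
Qed.

(** For each k in the fibre of c, let e be the order of P(k, y) at c: the contribution is q e minus
    r (r - 1), where r = e or e - 1 according to the excess. Completing the square gives (q + 1)^2 /
    4, plus q in case of excess. *)
Lemma norm_mod_value_bound c : c \in C ->
  (4 * mup c (norm_mod d P V) <=
   (\sum_(k <- C) (F.[c] == F.[k])) * ((q + 1) ^ 2 + 4 * q * order_excess c))%N.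
Proof.
move=> cC; have size_P : size P = d.+1 by rewrite prednK // size_poly_gt0 monic_neq0.
have [_ mup_eq] := divisor_norm_bound p_prime pK t_ge3 t_neq0 L_neq0 C_uniq C_size C_prod P_monic g_eq.
have [n1 n2] := norm_mod_separated_neq0 (kappa_neq0 t_neq0 L_neq0)
  (F_derivE i pK C_prod) P_monic size_P separated_divisor divisor_tight.
have := norm_mod_deriv_multiplicity C_uniq P_monic size_P (fun k => @divisor_multiplicity c k cC) n1.
have := mup_eq c; rewrite -/d -/V -/q.
move: (mup c _) (mup c _) => N1 N2 N12 le_N1.
suff : (\sum_(k <- C) 4 * (q * mup c P.[k%:P]) <=
    \sum_(k <- C) (4 * ((mup c P.[k%:P] - order_excess c) * (mup c P.[k%:P] - order_excess c).-1)
      + (F.[c] == F.[k]) * ((q + 1) ^ 2 + 4 * q * order_excess c)))%N.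
  have -> : (\sum_(k <- C) 4 * (q * mup c P.[k%:P]) =
      4 * (q * \sum_(k <- C) mup c P.[k%:P]))%N by rewrite !big_distrr.
  rewrite -N12 big_split /= -[X in (_ <= _ + X)%N]big_distrl /=.
  rewrite -[X in (_ <= X + _)%N](big_distrr 4) /=.
  move: le_N1; move: (\sum_(k <- C) _ * _)%N => a; move: ((\sum_(k <- C) (F.[c] == F.[k])) * _)%N => b.
  by clear; lia.
rewrite big_seq [X in (_ <= X)%N]big_seq; apply: leq_sum => k kC.
have [Fck|neF] := eqVneq F.[c] F.[k]; last first.
  by rewrite mupNroot ?muln0 //; apply: contra_neqN neF => /divisor_root.
rewrite mul1n; move: (mup c _) (order_excess c) => e [] /=; rewrite ?subn1 ?muln1 ?subn0 ?muln0 ?addn0.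
  case: e => [|e]; first by rewrite !muln0.
  by rewrite mulnS mulnDr addnC addnA leq_add2r square_completion.
exact: square_completion.
Qed.

End Divisor.
End Wild.

(** * Elimination of the degree *)

Lemma wild_degree_elimination (q m d R : int) : let n := q * m + q - 1 in
    2 <= m -> 3 <= q -> n <= 3 * d -> 2 * d <= n -> 8 * d * (q * m + 1) <= 8 * d * d + R ->
  n * (16 * q * m - 8 * q + 32) <= 9 * R \/ n * (12 * q * m - 12 * q + 36) <= 6 * R.
Proof.
move=> n m_ge2 q_ge3 d_ge d_le main.
(* For n / 3 <= d <= n / 2 this gives 6 d^2 <= 5 d n - n^2, which makes the inequality linear in d;
   it then suffices to look at an endpoint, chosen by the sign of the slope. *)
have concave : 0 <= (3 * d - n) * (n - 2 * d) by rewrite mulr_ge0 // subr_ge0.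
have lin : d * (4 * q * m - 20 * q + 44) + 4 * n * n <= 3 * R by rewrite /n in concave *; nia.
have [c|c] := lerP 0 (4 * q * m - 20 * q + 44).
  left; have : 0 <= (3 * d - n) * (4 * q * m - 20 * q + 44) by rewrite mulr_ge0 // subr_ge0.
  by move: lin; rewrite /n; nia.
right; have : (n - 2 * d) * (4 * q * m - 20 * q + 44) <= 0.
  by rewrite mulr_ge0_le0 ?subr_ge0 // ltW.
by move: lin; rewrite /n; nia.
Qed.

(** With a <= m the first alternative has coefficient 7 q^2 - 54 q - 9 at m^2, which is negative at
    q = 7 and positive at q = 9: hence the threshold. Below it the sharper bound 2 a <= q - 3 is
    called for. *)
Lemma wild_large_absurd (q m a : int) :
    2 <= m -> 9 <= q -> 0 <= a <= m -> let R := m * (m * (q + 1) * (q + 1) + 4 * q * a) in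
  (q * m + q - 1) * (16 * q * m - 8 * q + 32) <= 9 * R \/
    (q * m + q - 1) * (12 * q * m - 12 * q + 36) <= 6 * R -> False.
Proof.
move=> m_ge2 q_ge9 a_le R.
have R_le : R <= m * m * (q * q + 6 * q + 1) by rewrite /R; nia.
have [u uE] : {u | m = u + 2} by exists (m - 2); rewrite subrK.
have [v vE] : {v | q = v + 9} by exists (q - 9); rewrite subrK.
clearbody R; subst q m.
case=> H; nia.
Qed.

Lemma wild_small_absurd (q m a : int) :
    2 <= m -> q = 3 /\ a = 0 \/ q = 5 /\ 0 <= a <= 1 \/ q = 7 /\ 0 <= a <= 2 ->
    let R := m * (m * (q + 1) * (q + 1) + 4 * q * a) in
  (q * m + q - 1) * (16 * q * m - 8 * q + 32) <= 9 * R \/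
    (q * m + q - 1) * (12 * q * m - 12 * q + 36) <= 6 * R -> False.
Proof.
move=> m_ge2 Hq; case: Hq => [[-> ->]|[[-> H]|[-> H]]] R; rewrite /R; case=> H1; nia.
Qed.

Lemma wild_inequality_absurd (q L d a : nat) : (3 <= L)%N -> odd q -> (3 <= q)%N ->
    (a <= L.-1)%N -> (2 * a <= q - 3)%N -> (q * L - 1 <= 3 * d)%N -> (2 * d <= q * L - 1)%N ->
    (8 * (d * (q * L.-1)) <= 8 * (d * d.-1) + L.-1 * (L.-1 * (q + 1) ^ 2 + 4 * q * a))%N ->
  False.
Proof.
case: L => // m; rewrite /= -mulnn mulnS => m_ge2 q_odd q_ge3 a_le a_le' d_ge d_le main.
have d_gt0 : (0 < d)%N by move: d_ge m_ge2 q_ge3; clear; nia.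
have main' : (8 * d * (q * m + 1) <= 8 * d * d + m * (m * (q + 1) * (q + 1) + 4 * q * a))%N.
  have -> : (8 * d * (q * m + 1) = 8 * (d * (q * m)) + 8 * d)%N by ring.
  have -> : (8 * d * d = 8 * (d * d.-1) + 8 * d)%N.
    by rewrite -mulnA -mulnDr addnC -mulnS prednK.
  by rewrite addnAC leq_add2r -[(m * _ * _)%N]mulnA.
have H : let n := q%:Z * m%:Z + q%:Z - 1 in
    let R := m%:Z * (m%:Z * (q%:Z + 1) * (q%:Z + 1) + 4 * q%:Z * a%:Z) in
    n * (16 * q%:Z * m%:Z - 8 * q%:Z + 32) <= 9 * R \/
    n * (12 * q%:Z * m%:Z - 12 * q%:Z + 36) <= 6 * R.
  apply: (@wild_degree_elimination q m d).
  - by move: m_ge2; clear; lia.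
  - by move: q_ge3; clear; lia.
  - by move: d_ge q_ge3; clear; lia.
  - by move: d_le q_ge3; clear; lia.
  by move: main'; clear; lia.
have [q_ge9|q_lt9] := leqP 9 q.
  by apply: (@wild_large_absurd q m a _ _ _ H); move: m_ge2 q_ge9 a_le; clear; lia.
apply: (@wild_small_absurd q m a _ _ H); first by move: m_ge2; clear; lia.
move: q_odd q_ge3 q_lt9 a_le'; clear.
by case: q => [|[|[|[|[|[|[|[|[|q]]]]]]]]] //; lia.
Qed.

Section WildAbsurd.

Variables (K : closedFieldType) (p i L : nat).
Hypotheses (p_prime : prime p) (pK : p \in [pchar K]).

Let q := (p ^ i)%N.
Let t := (q * L).+1.
Let F := diff_power K t.

Hypotheses (t_ge3 : (3 <= t)%N) (t_neq0 : t%:R != 0 :> K) (L_neq0 : L%:R != 0 :> K).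
Hypothesis no_fixed : forall f, component t f -> conj_poly pK 1 f <> f.

(** Take P of largest degree not exceeding n / 2, with n = deg g. If it were below n / 3, so would
    be that of a component f dividing g / P, and deg (P f) < 2 n / 3. Either P f or its cofactor
    then has degree at most n / 2 and larger than deg P. *)
Lemma exists_half_divisor : exists P h,
  [/\ P \is monic, g_poly K t = P * h, (2 * (size P).-1 <= t - 2)%N & (t - 2 <= 3 * (size P).-1)%N].
Proof.
have size_mg : size (monic_g K t) = t.-1.
  by rewrite /monic_g size_scale ?polyC_eq0 ?invr_eq0 // size_g.
pose divides (P h : {poly {poly K}}) := [/\ P \is monic, h \is monic & monic_g K t = P * h].
(* Minimising the degree of the cofactor maximises that of P. *)
pose Q m := exists P h, [/\ divides P h, (2 * (size P).-1 <= t - 2)%N & m = (t - 2 - (size P).-1)%N].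
have divides_size P h : divides P h -> ((size P).-1 + (size h).-1 = t - 2)%N.
  case=> mP mh E; move: size_mg; rewrite E size_Mmonic ?monic_neq0 //.
  have := size_poly_gt0 P; have := size_poly_gt0 h; rewrite !monic_neq0 //.
  by move: t_ge3; move: (size P) (size h) (t); clear; lia.
have [|m [P [h [div_Ph P_le mE]]] min_m] := @ex_least Q.
  exists (t - 2)%N, 1, (monic_g K t); split; last 2 first.
  - by rewrite size_poly1.
  - by rewrite size_poly1 subn0.
  by split; rewrite ?monic1 ?monic_g_monic ?mul1r.
have max_P P' h' : divides P' h' -> (2 * (size P').-1 <= t - 2)%N ->
    ((size P').-1 <= (size P).-1)%N.
  move=> div' P'_le; have : (m <= t - 2 - (size P').-1)%N by apply: min_m; exists P', h'.
  have := divides_size _ _ div'; rewrite mE; have := divides_size _ _ div_Ph.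
  by move: (size P).-1 (size P').-1 (size h).-1 (size h').-1 (t - 2)%N; clear; lia.
have sizes := divides_size _ _ div_Ph; have [mP mh g_eq] := div_Ph.
exists P; have [h0 h0E] : exists h0, g_poly K t = P * h0.
  by apply/(monic_g_dvd t_neq0); exists h.
exists h0; split=> //; rewrite leqNgt; apply/negP => P_small.
have h_gt1 : (1 < size h)%N.
  by move: sizes P_small; move: (size P).-1 (t - 2)%N; case: (size h) => [|[|n]] //= a b; clear; lia.
have [||f [f_irr _ [h' mh' hE]]] :=
    exists_monic_irreducible (Q := fun u => (1 < size u)%N) _ _ mh h_gt1.
- by rewrite size_poly1.
- move=> a b ab; apply/orP; apply: contraTT ab; rewrite negb_or -!leqNgt => /andP[a1 b1].
  rewrite (leq_trans (size_polyMleq _ _)) //.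
  by move: a1 b1; move: (size a) (size b); lia.
have [mf f_gt1 _] := f_irr.
have div_f : divides f (P * h').
  by split=> //; rewrite ?rpredM // mulrCA -hE -g_eq.
have div_Pf : divides (P * f) h' by split=> //; rewrite ?rpredM // -mulrA -hE -g_eq.
have div_h' : divides h' (P * f) by split=> //; rewrite ?rpredM // mulrC -mulrA -hE -g_eq.
have comp_f : component t f.
  by split=> //; apply/(monic_g_dvd t_neq0); exists (P * h'); case: div_f.
have f_le := half_degree t_ge3 t_neq0 no_fixed comp_f.
have f_small := max_P _ _ div_f f_le.
have := divides_size _ _ div_Pf; have := divides_size _ _ div_f.
have := max_P _ _ div_Pf; have := max_P _ _ div_h'.
have -> : (size (P * f)).-1 = ((size P).-1 + (size f).-1)%N.
  rewrite size_Mmonic ?monic_neq0 //; move: f_gt1; have := size_poly_gt0 P; rewrite monic_neq0 //.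
  by move: (size P) (size f); clear; lia.
move: f_small P_small f_gt1; move: (size P).-1 (size h').-1 (size (P * h')).-1 (t - 2)%N.
by case: (size f) => [|[|n]] //= a b e s; clear; lia.
Qed.

Hypotheses (p_odd : odd p) (t_even : ~~ odd t) (q_ge3 : (3 <= q)%N) (L_ge3 : (3 <= L)%N).

Lemma wild_absurd : False.
Proof.
have L_odd : odd L by move: t_even; rewrite /= negbK oddM => /andP[].
have q_odd : odd q by rewrite oddX p_odd orbT.
have L_gt0 : (0 < L)%N by apply: leq_trans L_ge3.
have [C [uC szC memC prodC]] := critical_points L_gt0 L_neq0.
(* Since t - 1 = q L and raising to the power q is injective, C also satisfies the description by
   exponent t - 1 on which the results about fibres rely. *)
have memC' x : (x \in C) = ((x + 1) ^+ t.-1 == x ^+ t.-1).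
  by rewrite memC /= mulnC !exprM (inj_eq (@fmorph_inj _ _ (frob pK i))).
have [P [h [mP gE P_le P_ge]]] := exists_half_divisor.
have [deg_le _] := divisor_norm_bound p_prime pK t_ge3 t_neq0 L_neq0 uC szC prodC mP gE.
pose exc c := (q < mup c (F.[c]%:P - F)%R)%N.
apply: (@wild_inequality_absurd q L (size P).-1 (count exc C)) => //.
- by rewrite -szC count_size.
- exact: (num_order_excess_le p_prime pK t_ge3 t_neq0 L_neq0 uC szC memC p_odd L_odd q_ge3).
move: deg_le; rewrite -/q -(leq_pmul2l (isT : 0 < 8)%N) mulnDr => /leq_trans; apply.
rewrite leq_add2l big_distrr /=.
have -> : (L.-1 * (L.-1 * (q + 1) ^ 2 + 4 * q * count exc C) =
    \sum_(c <- C) L.-1 * ((q + 1) ^ 2 + 4 * q * exc c))%N.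
  rewrite -big_distrr big_split /= big_const_seq count_predT iter_addn_0 szC.
  rewrite [((q + 1) ^ 2 * _)%N]mulnC -big_distrr /= -sum1_count [in LHS]big_mkcond /=.
  by congr (_ * (_ + _ * _))%N; apply: eq_bigr => c _; case: (exc c).
rewrite big_seq [X in (_ <= X)%N]big_seq; apply: leq_sum => c cC.
have := norm_mod_value_bound p_prime pK t_ge3 t_neq0 L_neq0 uC szC memC prodC mP gE cC.
rewrite (fiber_sizeE t C) -/q -/t -/F -/(exc c).
(* The fibres over F(c) and -F(c) are disjoint and equally large. *)
have : (2 * fiber_size t C F.[c] <= L.-1)%N.
  have := @fiber_size_disjoint K t C [:: F.[c]; - F.[c]].
  rewrite /= inE (not_opp_self p_prime pK p_odd) ?(F_critical_neq0 t_ge3 memC' cC) // => /(_ isT).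
  by rewrite !big_cons big_nil (fiber_size_opp t_ge3 t_even uC memC') szC addn0 addnn mul2n.
move: (mup _ _) (fiber_size _ _ _) ((q + 1) ^ 2 + _)%N => a b w; move: (L.-1); clear; nia.
Qed.

End WildAbsurd.

(** * The factor x + y + 1 for p = 2 or odd t *)

Section LinearFactor.

Variables (p t : nat).
Hypotheses (p_prime : prime p) (t_ge3 : (3 <= t)%N) (p_t : ~~ (p %| t)%N).
Variables (K : closedFieldType) (emb : {rmorphism 'F_p -> K}).

Local Notation pK := (pchar_K p_prime emb).

Lemma linear_factor : (p == 2)%N || odd t -> has_abs_irreducible_factor emb (g_poly 'F_p t).
Proof.
move=> triv; have tK := t_neq0 p_prime p_t emb.
pose w : {poly K} := - 1 - 'X; pose f : {poly {poly K}} := 'X - w%:P.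
have opp_t (u : {poly K}) : (- u) ^+ t = - u ^+ t.
  case/orP: triv => [/eqP p2|t_odd]; last by rewrite exprNn -signr_odd t_odd expr1 mulN1r.
  have opp (v : {poly K}) : - v = v.
    have two0 : 1 + 1 = 0 :> K by rewrite -[LHS](mulrS 1 1) -p2 (pcharf0 pK).
    apply/esym/eqP; rewrite -addr_eq0 -[v]mul1r -mulrDl -polyCD two0 mul0r; exact: eqxx.
  by rewrite !opp.
have N0 : (separated (diff_power K t)).[w] = 0.
  (* x -> -1 - x exchanges x + 1 and x up to sign, so it preserves F as soon as t-th powers are odd
     functions. *)
  have Fw : (diff_power K t) \Po w = diff_power K t.
    rewrite /diff_power comp_polyB !rmorphXn /= comp_polyD comp_polyX rmorph1 /w.
    have -> : - 1 - 'X + 1 = - 'X :> {poly K} by rewrite addrAC addNr add0r.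
    by rewrite -opprD !opp_t opprK addrC [1 + _]addrC.
  by rewrite /separated hornerD hornerN hornerC -/(comp_poly w _) Fw subrr.
have comp_f : component t f.
  split; last first.
    have : root (g_poly K t) w.
      move: N0; rewrite -(g_mul K t) hornerM hornerXsubC => /eqP; rewrite mulf_eq0 => /orP[//|/eqP].
      (* w - y takes the value -1 at y = 0, so it is non-zero even in characteristic 2. *)
      move=> /(congr1 (fun u : {poly K} => u.[0])); rewrite /w !hornerE => /eqP.
      by rewrite ?subr0 oppr_eq0 oner_eq0.
    by case/factor_theorem => h ->; exists h; rewrite mulrC.
  split; rewrite ?monicXsubC ?size_XsubC // => a b ab.
  have := size_XsubC w; rewrite -/f ab.
  have [-> | a_neq0] := eqVneq a 0; first by rewrite mul0r size_poly0.
  have [-> | b_neq0] := eqVneq b 0; first by rewrite mulr0 size_poly0.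
  rewrite size_mul //; move: (size_poly_gt0 a) (size_poly_gt0 b); rewrite a_neq0 b_neq0.
  by move: (size a) (size b); clear; lia.
apply: (fixed_component_factor (p_prime := p_prime) comp_f).
rewrite /conj_poly /extend_scalars /f rmorphB /= map_polyX map_polyC /= /w.
by rewrite !rmorphB /= rmorphN rmorph1 map_polyX.
Qed.

End LinearFactor.

Local Close Scope ring_scope.

Lemma dvdn_gcd_order p d n : prime p -> 0 < n -> ~~ (p %| n) -> d %| n ->
  d <= gcdn (p ^ mult_order p d - 1) n.
Proof.
move=> p_prime n_gt0 p_n d_n; rewrite dvdn_leq ?gcdn_gt0 ?n_gt0 ?orbT //.
rewrite dvdn_gcd d_n andbT mult_order_dvd ?(dvdn_gt0 n_gt0) //.
by apply: contra p_n => /dvdn_trans; apply.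
Qed.

Theorem theorem1p1 (p t : nat) (p_prime : prime p) (t_ge3 : 3 <= t)
    (p_ndvd_t : ~~ (p %| t))
    (K : closedFieldType) (iota : {rmorphism 'F_p -> K})
    (K_algebraic : integralRange iota) :
  let g := g_poly 'F_p t in
  let e := mult_order p in
  (t <> 1 %[mod p] /\
     ((3 <= gcdn (p - 1) t \/ 2 <= gcdn (p - 1) (t - 1)) \/
      (exists m : nat, 0 < m /\
         (exists (L : finFieldType) (phi : {rmorphism 'F_p -> L}),
            #|L| = p ^ m /\ irreducible_elt (extend_scalars phi g)) /\
         (3 <= gcdn (p ^ m - 1) t \/ 2 <= gcdn (p ^ m - 1) (t - 1))) \/
      (exists s : seq (K * K),
         uniq s /\
         (forall a : K * K,
            a \in s <-> singular_point (extend_scalars iota g) a) /\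
         ((size s)%:R < (t%:R - 2) ^+ 2 / 4 :> rat)%R) \/
      (~~ odd t /\
       forall s : K, ((t - 1)%N.-unity_root s)%R -> s <> 1%R ->
         ~ (exists c : 'F_p, ((s - 1) ^+ (t - 1)%N = iota c)%R) /\
         ((s - 1) ^+ ((t - 1) * (p - 1))%N <> -1)%R) \/
      (~~ odd t /\ exists k : nat, 0 < k /\ t - 1 %| p ^ (2 * k) + 1) \/
      (3 <= t - 1 /\ prime (t - 1) /\ e (t - 1) = (t - 2) %/ 2) \/
      ((exists d : nat, 2 < d /\ d %| t /\
          gcdn (gcdn (e (t - 1)) (e t)) (e d) = 1) \/
       (exists d : nat, 1 < d /\ d %| t - 1 /\
          gcdn (gcdn (e (t - 1)) (e t)) (e d) = 1)) \/
      (irreducible_elt g /\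
       \big[gcdn/0]_(3 <= d < t.+1 | (d %| t) || (d %| t - 1)) e d = 1)))
  \/
  (t = 1 %[mod p] /\
     exists i l : nat, t = p ^ i * l + 1 /\ 1 <= i /\ ~~ (p %| l) /\
       ((gcdn l (p ^ i - 1) < l /\
         ((5 <= p /\ 1 <= i /\ 3 < l) \/
          (5 <= p /\ 2 <= i /\ 3 <= l) \/
          (p = 3 /\ 2 <= i /\ 3 <= l))) \/
        (gcdn l (p ^ i - 1) = l /\ 1 < l < p ^ i - 1))) ->
  has_abs_irreducible_factor iota g.
Proof.
move=> g e cases.
have [triv|] := boolP ((p == 2) || odd t).
  exact: (linear_factor p_prime).
rewrite negb_or => /andP[p_neq2 t_even].
have p_odd : odd p by case: (even_prime p_prime) p_neq2 => [->|].
have pK := pchar_K p_prime iota.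
have natK n : ((n%:R != 0 :> K)%R = ~~ (p %| n)) by apply: natr_neq0.
have tK : (t%:R != 0 :> K)%R by rewrite natK.
have t_gt0 : 0 < t by apply: leq_trans t_ge3.
have [no_fixed|] := classic (forall f, component t f ->
    conj_poly (pchar_K p_prime iota) 1 f <> f); last first.
  move=> /not_all_ex_not[f fixed]; have [comp_f /NNPP fix_f] := imply_to_and _ _ fixed.
  exact: fixed_component_factor comp_f fix_f.
case: cases => [[t_neq1 cases]|[_ [i [l [tE [i_ge1 [p_l cond]]]]]]]; last first.
  exfalso; rewrite addn1 in tE; subst t.
  have q_ge3 : 2 < p ^ i.
    apply: leq_trans (leq_pexp2l (prime_gt0 p_prime) i_ge1); rewrite expn1.
    by move: (prime_gt1 p_prime); rewrite leq_eqVlt eq_sym (negPf p_neq2).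
  have l_odd : odd l by move: t_even; rewrite /= negbK oddM => /andP[].
  apply: (wild_absurd p_prime t_ge3 tK _ no_fixed p_odd t_even q_ge3); first by rewrite natK.
  case: cond => [[_]|[_ /andP[l_gt1 _]]].
    by case=> [[_ [_ /ltnW]]|[[_ [_]]|[_ [_]]]].
  (* As [l] is odd, [1 < l] means [3 <= l]. *)
  by move: l_odd l_gt1; case: (l) => [|[|[|]]].
have p_t1 : ~~ (p %| t - 1).
  by rewrite -eqn_mod_dvd //; apply/eqP.
have t1K : (t.-1%:R != 0 :> K)%R by rewrite natK -subn1.
have t1_gt0 : 0 < t - 1 by rewrite subn_gt0 ltnW.
pose fixes m := exists2 f, component t f & conj_poly (pchar_K p_prime iota) m f = f.
have fix_gcd m : 3 <= gcdn (p ^ m - 1) t \/ 2 <= gcdn (p ^ m - 1) (t - 1) -> fixes m.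
  case=> [|H]; first exact: fixed_component_affine.
  exact: fixed_component_infinity.
have fix_order d : 2 < d /\ d %| t \/ 1 < d /\ d %| t - 1 -> fixes (e d).
  by case=> -[d_gt d_dvd]; apply: fix_gcd; [left|right];
    apply: leq_trans d_gt (dvdn_gcd_order p_prime _ _ d_dvd).
have [c|[[m [_ [[L [phi [cardL irrL]]] c]]]|[[s [uniq_s [s_sing s_lt]]]|[[_ c]|[[_ [k [k_gt0 k_dvd]]]|
  [[_ [t1_prime t1_order]]|[c|[g_irr c]]]]]]]] := cases.
- by have [|f comp_f fix_f] := fix_gcd 1; [rewrite expn1|case: (no_fixed f)].
- exact: (case_extension t_ge3 p_ndvd_t cardL irrL (fix_gcd m c)).
- exfalso; apply: (few_singular_points_absurd p_prime t_ge3 tK t1K no_fixed uniq_s _ s_lt).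
  by move=> a; rewrite s_sing extend_g_poly.
- exfalso; apply: (root_of_unity_condition_absurd p_prime t_ge3 tK t1K no_fixed t_even p_odd).
  by rewrite -subn1; exact: c.
- exfalso; apply: (order_condition_absurd p_prime t_ge3 tK t1K no_fixed t_even p_odd k_gt0).
  by rewrite -subn1.
- exfalso; rewrite subn1 in t1_prime t1_order.
  apply: (half_order_absurd p_prime t_ge3 tK t1K no_fixed t_even p_odd t1_prime).
  rewrite -/e t1_order mulnC divnK // dvdn2 oddB ?(negPf t_even) //.
  exact: ltnW.
- have [d fix_d gcd1] : exists2 d, fixes (e d) & gcdn (gcdn (e (t - 1)) (e t)) (e d) = 1.
    by case: c => -[d [d_gt [d_dvd gcd1]]]; exists d => //; apply: fix_order; [left|right].
  exact: (case_multiplicative_order t_ge3 p_ndvd_t p_t1 fix_d gcd1).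
apply: (case_irreducible g_irr _ c) => d d_ge3 /orP[] d_dvd; apply: fix_order.
  by left.
by right; split=> //; apply: ltnW.
Qed.
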